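(* Let $\pi:U\mathbb{H}^n\to\mathbb{H}^n$ be the unit tangent bundle of real hyperbolic space, equipped with the Sasaki metric $g^S$, and let $T(U\mathbb{H}^n)=\mathcal{H}\oplus\mathcal{V}$ be the $g^S$-orthogonal splitting into horizontal and vertical parts. Fix a Busemann function $b$ on $\mathbb{H}^n$, let $\xi=\nabla b$ be its gradient (a unit vector field), and let $\xi^b$ be the horizontal lift of $\xi$ to $U\mathbb{H}^n$. Let $$D_b=\{X\in\mathfrak{X}(U\mathbb{H}^n)\mid g^S(X,\xi^b)=0\}=(\ker db)^{\mathcal{H}}\oplus\mathcal{V},$$ where $(\ker db)^{\mathcal{H}}$ is the horizontal lift of $\ker db$. Suppose there is an affine connection $\nabla^b$ on $U\mathbb{H}^n$ with $\nabla^b\xi^b=0$, $\nabla^b g^S=0$, and torsion $T^b$ satisfying $T^b(X,Y)\in D_b$ for all $X,Y\in D_b$. Then $D_b$ is integrable, its leaves are totally geodesic for $\nabla^b$, and they coincide with the horospherical cylinders $$H_c:=\pi^{-1}(b^{-1}(c))\cong S_c\times S^{n-1},\qquad c\in\mathbb{R},$$ where $S_c$ is a horosphere in $\mathbb{H}^n$ (namely $S_c=b^{-1}(c)$).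
   Context: Real hyperbolic space: with $q(x,y)=-x_0y_0+\sum_{i=1}^n x_iy_i$ on $\mathbb{R}^{n+1}$, $\mathbb{H}^n=\{x\in\mathbb{R}^{n+1}\mid q(x,x)=-1,\ x_0>0\}$ with the Riemannian metric $g$ obtained by restricting $q$ to tangent spaces; its unit tangent bundle is $U\mathbb{H}^n=\{(x,v)\mid x\in\mathbb{H}^n,\ v\in T_x\mathbb{H}^n,\ g(v,v)=1\}$, with projection $\pi(x,v)=x$. $\mathfrak{X}(U\mathbb{H}^n)$ denotes the vector fields on $U\mathbb{H}^n$. Sasaki metric: for a curve $s(t)=(u(t),v(t))$ in $U\mathbb{H}^n$, i.e. a unit vector field $v(t)$ along a curve $u(t)$ in $\mathbb{H}^n$, $g^S(s'(t),s'(t))=g(u'(t),u'(t))+g\big(\tfrac{Dv}{dt},\tfrac{Dv}{dt}\big)$, where $\tfrac{D}{dt}$ is covariant differentiation along $u$ for the Levi-Civita connection of $g$. The vertical subbundle is $\mathcal{V}=\ker d\pi$. The horizontal subbundle $\mathcal{H}$ consists of the velocities of curves $(u(t),v(t))$ with $v$ parallel along $u$; it is the $g^S$-orthogonal complement of $\mathcal{V}$, and $d\pi$ maps $\mathcal{H}_{(x,v)}$ isometrically onto $T_x\mathbb{H}^n$. The horizontal lift of a vector (field) on $\mathbb{H}^n$ is its preimage in $\mathcal{H}$ under $d\pi$. Busemann function: a function of the form $b(x)=\lim_{t\to\infty}\big(d(x,\gamma(t))-t\big)$ for a unit-speed geodesic ray $\gamma$ in $\mathbb{H}^n$, where $d$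 is the hyperbolic distance. It is smooth with gradient of norm $1$; its level sets are called horospheres. The torsion is $T^b(X,Y)=\nabla^b_XY-\nabla^b_YX-[X,Y]$. The leaves of an integrable distribution are its maximal connected integral submanifolds. The leaves of $D_b$ are totally geodesic for $\nabla^b$ if $\nabla^b_XY\in D_b$ for all $X,Y\in D_b$; in particular $\nabla^b$-geodesics initially tangent to $D_b$ remain tangent to it. The symbol $\cong$ denotes diffeomorphism.
   Formalization: The dimension is assumed to be n ≥ 2: for n = 1 the distribution D_b is zero, its leaves are single points, and H_c ≅ S_c × S^0 consists of two points, so the leaves do not coincide with the H_c. *)

(* Defs.v *)
From HB Require Import structures.
From mathcomp Require Import all_boot all_order all_algebra.
From mathcomp Require Import all_classical all_reals all_analysis.
Set Implicit Arguments. Unset Strict Implicit. Unset Printing Implicit Defensive.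
Import Order.TTheory GRing.Theory Num.Theory numFieldNormedType.Exports.
Local Open Scope classical_set_scope.
Local Open Scope ring_scope.

(* Manifolds are smooth embedded submanifolds M of a finite-dimensional
   normed space E, given as sets M : set E. Maps, vector fields and tensors
   on M are represented by functions on the whole of E; only their values at
   points of M matter.  Objects determined by a property are selected with
   xget; the default value 0 is returned only off the intended domain. *)

Section Smooth.
Context {R : realType}.

(* C^k on an open set U, by iterated directional derivatives (E is meant to be
   finite-dimensional). *)
Fixpoint Ck_on {E F : normedModType R} (k : nat) (U : set E) (f : E -> F)
    : Prop :=
  match k with
  | 0 => forall x, U x -> {for x, continuous f}
  | k'.+1 => (forall x, U x -> differentiable f x) /\
             (forall v : E, Ck_on k' U ('D_v f))
  end.

Definition smooth_at {E F : normedModType R} (f : E -> F) (x : E) : Prop :=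
  exists U : set E, [/\ open U, U x & forall k, Ck_on k U f].

(* F is a smooth extension of f|M to a neighbourhood of p in E. *)
Definition local_extension {E F : normedModType R} (M : set E) (f : E -> F)
    (p : E) (g : E -> F) : Prop :=
  smooth_at g p /\ \forall x \near p, M x -> g x = f x.

Definition smooth_map {E F : normedModType R} (M : set E) (f : E -> F)
    : Prop :=
  forall p, M p -> exists g, local_extension M f p g.

Definition diffeomorphic {E F : normedModType R} (M : set E) (N : set F)
    : Prop :=
  exists (f : E -> F) (h : F -> E),
    [/\ smooth_map M f /\ (forall x, M x -> N (f x)),
        smooth_map N h /\ (forall y, N y -> M (h y)),
        (forall x, M x -> h (f x) = x) & (forall y, N y -> f (h y) = y)].

(* c : R -> E restricts to a smooth curve in M on a neighbourhood of t. *)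
Definition curve_at {E : normedModType R} (M : set E) (c : R -> E) (t : R)
    : Prop :=
  smooth_at c t /\ \forall s \near t, M (c s).

Definition tangent {E : normedModType R} (M : set E) (p : E) : set E :=
  [set w | exists c : R -> E, [/\ curve_at M c 0, c 0 = p & 'D_1 c 0 = w]].

(* The differential of f : M -> F at p, for w in T_p M; it does not depend on
   the chosen local extension. *)
Definition tdiff {E F : normedModType R} (M : set E) (f : E -> F) (p w : E)
    : F :=
  xget 0 [set 'D_w g p | g in local_extension M f p].

End Smooth.

Section Connections.
Context {R : realType} {E : normedModType R}.
Implicit Types (M : set E) (X Y Z : E -> E) (f h : E -> R).
Implicit Types (g : E -> E -> E -> R) (nabla : (E -> E) -> (E -> E) -> E -> E).

Definition vfield M X : Prop :=
  smooth_map M X /\ forall p, M p -> tangent M p (X p).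

Definition vderiv M X f : E -> R := fun p => tdiff M f p (X p).

(* For fields on a submanifold of a vector space, [X, Y] = D_X Y - D_Y X with
   D the flat derivative of the ambient space. *)
Definition lie_bracket M X Y : E -> E :=
  fun p => tdiff M Y p (X p) - tdiff M X p (Y p).

Record affine_connection M nabla : Prop := {
  conn_vfield : forall X Y, vfield M X -> vfield M Y -> vfield M (nabla X Y);
  conn_ext : forall X X' Y Y',
    vfield M X -> vfield M X' -> vfield M Y -> vfield M Y' ->
    {in M, X =1 X'} -> {in M, Y =1 Y'} -> {in M, nabla X Y =1 nabla X' Y'};
  conn_linl : forall f h X X' Y, smooth_map M f -> smooth_map M h ->
    vfield M X -> vfield M X' -> vfield M Y ->
    {in M, nabla (fun p => f p *: X p + h p *: X' p) Y
           =1 fun p => f p *: nabla X Y p + h p *: nabla X' Y p};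
  conn_addr : forall X Y Y', vfield M X -> vfield M Y -> vfield M Y' ->
    {in M, nabla X (fun p => Y p + Y' p)
           =1 fun p => nabla X Y p + nabla X Y' p};
  conn_leibniz : forall f X Y, smooth_map M f -> vfield M X -> vfield M Y ->
    {in M, nabla X (fun p => f p *: Y p)
           =1 fun p => vderiv M X f p *: Y p + f p *: nabla X Y p}
}.

Definition torsion M nabla X Y : E -> E :=
  fun p => nabla X Y p - nabla Y X p - lie_bracket M X Y p.

(* nabla g = 0 *)
Definition metric_compatible M g nabla : Prop :=
  forall X Y Z, vfield M X -> vfield M Y -> vfield M Z -> forall p, M p ->
    vderiv M X (fun x => g x (Y x) (Z x)) p
    = g p (nabla X Y p) (Z p) + g p (Y p) (nabla X Z p).

Definition levi_civita M g : (E -> E) -> (E -> E) -> E -> E :=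
  xget (fun _ _ _ => 0)
    [set nabla | [/\ affine_connection M nabla, metric_compatible M g nabla
      & forall X Y, vfield M X -> vfield M Y -> forall p, M p ->
          torsion M nabla X Y p = 0]].

(* Covariant derivative (Dw/dt)(t) of a field w along a curve u in M: writing
   w(s) = \sum_i a_i(s) Y_i(u(s)) for s near t, with vector fields Y_i on M,
   Dw/dt = \sum_i (a_i' Y_i + a_i nabla_{u'} Y_i). *)
Definition cov_deriv M nabla (u w : R -> E) (t : R) : E :=
  xget 0 [set z | exists (k : nat) (a : 'I_k -> R -> R) (Y : 'I_k -> E -> E)
                         (X : E -> E),
    [/\ vfield M X /\ X (u t) = 'D_1 u t,
        forall i, smooth_at (a i) t /\ vfield M (Y i),
        \forall s \near t, w s = \sum_(i < k) a i s *: Y i (u s)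
      & z = \sum_(i < k) ('D_1 (a i) t *: Y i (u t)
                          + a i t *: nabla X (Y i) (u t))]].

(* Riemannian gradient *)
Definition grad M g f (p : E) : E :=
  xget 0 [set a | tangent M p a /\
                  forall w, tangent M p w -> g p a w = tdiff M f p w].

Definition curve_length g (c : R -> E) : R :=
  \int[lebesgue_measure]_(t in `[0, 1]) Num.sqrt (g (c t) ('D_1 c t) ('D_1 c t)).

(* Riemannian distance; minimizing over smooth instead of piecewise smooth
   curves gives the same infimum. *)
Definition rdist M g (x y : E) : R :=
  inf [set curve_length g c | c in
    [set c | [/\ forall t, 0 <= t <= 1 -> curve_at M c t, c 0 = x & c 1 = y]]].

Definition geodesic_ray M g (c : R -> E) : Prop :=
  forall t, 0 <= t ->
    [/\ curve_at M c t, cov_deriv M (levi_civita M g) c ('D_1 c) t = 0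
      & g (c t) ('D_1 c t) ('D_1 c t) = 1].

Definition busemann_fun M g f : Prop :=
  exists2 c, geodesic_ray M g c
    & forall x, M x -> rdist M g x (c t) - t @[t --> +oo] --> f x.

End Connections.

Section Foliations.
Context {R : realType} {E : normedModType R}.
Implicit Types (M N : set E) (D : E -> set E).

Definition dsection M D (X : E -> E) : Prop :=
  vfield M X /\ forall p, M p -> D p (X p).

(* N with an atlas of countably many parametrizations phi_i : U_i -> N making
   it an injectively immersed k-dimensional submanifold of E; the topology and
   smooth structure are those of the atlas and may be finer than the induced
   ones. As each phi_i is an immersion into E, the last field makes the changes
   of charts smooth. *)
Record immersed_atlas (k : nat) N (U : nat -> set 'rV[R]_k)
    (phi : nat -> 'rV[R]_k -> E) : Prop := {
  atlas_open : forall i, open (U i);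
  atlas_smooth : forall i u, U i u -> smooth_at (phi i) u;
  atlas_inj : forall i, {in U i &, injective (phi i)};
  atlas_immersion : forall i u, U i u -> injective ('d (phi i) u);
  atlas_cover : N = \bigcup_i (phi i @` U i);
  atlas_compat : forall i j V, open V -> V `<=` U i ->
    open (U j `&` phi j @^-1` (phi i @` V))
}.

Definition atlas_connected (k : nat) N (U : nat -> set 'rV[R]_k)
    (phi : nat -> 'rV[R]_k -> E) : Prop :=
  let lopen A := forall i, open (U i `&` phi i @^-1` A) in
  forall A, A `<=` N -> A !=set0 -> lopen A -> lopen (N `\` A) -> A = N.

Definition integral_atlas M D (k : nat) N (U : nat -> set 'rV[R]_k)
    (phi : nat -> 'rV[R]_k -> E) : Prop :=
  [/\ immersed_atlas N U phi, N `<=` M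
    & forall i u, U i u -> range ('d (phi i) u) = D (phi i u)].

Definition integral_submanifold M D N : Prop :=
  exists k U phi, @integral_atlas M D k N U phi.

Definition connected_integral_submanifold M D N : Prop :=
  exists k U phi, @integral_atlas M D k N U phi /\ atlas_connected N U phi.

Definition involutive_distribution M D : Prop :=
  forall X Y, dsection M D X -> dsection M D Y ->
    dsection M D (lie_bracket M X Y).

Definition integrable_distribution M D : Prop :=
  forall p, M p -> exists2 N, integral_submanifold M D N & N p.

Definition leaf M D N : Prop :=
  [/\ connected_integral_submanifold M D N, N !=set0
    & forall N', connected_integral_submanifold M D N' -> N `<=` N' -> N' = N].

Definition direct_sum (A B C : set E) : Prop :=
  A = [set x + y | x in B & y in C] /\ B `&` C = [set 0].

End Foliations.

Section Hyperbolic.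
Context {R : realType}.

Definition lorentz (n : nat) (x y : 'rV[R]_n.+1) : R :=
  - (x 0 ord0 * y 0 ord0)
  + \sum_(i < n) x 0 (lift ord0 i) * y 0 (lift ord0 i).

Definition hyp (n : nat) : set 'rV[R]_n.+1 :=
  [set x | lorentz x x = -1 /\ 0 < x 0 ord0].
Arguments hyp n : clear implicits.

Definition hyp_metric (n : nat) (_ a w : 'rV[R]_n.+1) : R := lorentz a w.

Definition hyp_conn (n : nat) := levi_civita (hyp n) (@hyp_metric n).
Arguments hyp_conn n : clear implicits.

Definition unit_sphere (n : nat) : set 'rV[R]_n :=
  [set y | \sum_(i < n) y 0 i ^+ 2 = 1].

Definition UT (n : nat) : set ('rV[R]_n.+1 * 'rV[R]_n.+1) :=
  [set p | [/\ hyp n p.1, tangent (hyp n) p.1 p.2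
             & hyp_metric p.1 p.2 p.2 = 1]].
Arguments UT n : clear implicits.

Section UnitTangent.
Context {n : nat}.
Local Notation V := ('rV[R]_n.+1).
Local Notation W := (V * V)%type.
Implicit Types (p z e : W) (b : V -> R).

Definition utproj p : V := p.1.

Definition dproj p z : V := tdiff (UT n) utproj p z.

(* The connection map: s'(0) |-> (Dv/dt)(0) for curves s = (u, v) in UH^n *)
Definition connector p z : V :=
  xget 0 [set k | exists s : R -> W,
    [/\ curve_at (UT n) s 0, s 0 = p, 'D_1 s 0 = z
      & k = cov_deriv (hyp n) (hyp_conn n) (fst \o s) (snd \o s) 0]].

(* Polarization of the quadratic form defining the Sasaki metric *)
Definition sasaki p z e : R :=
  hyp_metric p.1 (dproj p z) (dproj p e)
  + hyp_metric p.1 (connector p z) (connector p e).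

Definition vertical p : set W := [set z | tangent (UT n) p z /\ dproj p z = 0].

Definition horizontal p : set W :=
  [set z | exists s : R -> W,
    [/\ curve_at (UT n) s 0, s 0 = p, 'D_1 s 0 = z
      & \forall t \near (0 : R),
          cov_deriv (hyp n) (hyp_conn n) (fst \o s) (snd \o s) t = 0]].

Definition hlift p (a : V) : W :=
  xget 0 [set z | horizontal p z /\ dproj p z = a].

Definition busemann b : Prop := busemann_fun (hyp n) (@hyp_metric n) b.

Definition xi b : V -> V := grad (hyp n) (@hyp_metric n) b.

Definition xi_lift b : W -> W := fun p => hlift p (xi b p.1).

Definition Db b p : set W :=
  [set z | tangent (UT n) p z /\ sasaki p z (xi_lift b p) = 0].

Definition ker_db_lift b p : set W :=
  hlift p @` [set a | tangent (hyp n) p.1 a /\ tdiff (hyp n) b p.1 a = 0].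

Definition horosphere b (c : R) : set V := hyp n `&` b @^-1` [set c].

Definition horocylinder b (c : R) : set W := UT n `&` utproj @^-1` horosphere b c.

End UnitTangent.
End Hyperbolic.

Arguments hyp R n : clear implicits.
Arguments UT R n : clear implicits.
Arguments unit_sphere R n : clear implicits.

(* Main.v *)
(* A geodesic ray has acceleration equal to its position, so it is
   cosh t x0 + sinh t u0, and with the null vector om = x0 + u0 the Busemann
   function is b = ln (- q (x, om)): the function ln (- q (x, om)) has unit
   gradient, which bounds lengths of curves from below, and explicit geodesics
   give the matching upper bound for the distance. Hence D_b consists of the
   tangent vectors (a, w) of UH^n with q (a, om) = 0. Metric compatibility and
   nabla xi^b = 0 give nabla_X Y in D_b for sections X, Y of D_b, and then
   [X, Y] = nabla_X Y - nabla_Y X - T (X, Y) lies in D_b. Each horospherical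
   cylinder q (x, om) = - exp c is covered by two overlapping charts
   (horospherical coordinates times stereographic projections in a frame of the
   horosphere), so it is a connected integral submanifold. Conversely
   q (x, om) has zero differential on D_b, so every connected integral
   submanifold lies in one cylinder. *)
Require Import Defs.
From HB Require Import structures.
From mathcomp Require Import all_boot all_order all_algebra.
From mathcomp Require Import all_classical all_reals all_analysis.
From mathcomp Require Import ring lra.
Set Implicit Arguments. Unset Strict Implicit. Unset Printing Implicit Defensive.
Import Order.TTheory GRing.Theory Num.Theory numFieldNormedType.Exports.
Local Open Scope classical_set_scope.
Local Open Scope ring_scope.

(** * Iterated directional derivatives *)

(** The geometric objects in the definitions are selected by [xget]: differentials, the Levi-Civita
    connection, covariant derivatives, the connection map, gradients, horizontal lifts. Each has to
    be shown to exist and to be unique before it can be computed, so much of the proof replaces them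
    by closed formulas in the ambient Lorentz space. The recurring device is to differentiate a
    constraint along a curve and to compare two derivatives with [is_derive_unique]. After that only
    linear algebra for [q] remains. Leaves compete with immersed submanifolds whose topology may be
    finer than the induced one, so constancy of [q (x, om)] has to be checked in the charts of an
    arbitrary atlas. This works because the functional is linear on the whole ambient space. The
    condition [2 <= n] enters through connectedness: for [n = 1] a horosphere is a point, the fibre
    [S^0] has two points, and a cylinder falls apart. For [n >= 2] a unit vector tangent to the
    horosphere provides a point lying in both charts. *)

Section CkCalculus.
Context {R : realType}.
Implicit Types (E F G : normedModType R).

(** The difference [g - f] vanishes near [x], hence is little-o of the increment and differentiable
    with differential zero; adding it to [f] gives [g]. *)
Lemma near_eq_differentiable E F (f g : E -> F) (x : E) :
  (\forall y \near x, f y = g y) -> differentiable f x -> differentiable g x.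
Proof.
move=> fg df; pose h := g - f.
have hx : h x = 0 by rewrite /h !fctE (nbhs_singleton fg) subrr.
have ho : h \o shift x =o_ (0 : E) id.
  apply/eqoP => _/posnumP[e] /=.
  have : \forall y \near (0 : E), f (y + x) = g (y + x).
    by have := fg; rewrite (near_shift 0 x); apply: filterS => y; rewrite /= subr0.
  apply: filterS => y e1.
  by rewrite /h /= !fctE e1 subrr normr0 mulr_ge0.
suff : differentiable h x.
  by move=> dh; rewrite -[g](subrK f); apply: differentiableD.
have E0 : h \o shift x = cst (h x) + \0 +o_ (0 : E) id.
  by apply: eqaddoE; rewrite hx ho addr0 add0r.
have c0 : continuous (\0 : E -> F) by exact: cst_continuous.
have d0 := diff_unique c0 E0.
by apply/diff_locallyP; rewrite d0.
Qed.

Lemma Ck_on_sub E F k (U V : set E) (f : E -> F) :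
  V `<=` U -> Ck_on k U f -> Ck_on k V f.
Proof.
elim: k f => [|k IH] f VU /=; first by move=> h x /VU /h.
by move=> [df Df]; split=> [x /VU /df //|v]; apply: IH.
Qed.

Lemma Ck_on_eq E F k (U : set E) (f g : E -> F) :
  open U -> (forall x, U x -> f x = g x) -> Ck_on k U f -> Ck_on k U g.
Proof.
move=> oU; elim: k f g => [|k IH] f g fg /=.
  move=> cf x Ux; have nfg : \forall y \near x, f y = g y.
    by apply: filterS (open_nbhs_nbhs (conj oU Ux)) => y /fg.
  rewrite /prop_for/continuous_at -fg//; apply: cvg_trans (cf x Ux).
  exact: near_eq_cvg.
move=> [df Df].
have nfg x : U x -> \forall y \near x, f y = g y.
  by move=> Ux; apply: filterS (open_nbhs_nbhs (conj oU Ux)) => y /fg.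
split=> [x Ux|v]; last first.
  by apply: IH (Df v) => x Ux; apply: near_eq_derive; exact: nfg.
by apply: near_eq_differentiable (df x Ux); exact: nfg.
Qed.

Lemma Ck_onW E F k (U : set E) (f : E -> F) : Ck_on k.+1 U f -> Ck_on k U f.
Proof.
elim: k f => [|k IH] f [df Df].
  by move=> x /df; exact: differentiable_continuous.
by split=> // v; apply: IH; exact: Df.
Qed.

Lemma Ck_on_cst E F k (U : set E) (a : F) : Ck_on k U (cst a : E -> F).
Proof.
elim: k a => [|k IH] a /=; first by move=> x _; exact: cst_continuous.
split=> [x _|v]; first exact: differentiable_cst.
rewrite (_ : 'D_v (cst a) = cst 0); first exact: IH.
by apply/funext => x; rewrite derive_cst.
Qed.

Lemma Ck_on_linear E F k (U : set E) (f : {linear E -> F}) :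
  continuous f -> Ck_on k U f.
Proof.
move=> cf; case: k => [|k] /=; first by move=> x _; exact: cf.
split=> [x _|v]; first exact: linear_differentiable.
rewrite (_ : 'D_v f = cst (f v)); first exact: Ck_on_cst.
apply/funext => x; rewrite deriveE; last exact: linear_differentiable.
by rewrite diff_lin.
Qed.

Lemma Ck_onD E F k (U : set E) (f g : E -> F) :
  open U -> Ck_on k U f -> Ck_on k U g -> Ck_on k U (f + g).
Proof.
move=> oU; elim: k f g => [|k IH] f g.
  by move=> cf cg x Ux; apply: continuousD; [exact: cf|exact: cg].
move=> [df Df] [dg Dg]; split=> [x Ux|v].
  by apply: differentiableD; [exact: df|exact: dg].
apply: Ck_on_eq (IH _ _ (Df v) (Dg v)) => // x Ux.
by rewrite deriveD//; apply: diff_derivable; [exact: df|exact: dg].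
Qed.

Lemma Ck_on_sum E F k (U : set E) (I : finType) (f : I -> E -> F) : open U ->
  (forall i, Ck_on k U (f i)) -> Ck_on k U (fun x => \sum_i f i x).
Proof.
move=> oU fk; elim: index_enum => [|i r IH].
  by apply: (Ck_on_eq oU _ (@Ck_on_cst E F k U 0)) => x _; rewrite big_nil.
by apply: (Ck_on_eq oU _ (Ck_onD oU (fk i) IH)) => x _; rewrite big_cons.
Qed.

Section Bilinear.
Variables (E1 E2 F : normedModType R) (B : {bilinear E1 -> E2 -> F}).
Hypothesis cB : continuous (fun p : E1 * E2 => B p.1 p.2).

Lemma differentiable_bilin_comp E (f : E -> E1) (g : E -> E2) x :
  differentiable f x -> differentiable g x ->
  differentiable (fun y => B (f y) (g y)) x.
Proof.
move=> df dg.
apply: (@differentiable_comp _ _ _ _ (fun y => (f y, g y)) (fun p => B p.1 p.2)).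
  exact: differentiable_pair.
exact: differentiable_bilin.
Qed.

Lemma derive_bilin_comp E (f : E -> E1) (g : E -> E2) x v :
  differentiable f x -> differentiable g x ->
  'D_v (fun y => B (f y) (g y)) x = B ('D_v f x) (g x) + B (f x) ('D_v g x).
Proof.
move=> df dg; rewrite deriveE; last exact: differentiable_bilin_comp.
have -> : 'd (fun y => B (f y) (g y)) x
  = 'd ((fun p => B p.1 p.2) \o (fun y => (f y, g y))) x by [].
rewrite diff_comp/=; last 2 first.
- exact: differentiable_pair.
- exact: differentiable_bilin.
by rewrite diff_bilin// diff_pair//= !deriveE// addrC.
Qed.

(** By the Leibniz rule a directional derivative is a sum of two terms of the same shape, each
    pairing a derivative with an undifferentiated factor; the latter is lowered one order by
    [Ck_onW] so that the induction applies. *)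
Lemma Ck_on_bilin E k (U : set E) (f : E -> E1) (g : E -> E2) : open U ->
  Ck_on k U f -> Ck_on k U g -> Ck_on k U (fun y => B (f y) (g y)).
Proof.
move=> oU; elim: k f g => [|k IH] f g.
  move=> cf cg x Ux.
  apply: (@continuous_comp _ _ _ (fun y => (f y, g y)) (fun p => B p.1 p.2)).
    by apply: cvg_pair; [exact: cf|exact: cg].
  exact: cB.
move=> Cf Cg; have [df Df] := Cf; have [dg Dg] := Cg; split=> [x Ux|v].
  by apply: differentiable_bilin_comp; [exact: df|exact: dg].
apply: (Ck_on_eq oU _ (Ck_onD oU (IH _ _ (Df v) (Ck_onW Cg))
  (IH _ _ (Ck_onW Cf) (Dg v)))).
by move=> x Ux; rewrite derive_bilin_comp//; [exact: df|exact: dg].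
Qed.

End Bilinear.

Lemma scaler_is_bilinear E :
  bilinear_for
    (GRing.Scale.Law.clone _ _ *:%R _) (GRing.Scale.Law.clone _ _ *:%R _)
    (@GRing.scale R E).
Proof.
split=> [u'|u] a x y /=.
- by rewrite scalerDl scalerA.
- by rewrite scalerDr !scalerA mulrC.
Qed.
HB.instance Definition _ E := bilinear_isBilinear.Build R R E E _ _
  (@GRing.scale R E) (@scaler_is_bilinear E).

Lemma Ck_onZ E F k (U : set E) (a : E -> R) (f : E -> F) : open U ->
  Ck_on k U a -> Ck_on k U f -> Ck_on k U (fun y => a y *: f y).
Proof.
move=> oU Ca Cf.
by apply: (@Ck_on_bilin _ _ _ (@GRing.scale R F)) => //; exact: scale_continuous.
Qed.

Lemma Ck_on_pair E F G k (U : set E) (f : E -> F) (g : E -> G) : open U ->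
  Ck_on k U f -> Ck_on k U g -> Ck_on k U (fun y => (f y, g y)).
Proof.
move=> oU; elim: k f g => [|k IH] f g.
  by move=> cf cg x Ux; apply: cvg_pair; [exact: cf|exact: cg].
move=> [df Df] [dg Dg]; split=> [x Ux|v].
  by apply: differentiable_pair; [exact: df|exact: dg].
apply: (Ck_on_eq oU _ (IH _ _ (Df v) (Dg v))) => x Ux.
have [dfx dgx] := (df x Ux, dg x Ux).
rewrite [RHS]deriveE; last exact: differentiable_pair.
by rewrite (diff_pair dfx dgx) (deriveE _ dfx) (deriveE _ dgx).
Qed.

(** Finite dimension in the form the chain rule needs. The derivative of [g \o f] differentiates [g]
    in the moving direction ['D_v f x], whereas [Ck_on] controls fixed directions only; expanding in
    the [e i] reduces the former to the latter. *)
Definition finite_coordinates E := exists (I : finType) (e : I -> E)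
    (l : I -> {linear E -> R}),
  (forall i, continuous (l i)) /\ forall x, x = \sum_i l i x *: e i.

Lemma derive_coordinates E F (I : finType) (e : I -> E)
    (l : I -> {linear E -> R}) (f : E -> F) x v :
  (forall y, y = \sum_i l i y *: e i) -> differentiable f x ->
  'D_v f x = \sum_i l i v *: 'D_(e i) f x.
Proof.
move=> el df; rewrite (deriveE _ df) [in LHS](el v) linear_sum.
by apply: eq_bigr => i _; rewrite linearZ/= (deriveE _ df).
Qed.

Lemma derive_comp E F G (f : E -> F) (g : F -> G) x v :
  differentiable f x -> differentiable g (f x) ->
  'D_v (g \o f) x = 'D_('D_v f x) g (f x).
Proof.
move=> df dg; rewrite (deriveE _ dg) (deriveE _ df).
rewrite deriveE; last exact: differentiable_comp.
by rewrite (diff_comp df dg).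
Qed.

Lemma Ck_on_linear_comp E F G k (U : set E) (f : E -> F) (l : {linear F -> G}) :
  continuous l -> open U -> Ck_on k U f -> Ck_on k U (l \o f).
Proof.
move=> cl oU; elim: k f => [|k IH] f Cf.
  by move=> x Ux; apply: continuous_comp; [exact: Cf|exact: cl].
have [df Df] := Cf; split=> [x Ux|w].
  by apply: differentiable_comp; [exact: df|exact: linear_differentiable].
apply: (Ck_on_eq oU _ (IH _ (Df w))) => x Ux.
have dl : differentiable l (f x) by exact: linear_differentiable.
by rewrite (derive_comp _ (df x Ux) dl) (deriveE _ dl) diff_lin.
Qed.

Lemma Ck_on_comp E F G k (U : set E) (V : set F) (f : E -> F) (g : F -> G) :
  finite_coordinates F -> open U -> open V -> (forall x, U x -> V (f x)) ->
  Ck_on k U f -> Ck_on k V g -> Ck_on k U (g \o f).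
Proof.
move=> [I [e [l [cl el]]]] oU oV fUV; elim: k f g fUV => [|k IH] f g fUV Cf Cg.
  move=> x Ux; apply: continuous_comp; first exact: Cf.
  by apply: Cg; exact: fUV.
have [[df Df] [dg Dg]] := (Cf, Cg); split=> [x Ux|v].
  by apply: differentiable_comp; [exact: df|apply: dg; exact: fUV].
have CD i : Ck_on k U ('D_(e i) g \o f).
  by apply: IH => //; [exact: Ck_onW|exact: Dg].
have Cl i : Ck_on k U (l i \o 'D_v f) by exact: Ck_on_linear_comp (cl i) oU (Df v).
apply: (Ck_on_eq oU _ (Ck_on_sum oU (fun i => Ck_onZ oU (Cl i) (CD i)))).
move=> x Ux /=; have dgx := dg _ (fUV x Ux).
by rewrite [RHS](derive_comp _ (df x Ux) dgx) (derive_coordinates _ el dgx).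
Qed.

Lemma finite_coordinatesR : finite_coordinates R.
Proof.
exists unit, (fun=> 1), (fun=> idfun); split=> [_ x|x]; first exact: cvg_id.
by rewrite big_const card_unit /= addr0 /GRing.scale /= mulr1.
Qed.

Lemma finite_coordinates_prod E F :
  finite_coordinates E -> finite_coordinates F -> finite_coordinates (E * F)%type.
Proof.
move=> [I [e [l [cl el]]]] [J [f [m [cm em]]]].
pose h (i : I + J) : E * F := match i with inl i => (e i, 0) | inr j => (0, f j) end.
pose k (i : I + J) : {linear (E * F)%type -> R} :=
  match i with inl i => l i \o fst | inr j => m j \o snd end.
exists (I + J)%type, h, k; split=> [[i|j] x|[x y]].
- by apply: continuous_comp; [exact: cvg_fst|exact: cl].
- by apply: continuous_comp; [exact: cvg_snd|exact: cm].
rewrite big_sumType/= [RHS]surjective_pairing; congr pair.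
  rewrite (raddfD fst) !(raddf_sum fst)/= [X in _ + X]big1 ?addr0// => i _.
  exact: scaler0.
rewrite (raddfD snd) !(raddf_sum snd)/= [X in X + _]big1 ?add0r// => i _.
exact: scaler0.
Qed.

Definition rV_coord n (j : 'I_n) (x : 'rV[R]_n) : R := x 0 j.

Lemma rV_coord_is_linear n (j : 'I_n) : linear (rV_coord j).
Proof. by move=> a x y; rewrite /rV_coord !mxE. Qed.
HB.instance Definition _ n (j : 'I_n) := GRing.isLinear.Build R 'rV[R]_n R _
  (rV_coord j) (rV_coord_is_linear j).

Lemma finite_coordinates_rV n : finite_coordinates 'rV[R]_n.
Proof.
exists 'I_n, (fun j => delta_mx 0 j), (fun j => rV_coord j); split=> [i|x].
  exact: coord_continuous.
by rewrite {1}(row_sum_delta x).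
Qed.

(** On the line every direction is a multiple of [1], so one explicit derivative suffices. For the
    inverse, the square root and the exponential this derivative is built from the function itself
    and functions already treated, which closes an induction on [k]. *)
Lemma Ck_on_derive1 k (U : set R) (f g : R -> R) : open U ->
  (forall x, U x -> is_derive x 1 f (g x)) -> Ck_on k U g -> Ck_on k.+1 U f.
Proof.
move=> oU fg Cg; split=> [x Ux|v].
  by apply/derivable1_diffP; have [] := fg x Ux.
apply: (Ck_on_eq oU _ (Ck_onZ oU (@Ck_on_cst R R k U v) Cg)) => x Ux.
have [dx <-] := fg x Ux; rewrite !deriveE -?derivable1_diffP//.
by rewrite -linearZ/= /GRing.scale/= mulr1.
Qed.

Lemma Ck_on_inv k : Ck_on k (~` [set 0 : R]) (@GRing.inv R).
Proof.
have oU : open (~` [set 0 : R]) by apply: closed_openC; exact: closed_eq.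
elim: k => [|k IH].
  by move=> x /eqP x0; apply: inv_continuous.
apply: (Ck_on_derive1 oU (g := fun x => - 1 *: (x^-1 *: x^-1 : R))).
  move=> x /eqP x0; have := @is_deriveV _ id x 1 1 x0 (is_derive_id _ _).
  by rewrite /GRing.scale/= mulr1 mulN1r -expr2 exprVn.
apply: Ck_onZ => //; first exact: Ck_on_cst.
exact: Ck_onZ.
Qed.

Let openpos : open [set x : R | 0 < x]. Proof. exact: open_gt. Qed.

Lemma Ck_on_sqrt k : Ck_on k [set x : R | 0 < x] Num.sqrt.
Proof.
elim: k => [|k IH]; first by move=> x _; exact: sqrt_continuous.
apply: (Ck_on_derive1 openpos
  (g := fun x => 2^-1 *: (Num.sqrt x *: x^-1 : R))).
  move=> x /= x0; apply: (is_derive_eq (is_derive1_sqrt x0)).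
  rewrite /GRing.scale/= invfM; congr (_ * _).
  by rewrite -{3}(sqr_sqrtr (ltW x0)) expr2 invfM mulrA divff ?mul1r// sqrtr_eq0 -ltNge.
apply: Ck_onZ => //; first exact: Ck_on_cst.
apply: Ck_onZ => //; apply: Ck_on_sub (Ck_on_inv k) => x /= x0 x1.
by move: x0; rewrite x1 ltxx.
Qed.

Lemma Ck_on_ln k : Ck_on k [set x : R | 0 < x] (@ln R).
Proof.
case: k => [|k]; first by move=> x /= x0; exact: continuous_ln.
have posU : [set x : R | 0 < x] `<=` ~` [set 0].
  by move=> x /= x0 x1; move: x0; rewrite x1 ltxx.
exact: (Ck_on_derive1 openpos _ (Ck_on_sub posU (Ck_on_inv k))).
Qed.

Lemma Ck_on_expR k : Ck_on k setT (@expR R).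
Proof.
elim: k => [|k IH]; first by move=> x _; exact: continuous_expR.
by apply: (Ck_on_derive1 openT (g := @expR R)) => // x _; exact: is_derive_expR.
Qed.

End CkCalculus.

(** * Smooth maps and differentials on embedded submanifolds *)

Section SmoothAt.
Context {R : realType}.
Implicit Types (E F G : normedModType R) (t : R).

Lemma near_open_set E (x : E) (P : set E) : (\forall y \near x, P y) ->
  exists U, [/\ open U, U x & U `<=` P].
Proof.
move=> nP; exists (interior P); split; first exact: open_interior.
- exact: nP.
- exact: interior_subset.
Qed.

Lemma smooth_at_eq E F (f g : E -> F) x :
  (\forall y \near x, f y = g y) -> smooth_at f x -> smooth_at g x.
Proof.
move=> /near_open_set[V [oV Vx fg]] [U [oU Ux Cf]].
exists (U `&` V); split=> // [|k]; first exact: openI.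
apply: (@Ck_on_eq _ _ _ _ _ f); first exact: openI.
- by move=> y [_ /fg].
- by apply: Ck_on_sub (Cf k) => y [].
Qed.

Lemma smooth_at_near E F (f : E -> F) x :
  smooth_at f x -> \forall y \near x, smooth_at f y.
Proof.
move=> [U [oU Ux Cf]]; apply: filterS (open_nbhs_nbhs (conj oU Ux)) => y Uy.
by exists U.
Qed.

Lemma smooth_at_differentiable E F (f : E -> F) x :
  smooth_at f x -> differentiable f x.
Proof. by move=> [U [oU Ux /(_ 1)[+ _]]]; exact. Qed.

Lemma smooth_at_continuous E F (f : E -> F) x :
  smooth_at f x -> {for x, continuous f}.
Proof. by move=> [U [oU Ux /(_ 0)]]; exact. Qed.

Lemma smooth_at_derive E F (f : E -> F) x v :
  smooth_at f x -> smooth_at ('D_v f) x.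
Proof.
by move=> [U [oU Ux Cf]]; exists U; split=> // k; have [_] := Cf k.+1; exact.
Qed.

Lemma smooth_at_cst E F (a : F) (x : E) : smooth_at (fun=> a) x.
Proof. by exists setT; split=> // [|k]; [exact: openT|exact: Ck_on_cst]. Qed.

Lemma smooth_at_linear E F (f : {linear E -> F}) (x : E) :
  continuous f -> smooth_at f x.
Proof.
by move=> cf; exists setT; split=> // [|k]; [exact: openT|exact: Ck_on_linear].
Qed.

Lemma smooth_at_id E (x : E) : smooth_at (fun y => y) x.
Proof. by apply: (@smooth_at_linear E E idfun) => y; exact: cvg_id. Qed.

Lemma smooth_at_fst E F (x : E * F) : smooth_at (fst : E * F -> E) x.
Proof.
apply: (@smooth_at_linear _ _ (fst : {linear (E * F)%type -> E})) => y.
exact: cvg_fst.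
Qed.

Lemma smooth_at_snd E F (x : E * F) : smooth_at (snd : E * F -> F) x.
Proof.
apply: (@smooth_at_linear _ _ (snd : {linear (E * F)%type -> F})) => y.
exact: cvg_snd.
Qed.

Lemma smooth_at_common E F G (f : E -> F) (g : E -> G) x :
  smooth_at f x -> smooth_at g x ->
  exists U, [/\ open U, U x, forall k, Ck_on k U f & forall k, Ck_on k U g].
Proof.
move=> [U [oU Ux Cf]] [V [oV Vx Cg]]; exists (U `&` V); split=> //.
- exact: openI.
- by move=> k; apply: Ck_on_sub (Cf k) => y [].
- by move=> k; apply: Ck_on_sub (Cg k) => y [].
Qed.

Lemma smooth_atD E F (f g : E -> F) x :
  smooth_at f x -> smooth_at g x -> smooth_at (fun y => f y + g y) x.
Proof.
move=> /smooth_at_common H /H[U [oU Ux Cf Cg]]; exists U; split=> // k.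
exact: Ck_onD.
Qed.

Lemma smooth_at_bilin (E1 E2 F : normedModType R) (B : {bilinear E1 -> E2 -> F})
    E (f : E -> E1) (g : E -> E2) x :
  continuous (fun p : E1 * E2 => B p.1 p.2) ->
  smooth_at f x -> smooth_at g x -> smooth_at (fun y => B (f y) (g y)) x.
Proof.
move=> cB /smooth_at_common H /H[U [oU Ux Cf Cg]]; exists U; split=> // k.
exact: Ck_on_bilin.
Qed.

Lemma smooth_atZ E F (a : E -> R) (f : E -> F) x :
  smooth_at a x -> smooth_at f x -> smooth_at (fun y => a y *: f y) x.
Proof.
move=> /smooth_at_common H /H[U [oU Ux Cf Cg]]; exists U; split=> // k.
exact: Ck_onZ.
Qed.

Lemma smooth_atM E (a f : E -> R) x :
  smooth_at a x -> smooth_at f x -> smooth_at (fun y => a y * f y) x.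
Proof. exact: smooth_atZ. Qed.

Lemma smooth_atN E F (f : E -> F) x : smooth_at f x -> smooth_at (fun y => - f y) x.
Proof.
move=> sf; apply: (@smooth_at_eq _ _ (fun y => (-1) *: f y)).
  by apply: nearW => y; rewrite scaleN1r.
by apply: smooth_atZ => //; exact: smooth_at_cst.
Qed.

Lemma smooth_atB E F (f g : E -> F) x :
  smooth_at f x -> smooth_at g x -> smooth_at (fun y => f y - g y) x.
Proof. by move=> sf sg; apply: smooth_atD => //; exact: smooth_atN. Qed.

Lemma smooth_at_sum E F (I : finType) (f : I -> E -> F) x :
  (forall i, smooth_at (f i) x) -> smooth_at (fun y => \sum_i f i y) x.
Proof.
move=> sf; elim: index_enum => [|i r IH].
  apply: (@smooth_at_eq _ _ (fun=> 0)); last exact: smooth_at_cst.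
  by apply: nearW => y; rewrite big_nil.
apply: (@smooth_at_eq _ _ (fun y => f i y + \sum_(j <- r) f j y)).
  by apply: nearW => y; rewrite big_cons.
exact: smooth_atD.
Qed.

Lemma smooth_at_pair E F G (f : E -> F) (g : E -> G) x :
  smooth_at f x -> smooth_at g x -> smooth_at (fun y => (f y, g y)) x.
Proof.
move=> /smooth_at_common H /H[U [oU Ux Cf Cg]]; exists U; split=> // k.
exact: Ck_on_pair.
Qed.

Lemma smooth_at_comp E F G (f : E -> F) (g : F -> G) x :
  finite_coordinates F -> smooth_at f x -> smooth_at g (f x) ->
  smooth_at (fun y => g (f y)) x.
Proof.
move=> cF sf [V [oV Vfx Cg]].
have : \forall y \near x, V (f y).
  exact: (smooth_at_continuous sf) (open_nbhs_nbhs (conj oV Vfx)).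
move=> /near_open_set[W [oW Wx WV]]; have [U [oU Ux Cf]] := sf.
exists (U `&` W); split=> // [|k]; first exact: openI.
apply: (Ck_on_comp cF _ oV _ _ (Cg k)); first exact: openI.
- by move=> y [_ /WV].
- by apply: Ck_on_sub (Cf k) => y [].
Qed.

Lemma smooth_at_compR E G (f : E -> R) (g : R -> G) x :
  smooth_at f x -> smooth_at g (f x) -> smooth_at (fun y => g (f y)) x.
Proof. exact/smooth_at_comp/finite_coordinatesR. Qed.

Lemma smooth_atV E (f : E -> R) x :
  f x != 0 -> smooth_at f x -> smooth_at (fun y => (f y)^-1) x.
Proof.
move=> fx sf; apply: smooth_at_compR => //; exists (~` [set 0 : R]); split.
- by apply: closed_openC; exact: closed_eq.
- exact/eqP.
- exact: Ck_on_inv.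
Qed.

Lemma smooth_at_sqrt E (f : E -> R) x :
  0 < f x -> smooth_at f x -> smooth_at (fun y => Num.sqrt (f y)) x.
Proof.
move=> fx sf; apply: (smooth_at_compR (g := Num.sqrt)) => //.
exists [set x : R | 0 < x]; split; [exact: open_gt|exact: fx|exact: Ck_on_sqrt].
Qed.

Lemma smooth_at_ln E (f : E -> R) x :
  0 < f x -> smooth_at f x -> smooth_at (fun y => ln (f y)) x.
Proof.
move=> fx sf; apply: (smooth_at_compR (g := @ln R)) => //.
exists [set x : R | 0 < x]; split; [exact: open_gt|exact: fx|exact: Ck_on_ln].
Qed.

Lemma smooth_at_expR E (f : E -> R) x :
  smooth_at f x -> smooth_at (fun y => expR (f y)) x.
Proof.
move=> sf; apply: (smooth_at_compR (g := @expR R)) => //.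
by exists setT; split; [exact: openT| |exact: Ck_on_expR].
Qed.

Lemma smooth_at_directional E F (X : E -> E) (f : E -> F) x :
  finite_coordinates E -> smooth_at X x -> smooth_at f x ->
  smooth_at (fun y => 'D_(X y) f y) x.
Proof.
move=> [I [e [l [cl el]]]] sX sf.
apply: (@smooth_at_eq _ _ (fun y => \sum_i l i (X y) *: 'D_(e i) f y)).
  apply: filterS (smooth_at_near sf) => y /smooth_at_differentiable dfy.
  by rewrite (derive_coordinates _ el dfy).
apply: smooth_at_sum => i; apply: smooth_atZ; last exact: smooth_at_derive.
apply: (@smooth_at_comp _ E) => //; first by exists I, e, l.
exact: smooth_at_linear.
Qed.

Lemma smooth_at_is_derive F (c : R -> F) t :
  smooth_at c t -> is_derive t 1 c ('D_1 c t).
Proof.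
move=> /smooth_at_differentiable dc; apply: derivableP.
exact: diff_derivable.
Qed.

Lemma is_derive1_diff F (c : R -> F) t dc :
  is_derive t 1 c dc -> differentiable c t.
Proof. by move=> [dct _]; exact/derivable1_diffP. Qed.

Lemma is_derive_along F G (c : R -> F) (g : F -> G) t dc :
  differentiable g (c t) -> is_derive t 1 c dc ->
  is_derive t 1 (fun s => g (c s)) ('D_dc g (c t)).
Proof.
move=> dg dct; have dc' := is_derive1_diff dct; apply: DeriveDef.
  by apply: diff_derivable; apply: differentiable_comp.
by rewrite (derive_comp _ dc' dg) derive_val.
Qed.

Lemma is_derive_lin F G (c : R -> F) (g : {linear F -> G}) t dc :
  continuous g -> is_derive t 1 c dc ->
  is_derive t 1 (fun s => g (c s)) (g dc).
Proof.
move=> cg dct.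
have dg : differentiable g (c t) by exact: linear_differentiable.
by have := is_derive_along dg dct; rewrite (deriveE _ dg) diff_lin.
Qed.

Lemma is_derive_bilin (E1 E2 F : normedModType R) (B : {bilinear E1 -> E2 -> F})
    (f : R -> E1) (g : R -> E2) t df dg :
  continuous (fun p : E1 * E2 => B p.1 p.2) ->
  is_derive t 1 f df -> is_derive t 1 g dg ->
  is_derive t 1 (fun s => B (f s) (g s)) (B df (g t) + B (f t) dg).
Proof.
move=> cB df' dg'; have [d1 d2] := (is_derive1_diff df', is_derive1_diff dg').
apply: DeriveDef; first exact/diff_derivable/differentiable_bilin_comp.
by rewrite derive_bilin_comp// !derive_val.
Qed.

Lemma is_derive_scale F (a : R -> R) (f : R -> F) t da df :
  is_derive t 1 a da -> is_derive t 1 f df ->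
  is_derive t 1 (fun s => a s *: f s) (da *: f t + a t *: df).
Proof.
move=> h1 h2; apply: (is_derive_bilin (B := @GRing.scale R F)) => //.
exact: scale_continuous.
Qed.

Lemma is_derive_pair F G (f : R -> F) (g : R -> G) t df dg :
  is_derive t 1 f df -> is_derive t 1 g dg ->
  is_derive t 1 (fun s => (f s, g s)) (df, dg).
Proof.
move=> df' dg'; have [d1 d2] := (is_derive1_diff df', is_derive1_diff dg').
apply: DeriveDef; first exact/diff_derivable/differentiable_pair.
rewrite deriveE; last exact: differentiable_pair.
by rewrite (diff_pair d1 d2) -!deriveE// !derive_val.
Qed.

Lemma is_derive_fst F G (f : R -> F * G) t df :
  is_derive t 1 f df -> is_derive t 1 (fun s => (f s).1) df.1.
Proof.
apply: (is_derive_lin (g := (fst : {linear (F * G)%type -> F}))) => y.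
exact: cvg_fst.
Qed.

Lemma is_derive_snd F G (f : R -> F * G) t df :
  is_derive t 1 f df -> is_derive t 1 (fun s => (f s).2) df.2.
Proof.
apply: (is_derive_lin (g := (snd : {linear (F * G)%type -> G}))) => y.
exact: cvg_snd.
Qed.

Lemma is_derive_add F (f g : R -> F) t df dg :
  is_derive t 1 f df -> is_derive t 1 g dg ->
  is_derive t 1 (fun s => f s + g s) (df + dg).
Proof. exact: is_deriveD. Qed.

Lemma is_derive_sub F (f g : R -> F) t df dg :
  is_derive t 1 f df -> is_derive t 1 g dg ->
  is_derive t 1 (fun s => f s - g s) (df - dg).
Proof. exact: is_deriveB. Qed.

Lemma is_derive_const F (a : F) t : is_derive t 1 (fun=> a) 0.
Proof. exact: is_derive_cst. Qed.

Lemma is_derive_ext F (f g : R -> F) t df :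
  (forall s, f s = g s) -> is_derive t 1 f df -> is_derive t 1 g df.
Proof. by move=> /funext ->. Qed.

Lemma is_derive_near_const F (f : R -> F) t a :
  (\forall s \near t, f s = a) -> is_derive t 1 f 0.
Proof.
move=> fa; apply: near_eq_is_derive (is_derive_const a t).
by apply: filterS fa => s.
Qed.

Lemma is_derive_unique F (f : R -> F) t a b :
  is_derive t 1 f a -> is_derive t 1 f b -> a = b.
Proof. by move=> [_ <-] [_ <-]. Qed.

End SmoothAt.

Section Manifold.
Context {R : realType}.
Implicit Types (E F G : normedModType R) (t : R).

Lemma curve_at_shift E (M : set E) (c : R -> E) t :
  curve_at M c t -> curve_at M (fun s => c (t + s)) 0.
Proof.
move=> [sc Mc]; split.
  apply: smooth_at_compR; last by rewrite addr0.
  by apply: smooth_atD; [exact: smooth_at_cst|exact: smooth_at_id].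
move: Mc; rewrite (near_shift 0 t); apply: filterS => s /=.
by rewrite subr0 addrC.
Qed.

Lemma is_derive_shiftl E (c : R -> E) t dc :
  is_derive t 1 c dc -> is_derive (0 : R) 1 (fun s => c (t + s)) dc.
Proof.
move=> dct.
have dc0 : is_derive (t + 0) 1 c dc by rewrite addr0.
have ds : is_derive (0 : R) 1 (fun s => t + s) 1.
  by have := is_derive_add (is_derive_const t 0) (is_derive_id (0 : R) 1);
    rewrite add0r.
have dd := is_derive1_diff dc0.
have := is_derive_along dd ds; suff -> : 'D_1 c (t + 0) = dc by [].
by have [] := dc0.
Qed.

(** [tangent] only knows curves at time [0], so the curve is translated in time. *)
Lemma tangent_curve E (M : set E) (c : R -> E) t :
  curve_at M c t -> tangent M (c t) ('D_1 c t).
Proof.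
move=> ct; exists (fun s => c (t + s)); split; first exact: curve_at_shift.
- by rewrite addr0.
- by have [] := is_derive_shiftl (smooth_at_is_derive ct.1).
Qed.

Lemma curve_atW E (M : set E) (c : R -> E) t : curve_at M c t -> M (c t).
Proof. by move=> [_ /nbhs_singleton]. Qed.

Lemma tangentW E (M : set E) p w : tangent M p w -> M p.
Proof. by move=> [c [/curve_atW + <- _]]. Qed.

Lemma curve_at_near E (M : set E) (c : R -> E) t :
  curve_at M c t -> \forall s \near t, curve_at M c s.
Proof.
move=> [/smooth_at_near sc /near_join Mc].
by apply: filterS2 sc Mc => s ? ?.
Qed.

(** Both extensions equal [f] along a curve in [M] with velocity [w], so they have the same
    derivative along it. This makes the choice in [tdiff] harmless. *)
Lemma local_extension_unique E F (M : set E) (f : E -> F) g1 g2 p w :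
  local_extension M f p g1 -> local_extension M f p g2 -> tangent M p w ->
  'D_w g1 p = 'D_w g2 p.
Proof.
move=> [s1 e1] [s2 e2] [c [[sc Mc] c0 cw]]; rewrite -c0 in s1 s2 e1 e2 *.
have dc := smooth_at_is_derive sc; rewrite cw in dc.
have d1 := is_derive_along (smooth_at_differentiable s1) dc.
have d2 := is_derive_along (smooth_at_differentiable s2) dc.
rewrite -(is_derive_unique (near_eq_is_derive _ d1) d2)//.
have cc := smooth_at_continuous sc.
have h1 : \forall s \near (0 : R), M (c s) -> g1 (c s) = f (c s) := cc _ e1.
have h2 : \forall s \near (0 : R), M (c s) -> g2 (c s) = f (c s) := cc _ e2.
by apply: filterS3 Mc h1 h2 => s Ms -> // ->.
Qed.

Lemma tdiff_ext E F (M : set E) (f : E -> F) g p w :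
  local_extension M f p g -> tangent M p w -> tdiff M f p w = 'D_w g p.
Proof.
move=> fg tw; rewrite /tdiff; case: xgetP => [y _ [g' fg' <-]|/(_ ('D_w g p))].
  exact: local_extension_unique fg' fg tw.
by case; exists g.
Qed.

(** The chain rule along curves of [M]; product rules and differentiated constraints for [tdiff] are
    all derived from it. *)
Lemma tdiff_is_derive E F (M : set E) (f : E -> F) (c : R -> E) t :
  smooth_map M f -> curve_at M c t ->
  is_derive t 1 (fun s => f (c s)) (tdiff M f (c t) ('D_1 c t)).
Proof.
move=> sf ct; have [g fg] := sf _ (curve_atW ct).
rewrite (tdiff_ext fg (tangent_curve ct)).
have d1 := is_derive_along (smooth_at_differentiable fg.1)
  (smooth_at_is_derive ct.1).
apply: near_eq_is_derive d1.
have h1 : \forall s \near t, M (c s) -> g (c s) = f (c s).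
  exact: smooth_at_continuous ct.1 _ fg.2.
by apply: filterS2 ct.2 h1 => s Ms ->.
Qed.

Lemma local_extension_near E F (M : set E) (f : E -> F) p g :
  local_extension M f p g -> \forall x \near p, local_extension M f x g.
Proof.
move=> [/smooth_at_near sg /near_join fg].
by apply: filterS2 sg fg => x ? ?.
Qed.

Lemma smooth_map_at E F (M : set E) (f : E -> F) :
  (forall x, M x -> smooth_at f x) -> smooth_map M f.
Proof. by move=> sf p /sf sp; exists f; split=> //; exact: nearW. Qed.

Lemma smooth_map_eq E F (M : set E) (f g : E -> F) :
  (forall x, M x -> f x = g x) -> smooth_map M f -> smooth_map M g.
Proof.
move=> fg sf p /sf[h [sh hf]]; exists h; split=> //.
by apply: filterS hf => x + Mx => ->//; exact: fg.
Qed.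

Lemma smooth_map_comp2 E (F1 F2 F : normedModType R) (M : set E) (op : F1 -> F2 -> F)
    (f : E -> F1) (g : E -> F2) :
  (forall (f' : E -> F1) (g' : E -> F2) x, smooth_at f' x -> smooth_at g' x ->
     smooth_at (fun y => op (f' y) (g' y)) x) ->
  smooth_map M f -> smooth_map M g -> smooth_map M (fun x => op (f x) (g x)).
Proof.
move=> sop sf sg p Mp.
have [f' [sf' f'f]] := sf p Mp; have [g' [sg' g'g]] := sg p Mp.
exists (fun x => op (f' x) (g' x)); split; first exact: sop.
by apply: filterS2 f'f g'g => x + + Mx => -> // ->.
Qed.

Lemma smooth_mapD E F (M : set E) (f g : E -> F) :
  smooth_map M f -> smooth_map M g -> smooth_map M (fun x => f x + g x).
Proof. by apply: smooth_map_comp2 => *; exact: smooth_atD. Qed.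

Lemma smooth_mapB E F (M : set E) (f g : E -> F) :
  smooth_map M f -> smooth_map M g -> smooth_map M (fun x => f x - g x).
Proof.
by apply: (smooth_map_comp2 (op := fun a b => a - b)) => *; exact: smooth_atB.
Qed.

Lemma smooth_mapZ E F (M : set E) (f : E -> R) (g : E -> F) :
  smooth_map M f -> smooth_map M g -> smooth_map M (fun x => f x *: g x).
Proof. by apply: smooth_map_comp2 => *; exact: smooth_atZ. Qed.

Lemma smooth_map_tdiff E F (M : set E) (X : E -> E) (f : E -> F) :
  finite_coordinates E -> smooth_map M X -> (forall p, M p -> tangent M p (X p)) ->
  smooth_map M f -> smooth_map M (fun p => tdiff M f p (X p)).
Proof.
move=> cE sX tX sf p Mp.
have [X' [sX' X'X]] := sX p Mp; have [f' f'f] := sf p Mp.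
exists (fun y => 'D_(X' y) f' y); split.
  by apply: smooth_at_directional => //; exact: f'f.1.
apply: filterS2 X'X (local_extension_near f'f) => x + e Mx => ->//.
by rewrite (tdiff_ext e)//; exact: tX.
Qed.

End Manifold.

(** * The Lorentz form *)

Section Lorentz.
Context {R : realType} {n : nat}.
Local Notation V := 'rV[R]_n.+1.
Local Notation q := (@lorentz R n).
Implicit Types (x y a e : V) (r : R).

Lemma lorentzC x y : q x y = q y x.
Proof.
rewrite /lorentz mulrC; congr (_ + _).
by apply: eq_bigr => i _; rewrite mulrC.
Qed.

Lemma lorentz_is_bilinear :
  bilinear_for
    (GRing.Scale.Law.clone _ _ *:%R _) (GRing.Scale.Law.clone _ _ *:%R _) q.
Proof.
have lin z : linear (q z).
  move=> r x y; rewrite /lorentz !mxE mulrDr mulrCA scalerDr opprD -scalerN -!addrA.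
  congr (_ + _); rewrite addrCA; congr (_ + _).
  rewrite scaler_sumr -big_split; apply: eq_bigr => i _ /=.
  by rewrite !mxE mulrDr mulrCA.
split=> [z|z] r x y /=; last by rewrite lin.
by rewrite !(lorentzC _ z) lin.
Qed.
HB.instance Definition _ := bilinear_isBilinear.Build R V V R _ _ q
  lorentz_is_bilinear.

Lemma lorentzDl x y e : q (x + y) e = q x e + q y e.
Proof. exact: linearDl. Qed.
Lemma lorentzDr x y e : q e (x + y) = q e x + q e y.
Proof. exact: linearDr. Qed.
Lemma lorentzZl r x e : q (r *: x) e = r * q x e.
Proof. exact: linearZl_LR. Qed.
Lemma lorentzZr r x e : q e (r *: x) = r * q e x.
Proof. exact: linearZr_LR. Qed.
Lemma lorentzNl x e : q (- x) e = - q x e.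
Proof. exact: linearNl. Qed.
Lemma lorentzNr x e : q e (- x) = - q e x.
Proof. exact: linearNr. Qed.
Lemma lorentz0l e : q 0 e = 0.
Proof. exact: linear0l. Qed.
Lemma lorentz0r e : q e 0 = 0.
Proof. exact: linear0r. Qed.

Lemma lorentzBl x y e : q (x - y) e = q x e - q y e.
Proof. exact: linearBl. Qed.
Lemma lorentzBr x y e : q e (x - y) = q e x - q e y.
Proof. exact: linearBr. Qed.

Definition lorentzE := (lorentzDl, lorentzDr, lorentzNl, lorentzNr,
  lorentzZl, lorentzZr, lorentz0l, lorentz0r).

Lemma smooth_at_coord (E : normedModType R) m (f : E -> 'rV[R]_m) (x : E) (j : 'I_m) :
  smooth_at f x -> smooth_at (fun z => f z 0 j) x.
Proof.
move=> sf; apply: (smooth_at_comp (g := @rV_coord R m j)) => //.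
  exact: finite_coordinates_rV.
by apply: smooth_at_linear; exact: coord_continuous.
Qed.

Lemma smooth_at_row (E : normedModType R) m (f : E -> 'I_m -> R) (x : E) :
  (forall j, smooth_at (fun z => f z j) x) ->
  smooth_at (fun z => \row_j f z j) x.
Proof.
move=> sf; apply: (@smooth_at_eq _ _ _ (fun z => \sum_j f z j *: delta_mx 0 j)).
  apply: nearW => z; rewrite [RHS]row_sum_delta.
  by apply: eq_bigr => j _; rewrite mxE.
apply: smooth_at_sum => j; apply: smooth_atZ => //; exact: smooth_at_cst.
Qed.

Lemma lorentz_continuous : continuous (fun p : V * V => q p.1 p.2).
Proof.
move=> p; apply: smooth_at_continuous.
have s1 : smooth_at (fst : V * V -> V) p by exact: smooth_at_fst.
have s2 : smooth_at (snd : V * V -> V) p by exact: smooth_at_snd.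
apply: smooth_atD.
  by apply: smooth_atN; apply: smooth_atM; exact: smooth_at_coord.
by apply: smooth_at_sum => i; apply: smooth_atM; exact: smooth_at_coord.
Qed.

Lemma smooth_at_lorentz (E : normedModType R) (f g : E -> V) (x : E) :
  smooth_at f x -> smooth_at g x -> smooth_at (fun z => q (f z) (g z)) x.
Proof. by apply: smooth_at_bilin; exact: lorentz_continuous. Qed.

Lemma is_derive_lorentz (f g : R -> V) (t : R) df dg :
  is_derive t 1 f df -> is_derive t 1 g dg ->
  is_derive t 1 (fun s => q (f s) (g s)) (q df (g t) + q (f t) dg).
Proof. by apply: is_derive_bilin; exact: lorentz_continuous. Qed.

(** [S] is the Euclidean product of the spatial parts; every sign statement about [q] comes from its
    Cauchy-Schwarz inequality. *)
Let S x y : R := \sum_(i < n) x 0 (lift ord0 i) * y 0 (lift ord0 i).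

Let S_ge0 x : 0 <= S x x.
Proof. by apply: sumr_ge0 => i _; rewrite -expr2 sqr_ge0. Qed.

Let S_eq0 x : S x x = 0 -> forall i, x 0 (lift ord0 i) = 0.
Proof.
move=> Sx i; apply/eqP; rewrite -sqrf_eq0 expr2; apply/eqP.
apply: (psumr_eq0P _ Sx) => // j _; by rewrite -expr2 sqr_ge0.
Qed.

Let cauchy_schwarz x y : S x y ^+ 2 <= S x x * S y y.
Proof.
have [y0|y0] := eqVneq (S y y) 0.
  have -> : S x y = 0 by apply: big1 => i _; rewrite (S_eq0 y0) mulr0.
  by rewrite y0 mulr0 expr0n.
have ypos : 0 < S y y by rewrite lt_neqAle eq_sym y0 S_ge0.
have : 0 <= \sum_(i < n)
    (S y y * x 0 (lift ord0 i) - S x y * y 0 (lift ord0 i)) ^+ 2.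
  by apply: sumr_ge0 => i _; rewrite sqr_ge0.
have -> : \sum_(i < n) (S y y * x 0 (lift ord0 i) - S x y * y 0 (lift ord0 i)) ^+ 2
    = S y y ^+ 2 * S x x - 2 * S y y * S x y * S x y + S x y ^+ 2 * S y y.
  transitivity (\sum_(i < n) (S y y ^+ 2 * (x 0 (lift ord0 i) * x 0 (lift ord0 i))
      + - (2 * S y y * S x y) * (x 0 (lift ord0 i) * y 0 (lift ord0 i))
      + S x y ^+ 2 * (y 0 (lift ord0 i) * y 0 (lift ord0 i)))).
    by apply: eq_bigr => i _; ring.
  rewrite !big_split/= -!mulr_sumr -/(S x x) -/(S x y) -/(S y y); ring.
rewrite (_ : _ + _ = S y y * (S x x * S y y - S x y ^+ 2)); last by ring.
by rewrite pmulr_rge0// subr_ge0.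
Qed.

Let lorentzS x y : q x y = S x y - x 0 ord0 * y 0 ord0.
Proof. by rewrite /lorentz addrC. Qed.

Lemma hyp_lorentz x : hyp R n x -> q x x = -1.
Proof. by case. Qed.

(** With [S x a = x_0 a_0] and [S x x = x_0^2 - 1], Cauchy-Schwarz reads
    [x_0^2 a_0^2 <= (x_0^2 - 1) S a a], which rearranges to the claim. It is the quantitative form
    of positivity of [q] on tangent spaces. *)
Let hyp_coord0 x a : hyp R n x -> q x a = 0 ->
  S a a <= x 0 ord0 ^+ 2 * q a a.
Proof.
move=> [xx x0] xa; move: xx xa; rewrite !lorentzS => xx xa.
have := cauchy_schwarz x a.
have -> : S x a = x 0 ord0 * a 0 ord0 by lra.
have -> : S x x = x 0 ord0 * x 0 ord0 - 1 by lra.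
by rewrite -subr_ge0 => H; rewrite -subr_ge0; apply: le_trans H _;
  rewrite le_eqVlt; apply/orP; left; apply/eqP; ring.
Qed.

Lemma lorentz_perp_ge0 x a : hyp R n x -> q x a = 0 -> 0 <= q a a.
Proof.
move=> hx xa; have := le_trans (S_ge0 a) (hyp_coord0 hx xa).
by case: hx => _ x0; rewrite pmulr_rge0// exprn_gt0.
Qed.

Lemma lorentz_perp_eq0 x a : hyp R n x -> q x a = 0 -> q a a = 0 -> a = 0.
Proof.
move=> hx xa aa; have := hyp_coord0 hx xa; rewrite aa mulr0 => Sle.
have S0 : S a a = 0 by apply/eqP; rewrite eq_le Sle S_ge0.
apply/rowP => i; rewrite mxE; have [j ->|->] := unliftP ord0 i.
  exact: S_eq0.
move: aa; rewrite lorentzS S0 => /eqP.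
by rewrite sub0r oppr_eq0 mulf_eq0 orbb => /eqP.
Qed.

(** For future causal vectors the spatial product is dominated by the time product, strictly because
    [S x x = x_0^2 - 1 < x_0^2]. *)
Lemma lorentz_lt0 x y : hyp R n x -> q y y <= 0 -> 0 < y 0 ord0 -> q x y < 0.
Proof.
move=> [+ x0]; rewrite !lorentzS => xx yy y0.
rewrite subr_lt0; apply: le_lt_trans (ler_norm _) _.
rewrite -(@ltr_pXn2r _ 2)// ?nnegrE ?normr_ge0 ?mulr_ge0 ?(ltW x0) ?(ltW y0)//.
rewrite real_normK ?num_real//; apply: le_lt_trans (cauchy_schwarz x y) _.
have -> : S x x = x 0 ord0 ^+ 2 - 1 by rewrite expr2; lra.
rewrite exprMn; apply: (@le_lt_trans _ _ ((x 0 ord0 ^+ 2 - 1) * y 0 ord0 ^+ 2)).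
  rewrite ler_wpM2l//; last by rewrite expr2; lra.
  by have := S_ge0 x; rewrite expr2; lra.
by rewrite mulrBl mul1r ltrBlDr ltrDl exprn_gt0.
Qed.

(** Decides the sheet of the hyperboloid without looking at [x_0]: if [x_0 < 0] then [- x] lies in
    hyperbolic space and [lorentz_lt0] gives the wrong sign. It serves points given in horospherical
    form, where the product with [om] is explicit but [x_0] is not. *)
Lemma hyp_future x y : q x x = -1 -> q y y = 0 -> 0 < y 0 ord0 -> q x y < 0 ->
  hyp R n x.
Proof.
move=> xx yy y0 xy; split=> //; rewrite ltNge; apply/negP.
rewrite le_eqVlt => /predU1P[x0|x0].
  by have := S_ge0 x; have := lorentzS x x; rewrite xx x0 => ? ?; lra.
have hN : hyp R n (- x) by split; rewrite ?lorentzNl ?lorentzNr ?opprK// mxE oppr_gt0.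
have := lorentz_lt0 hN; move=> /(_ y); rewrite yy lexx => /(_ isT y0).
by rewrite lorentzNl oppr_lt0 ltNge (ltW xy).
Qed.

Lemma hyp_coord_bound x a : hyp R n x -> q x a = 0 ->
  a 0 ord0 ^+ 2 <= (x 0 ord0 ^+ 2 - 1) * q a a.
Proof.
move=> hx xa; have h := hyp_coord0 hx xa.
have qaa : q a a = S a a - a 0 ord0 * a 0 ord0 by exact: lorentzS.
have -> : a 0 ord0 ^+ 2 = S a a - q a a by rewrite qaa; ring.
by rewrite mulrBl mul1r lerB.
Qed.

Lemma future_null x a : hyp R n x -> q x a = 0 -> q a a = 1 ->
  q (x + a) (x + a) = 0 /\ 0 < (x + a) 0 ord0.
Proof.
move=> hx xa aa; split; first by rewrite !lorentzE (lorentzC a) xa aa hyp_lorentz//; ring.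
have := hyp_coord_bound hx xa; case: hx => _ x0; rewrite aa mulr1 mxE => h.
rewrite -ltrBlDr sub0r; apply: le_lt_trans (ler_norm _) _.
rewrite normrN -(@ltr_pXn2r _ 2)// ?nnegrE ?normr_ge0 ?(ltW x0)//.
by rewrite real_normK ?num_real//; apply: le_lt_trans h _; lra.
Qed.

(** [q] is positive definite on the orthogonal of [x], so the classical argument applies to
    [q e e *: a - q a e *: e]. *)
Lemma lorentz_perp_cs x a e : hyp R n x -> q x a = 0 -> q x e = 0 ->
  q a e ^+ 2 <= q a a * q e e.
Proof.
move=> hx xa xe; have [e0|e0] := eqVneq (q e e) 0.
  by rewrite (lorentz_perp_eq0 hx xe e0) !lorentz0r mulr0 expr0n.
have epos : 0 < q e e by rewrite lt_neqAle eq_sym e0 (lorentz_perp_ge0 hx xe).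
have : 0 <= q (q e e *: a - q a e *: e) (q e e *: a - q a e *: e).
  by apply: (lorentz_perp_ge0 hx); rewrite !lorentzE xa xe !mulr0 subrr.
rewrite !lorentzE (lorentzC e a).
rewrite (_ : _ + _ = q e e * (q a a * q e e - q a e ^+ 2)); last by ring.
by rewrite pmulr_rge0// subr_ge0.
Qed.

(** The component of the null vector [e] orthogonal to [x] has square [q x e ^+ 2]; then use
    Cauchy-Schwarz there. Geometrically, [ln (- q (x, e))] has derivative at most [1] on unit
    vectors. *)
Lemma lorentz_null_cs x a e : hyp R n x -> q x a = 0 -> q e e = 0 ->
  q a e ^+ 2 <= q a a * q x e ^+ 2.
Proof.
move=> hx xa ee; have xx := hyp_lorentz hx.
have xp : q x (e + q e x *: x) = 0 by rewrite !lorentzE xx (lorentzC e); ring.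
have := lorentz_perp_cs hx xa xp.
rewrite !lorentzE (lorentzC a x) xa ee xx (lorentzC e x) mulr0 addr0.
by rewrite (_ : 0 + _ + _ = q x e ^+ 2)//; ring.
Qed.

(** The delicate point is positivity of the time coordinate: [hyp_coord_bound] gives [D^2 a_0^2 <=
    (x_0^2 - 1) (C^2 - 1) < C^2 x_0^2]. *)
Lemma hyp_combination x a (C D : R) : hyp R n x -> q x a = 0 -> 0 < C ->
  C ^+ 2 - q a a * D ^+ 2 = 1 -> hyp R n (C *: x + D *: a).
Proof.
move=> hx xa C0 CD; have [xx x0] := hx; split.
  rewrite !lorentzE xx xa (lorentzC a) xa.
  by rewrite -{2}CD; ring.
rewrite !mxE -ltrBlDr sub0r; apply: le_lt_trans (ler_norm _) _.
rewrite normrN -(@ltr_pXn2r _ 2)// ?nnegrE ?normr_ge0 ?mulr_ge0 ?(ltW x0) ?(ltW C0)//.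
rewrite real_normK ?num_real//.
have H := hyp_coord_bound hx xa.
rewrite !exprMn (_ : C ^+ 2 = 1 + q a a * D ^+ 2); last by lra.
have := ler_wpM2l (sqr_ge0 D) H.
have : 0 < x 0 ord0 ^+ 2 by rewrite exprn_gt0.
have : 0 <= q a a * D ^+ 2 by rewrite mulr_ge0 ?sqr_ge0 ?(lorentz_perp_ge0 hx xa).
by nra.
Qed.

End Lorentz.

(** * Hyperbolic space and its Levi-Civita connection *)

Section Dependence.
Context {R : realType}.
Implicit Types (E F : normedModType R).

Lemma tdiff_eq E F (M : set E) (f g : E -> F) p w :
  (forall x, M x -> f x = g x) -> tdiff M f p w = tdiff M g p w.
Proof.
move=> fg; rewrite /tdiff; congr (xget _ [set _ | _ in _]).
apply/seteqP; split=> h [sh eh]; split=> //; apply: filterS eh => x + Mx => ->//.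
  exact: fg.
by rewrite fg.
Qed.

Lemma tdiff_lin E F (M : set E) (f : E -> F) p (r s : R) w z :
  smooth_map M f -> tangent M p w -> tangent M p z ->
  tangent M p (r *: w + s *: z) ->
  tdiff M f p (r *: w + s *: z) = r *: tdiff M f p w + s *: tdiff M f p z.
Proof.
move=> sf tw tz tc; have [g fg] := sf _ (tangentW tw).
have dg := smooth_at_differentiable fg.1.
by rewrite !(tdiff_ext fg)// !(deriveE _ dg) linearD !linearZ.
Qed.

End Dependence.

Section HypCurves.
Context {R : realType}.
Implicit Types t r : R.

Definition ch t : R := (expR t + expR (- t)) / 2.
Definition sh t : R := (expR t - expR (- t)) / 2.

Lemma is_derive_expRN t : is_derive t 1 (fun s : R => expR (- s)) (- expR (- t)).
Proof.
have := @is_derive1_comp _ (@expR R) -%R t _ _ (is_derive_expR _) (is_deriveNid t 1).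
by rewrite mulrN1.
Qed.

Lemma is_derive_ch t : is_derive t 1 ch (sh t).
Proof.
have := is_derive_scale (is_derive_const (2^-1 : R) t)
  (is_derive_add (is_derive_expR t) (is_derive_expRN t)).
rewrite scale0r add0r /GRing.scale/= mulrC => d.
by apply: is_derive_ext d => s; rewrite mulrC.
Qed.

Lemma is_derive_sh t : is_derive t 1 sh (ch t).
Proof.
have := is_derive_scale (is_derive_const (2^-1 : R) t)
  (is_derive_sub (is_derive_expR t) (is_derive_expRN t)).
rewrite scale0r add0r /GRing.scale/= mulrC opprK => d.
by apply: is_derive_ext d => s; rewrite mulrC.
Qed.

Lemma smooth_at_ch t : smooth_at ch t.
Proof.
apply: smooth_atM; last exact: smooth_at_cst.
apply: smooth_atD; first exact/smooth_at_expR/smooth_at_id.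
exact/smooth_at_expR/smooth_atN/smooth_at_id.
Qed.

Lemma smooth_at_sh t : smooth_at sh t.
Proof.
apply: smooth_atM; last exact: smooth_at_cst.
apply: smooth_atB; first exact/smooth_at_expR/smooth_at_id.
exact/smooth_at_expR/smooth_atN/smooth_at_id.
Qed.

Lemma ch2_sh2 t : ch t ^+ 2 - sh t ^+ 2 = 1.
Proof.
rewrite /ch /sh expRN; have := expR_gt0 t => e0.
by field; rewrite gt_eqF.
Qed.

Lemma ch_gt0 t : 0 < ch t.
Proof. by rewrite /ch divr_gt0// addr_gt0// expR_gt0. Qed.

Lemma ch0 : ch 0 = 1. Proof. by rewrite /ch oppr0 expR0; field. Qed.
Lemma sh0 : sh 0 = 0. Proof. by rewrite /sh oppr0 expR0 subrr mul0r. Qed.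

(* C and D are cosh (sqrt r t) and sinh (sqrt r t) / sqrt r, with the limit
   value D = t when r = 0. *)
Lemma trig_of_curvature r : 0 <= r -> exists C D : R -> R,
  [/\ forall t, smooth_at C t /\ smooth_at D t,
      forall t, is_derive t 1 C (r * D t) /\ is_derive t 1 D (C t),
      C 0 = 1 /\ D 0 = 0 &
      forall t, 0 < C t /\ C t ^+ 2 - r * D t ^+ 2 = 1].
Proof.
rewrite le_eqVlt => /predU1P[<-|r0].
  exists (fun=> 1), (fun t => t); split=> // t.
  - by split; [exact: smooth_at_cst|exact: smooth_at_id].
  - by rewrite mul0r; split; [exact: is_derive_const|exact: is_derive_id].
  - by rewrite mul0r subr0 expr1n.
have s0 : 0 < Num.sqrt r by rewrite sqrtr_gt0.
have [rE s1] : Num.sqrt r ^+ 2 = r /\ Num.sqrt r != 0.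
  by rewrite sqr_sqrtr ?(ltW r0)// gt_eqF.
move: rE s0 s1; set s := Num.sqrt r => rE s0 s1.
have ds t : is_derive t 1 (fun t => t * s) s.
  have := is_derive_scale (is_derive_id t 1) (is_derive_const s t).
  by rewrite scaler0 addr0 /GRing.scale/= mul1r.
exists (fun t => ch (t * s)), (fun t => sh (t * s) * s^-1); split.
- move=> t; have ss : smooth_at (fun t => t * s) t.
    by apply: smooth_atM; [exact: smooth_at_id|exact: smooth_at_cst].
  split; first by apply: (smooth_at_compR ss); exact: smooth_at_ch.
  apply: smooth_atM; last exact: smooth_at_cst.
  by apply: (smooth_at_compR ss); exact: smooth_at_sh.
- move=> t; split.
    have := @is_derive1_comp _ ch _ t _ _ (is_derive_ch _) (ds t).
    by rewrite (_ : r * (sh (t * s) / s) = sh (t * s) * s)// -rE; field.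
  have d := @is_derive1_comp _ sh _ t _ _ (is_derive_sh _) (ds t).
  have := is_derive_scale d (is_derive_const s^-1 t).
  by rewrite scaler0 addr0 /GRing.scale/= mulfK.
- by rewrite mul0r ch0 sh0 mul0r.
- move=> t; split; first exact: ch_gt0.
  by rewrite -[RHS](ch2_sh2 (t * s)) -rE; field.
Qed.

End HypCurves.

Section HyperbolicSpace.
Context {R : realType} {n : nat}.
Local Notation V := 'rV[R]_n.+1.
Local Notation q := (@lorentz R n).
Local Notation H := (hyp R n).
Implicit Types (x y a e w : V) (t r : R).

(** The geodesic with initial velocity [a], for any tangent vector [a], zero included, so that no
    normalization of [a] is required. *)
Lemma hyp_curve x a : H x -> q x a = 0 -> exists C D : R -> R,
  [/\ forall t, smooth_at C t /\ smooth_at D t,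
      forall t, is_derive t 1 C (q a a * D t) /\ is_derive t 1 D (C t),
      C 0 = 1 /\ D 0 = 0,
      forall t, 0 < C t /\ C t ^+ 2 - q a a * D t ^+ 2 = 1 &
      forall t, curve_at H (fun s => C s *: x + D s *: a) t].
Proof.
move=> hx xa.
have [C [D [sCD dCD CD0 CD1]]] := trig_of_curvature (lorentz_perp_ge0 hx xa).
exists C, D; split=> // t; split.
  have [sC sD] := sCD t; apply: smooth_atD.
    by apply: smooth_atZ => //; exact: smooth_at_cst.
  by apply: smooth_atZ => //; exact: smooth_at_cst.
by near=> s; have [? ?] := CD1 s; exact: hyp_combination.
Unshelve. all: by end_near.
Qed.

Lemma is_derive_comb (C D : R -> R) x y dC dD t :
  is_derive t 1 C dC -> is_derive t 1 D dD ->
  is_derive t 1 (fun s => C s *: x + D s *: y) (dC *: x + dD *: y).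
Proof.
move=> hC hD.
have := is_derive_add (is_derive_scale hC (is_derive_const x t))
  (is_derive_scale hD (is_derive_const y t)).
by rewrite !scaler0 !addr0.
Qed.

Lemma tangent_hyp x a : tangent H x a <-> H x /\ q x a = 0.
Proof.
split=> [[c [ch c0 ca]]|[hx xa]].
  have hx : H x by rewrite -c0; exact: curve_atW ch.
  split=> //; have dc := smooth_at_is_derive ch.1; rewrite ca in dc.
  have d1 := is_derive_lorentz dc dc.
  have d2 : is_derive (0 : R) 1 (fun s => q (c s) (c s)) 0.
    apply: (@is_derive_near_const R R _ _ (-1)).
    by apply: filterS ch.2 => s /hyp_lorentz ->.
  have := is_derive_unique d1 d2; rewrite c0 (lorentzC a) => ?; lra.
have [C [D [sCD dCD [C0 D0] _ cu]]] := hyp_curve hx xa.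
exists (fun s => C s *: x + D s *: a); split=> //.
  by rewrite C0 D0 scale0r addr0 scale1r.
have [dC dD] := dCD 0; have [_ ->] := is_derive_comb x a dC dD.
by rewrite C0 D0 mulr0 scale0r add0r scale1r.
Qed.

Lemma curve_hyp_perp (c : R -> V) t : curve_at H c t -> q (c t) ('D_1 c t) = 0.
Proof. by move=> /tangent_curve/tangent_hyp[]. Qed.

(** Orthogonal projection onto the tangent space at [x]; the sign is a plus because [q x x = -1]. *)
Definition hproj x e : V := e + q e x *: x.

Lemma hproj_perp x e : H x -> q x (hproj x e) = 0.
Proof.
by move=> /hyp_lorentz xx; rewrite /hproj !lorentzE xx mulrN1 lorentzC subrr.
Qed.

Lemma hproj_id x e : q x e = 0 -> hproj x e = e.
Proof. by rewrite /hproj lorentzC => ->; rewrite scale0r addr0. Qed.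

Lemma hprojD x e w : hproj x (e + w) = hproj x e + hproj x w.
Proof. by rewrite /hproj lorentzDl scalerDl addrACA. Qed.

Lemma hprojZ x r e : hproj x (r *: e) = r *: hproj x e.
Proof. by rewrite /hproj lorentzZl scalerDr scalerA. Qed.

Lemma hproj_comb x r (s : R) e w :
  hproj x (r *: e + s *: w) = r *: hproj x e + s *: hproj x w.
Proof. by rewrite hprojD (hprojZ x r e) (hprojZ x s w). Qed.

Lemma hproj_tangent x e : H x -> tangent H x (hproj x e).
Proof. by move=> hx; apply/tangent_hyp; split=> //; exact: hproj_perp. Qed.

Lemma lorentz_hproj x e w : q x w = 0 -> q (hproj x e) w = q e w.
Proof. by move=> xw; rewrite /hproj !lorentzE xw mulr0 addr0. Qed.

Lemma smooth_at_hproj (E : normedModType R) (f g : E -> V) (p : E) :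
  smooth_at f p -> smooth_at g p -> smooth_at (fun z => hproj (f z) (g z)) p.
Proof.
move=> sf sg; apply: smooth_atD => //; apply: smooth_atZ => //.
exact: smooth_at_lorentz.
Qed.

Lemma vfield_hproj e : vfield H (hproj^~ e).
Proof.
split=> [|x]; last exact: hproj_tangent.
apply: smooth_map_at => x hx; apply: smooth_at_hproj; first exact: smooth_at_id.
exact: smooth_at_cst.
Qed.

Lemma vfield_hyp_perp X x : vfield H X -> H x -> q x (X x) = 0.
Proof. by move=> [_ tX] /tX/tangent_hyp[]. Qed.

(** The Gauss formula: tangential part of the flat derivative. *)
Definition hyp_nabla (X Y : V -> V) : V -> V :=
  fun x => hproj x (tdiff H Y x (X x)).

Lemma lorentz_tdiff X Y w x : H x -> tangent H x w -> vfield H X -> vfield H Y ->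
  tdiff H (fun z => q (X z) (Y z)) x w
  = q (tdiff H X x w) (Y x) + q (X x) (tdiff H Y x w).
Proof.
move=> hx tw [sX _] [sY _].
have sXY : smooth_map H (fun z => q (X z) (Y z)).
  by apply: smooth_map_comp2 => *; [exact: smooth_at_lorentz|..].
have [c [ch c0 cw]] := tw; have dX := tdiff_is_derive sX ch.
have dY := tdiff_is_derive sY ch; have dXY := tdiff_is_derive sXY ch.
have := is_derive_unique dXY (is_derive_lorentz dX dY).
by rewrite c0 cw.
Qed.

(** Differentiate [q (X, position) = 0] along a curve. The result is the normal part of the flat
    derivative, that is, the second fundamental form, and its symmetry is what makes the torsion of
    [hyp_nabla] vanish. *)
Lemma lorentz_tdiff_base X w x : H x -> tangent H x w -> vfield H X ->
  q (tdiff H X x w) x = - q (X x) w.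
Proof.
move=> hx tw vX; have [sX _] := vX.
have [c [ch c0 cw]] := tw; have dX := tdiff_is_derive sX ch.
have d1 := is_derive_lorentz dX (smooth_at_is_derive ch.1).
have d2 : is_derive (0 : R) 1 (fun s => q (X (c s)) (c s)) 0.
  apply: (@is_derive_near_const R R _ _ 0).
  by apply: filterS ch.2 => s hs; rewrite lorentzC (vfield_hyp_perp vX hs).
by move: (is_derive_unique d1 d2); rewrite c0 cw => /eqP; rewrite addr_eq0 => /eqP.
Qed.

Lemma hyp_nabla_connection : affine_connection H hyp_nabla.
Proof.
have inH x : x \in H -> H x by rewrite inE.
split.
- move=> X Y [sX tX] [sY tY]; split=> [|x hx]; last exact: hproj_tangent.
  apply: (smooth_map_comp2 (op := hproj)).
  + by move=> *; exact: smooth_at_hproj.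
  + by apply: smooth_map_at => x _; exact: smooth_at_id.
  + by apply: smooth_map_tdiff => //; exact: finite_coordinates_rV.
- move=> X X' Y Y' _ _ _ _ XX YY x xH; rewrite /hyp_nabla XX//; congr hproj.
  by apply: tdiff_eq => y Hy; apply: YY; rewrite inE.
- move=> f h X X' Y _ _ vX vX' [sY _] x /inH hx.
  have tX := vX.2 x hx; have tX' := vX'.2 x hx.
  have tc : tangent H x (f x *: X x + h x *: X' x).
    apply/tangent_hyp; split=> //; rewrite !lorentzE.
    by rewrite (vfield_hyp_perp vX hx) (vfield_hyp_perp vX' hx) !mulr0 addr0.
  rewrite -[LHS]/(hproj x (tdiff H Y x (f x *: X x + h x *: X' x))).
  by rewrite (tdiff_lin sY tX tX' tc) hproj_comb.
- move=> X Y Y' [_ tX] [sY _] [sY' _] x /inH hx.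
  rewrite -[RHS]/(hproj x _ + hproj x _) -hprojD; congr hproj; have [c [ch c0 cw]] := tX x hx.
  have dY := tdiff_is_derive sY ch; have dY' := tdiff_is_derive sY' ch.
  have := is_derive_unique (tdiff_is_derive (smooth_mapD sY sY') ch)
    (is_derive_add dY dY').
  by rewrite c0 cw.
- move=> f X Y sf [_ tX] vY x /inH hx; have [sY _] := vY.
  have [c [ch c0 cw]] := tX x hx.
  have df := tdiff_is_derive sf ch; have dY := tdiff_is_derive sY ch.
  have := is_derive_unique (tdiff_is_derive (smooth_mapZ sf sY) ch)
    (is_derive_scale df dY).
  rewrite c0 cw /hyp_nabla /vderiv => ->.
  by rewrite hproj_comb (hproj_id (vfield_hyp_perp vY hx)).
Qed.

Lemma hyp_nabla_metric : metric_compatible H (@hyp_metric R n) hyp_nabla.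
Proof.
move=> X Y Z vX vY vZ x hx; rewrite /vderiv /hyp_metric lorentz_tdiff//; last first.
  exact: vX.2.
rewrite lorentz_hproj; last exact: vfield_hyp_perp.
by rewrite [in RHS](lorentzC (Y x)) lorentz_hproj ?(vfield_hyp_perp vY)// (lorentzC (Y x)).
Qed.

Lemma hyp_nabla_torsion X Y : vfield H X -> vfield H Y -> forall x, H x ->
  torsion H hyp_nabla X Y x = 0.
Proof.
move=> vX vY x hx.
have key (A B : V) : q A x = - q (Y x) (X x) -> q B x = - q (X x) (Y x) ->
    A + q A x *: x - (B + q B x *: x) - (A - B) = 0.
  by move=> -> ->; rewrite (lorentzC (X x)) [B + _]addrC addrKA subrr.
exact: key (lorentz_tdiff_base hx (vX.2 x hx) vY)
  (lorentz_tdiff_base hx (vY.2 x hx) vX).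
Qed.

Let sym_skew_eq0 (a b c d f g : R) : a = b -> b = - c -> c = d -> d = - f ->
  f = g -> g = - a -> a = 0.
Proof. by lra. Qed.

Let skew_of_sum (a b c d : R) : a + b = c + d -> c - a = - (d - b).
Proof. by lra. Qed.

(** [levi_civita] returns some torsion-free metric connection, so the formula amounts to uniqueness;
    that there is one to return is shown by [hyp_nabla]. *)
Lemma hyp_connE X Y x : vfield H X -> vfield H Y -> H x ->
  @hyp_conn R n X Y x = hyp_nabla X Y x.
Proof.
move=> vX vY hx; rewrite /hyp_conn /levi_civita; case: xgetP; last first.
  move=> /(_ hyp_nabla) []; split; first exact: hyp_nabla_connection.
    exact: hyp_nabla_metric.
  exact: hyp_nabla_torsion.
move=> D _ [cD mD tD].
(* S is symmetric in X, Y and skew in Y, Z, hence zero. *)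
pose S X Y Z := q (D X Y x - hyp_nabla X Y x) (Z x).
have SE X' Y' Z : S X' Y' Z = q (D X' Y' x) (Z x) - q (hyp_nabla X' Y' x) (Z x).
  exact: lorentzBl.
have S_sym X' Y' Z : vfield H X' -> vfield H Y' -> S X' Y' Z = S Y' X' Z.
  move=> v1 v2; have key (A B C D' L : V) :
      A - B - L = 0 -> C - D' - L = 0 -> A - C = B - D'.
    move=> /subr0_eq <- /subr0_eq; move=> e; apply/eqP.
    by rewrite subr_eq -addrA (addrC (- D')) e addrC subrK.
  have e := key _ _ _ _ _ (tD _ _ v1 v2 x hx) (hyp_nabla_torsion v1 v2 hx).
  exact: (congr1 (fun A => q A (Z x)) e).
have S_skew X' Y' Z : vfield H X' -> vfield H Y' -> vfield H Z ->
    S X' Y' Z = - S X' Z Y'.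
  move=> v1 v2 v3; have := mD _ _ _ v1 v2 v3 x hx.
  rewrite (hyp_nabla_metric v1 v2 v3 hx) /hyp_metric => e.
  rewrite !SE (lorentzC (D X' Z x)) (lorentzC (hyp_nabla X' Z x)).
  exact: skew_of_sum e.
have S0 Z : vfield H Z -> S X Y Z = 0.
  move=> vZ; have e1 := S_sym _ _ Z vX vY; have e2 := S_skew _ _ _ vY vX vZ.
  have e3 := S_sym _ _ X vY vZ; have e4 := S_skew _ _ _ vZ vY vX.
  have e5 := S_sym _ _ Y vZ vX; have e6 := S_skew _ _ _ vX vZ vY.
  exact: sym_skew_eq0 e1 e2 e3 e4 e5 e6.
have tA : q x (D X Y x - hyp_nabla X Y x) = 0.
  rewrite lorentzBr (vfield_hyp_perp (conn_vfield cD vX vY) hx).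
  by rewrite (vfield_hyp_perp (conn_vfield hyp_nabla_connection vX vY) hx) subrr.
apply/eqP; rewrite -subr_eq0; apply/eqP; apply: (lorentz_perp_eq0 hx tA).
(* The difference vector, extended to a field by projection, is tested against itself; positive
   definiteness then kills it. *)
have := S0 _ (vfield_hproj (D X Y x - hyp_nabla X Y x)).
by rewrite /S hproj_id.
Qed.

(** Any admissible expansion of [w] gives the projected derivative, by the product rule and
    [hyp_connE]; it remains to exhibit one expansion. *)
Lemma cov_deriv_hyp (u w : R -> V) t : curve_at H u t -> smooth_at w t ->
  (\forall s \near t, q (u s) (w s) = 0) ->
  cov_deriv H (@hyp_conn R n) u w t = hproj (u t) ('D_1 w t).
Proof.
move=> cu sw uw; have ut := curve_atW cu.
rewrite /cov_deriv; case: xgetP => [y _|].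
  move=> [k [a [Y [X [[vX Xu] aY wE ->]]]]].
  have dYi i : is_derive t 1 (fun s => a i s *: Y i (u s))
      ('D_1 (a i) t *: Y i (u t) + a i t *: tdiff H (Y i) (u t) ('D_1 u t)).
    apply: is_derive_scale; first exact: smooth_at_is_derive (aY i).1.
    exact: tdiff_is_derive (aY i).2.1 cu.
  have dS := is_derive_sum dYi.
  have dw : is_derive t 1 w (\sum_(i < k) ('D_1 (a i) t *: Y i (u t)
      + a i t *: tdiff H (Y i) (u t) ('D_1 u t))).
    apply: near_eq_is_derive dS.
    by apply: filterS wE => s ->; rewrite fct_sumE.
  have [_ ->] := dw.
  have -> : forall (h : 'I_k -> V), hproj (u t) (\sum_i h i) = \sum_i hproj (u t) (h i).
    move=> h; apply: (big_morph (hproj (u t)) (hprojD _)).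
    by rewrite hproj_id// lorentz0r.
  apply: eq_bigr => i _; have hY := hproj_id (vfield_hyp_perp (aY i).2 ut).
  rewrite (hyp_connE vX (aY i).2 ut) /hyp_nabla Xu.
  by rewrite [RHS]hproj_comb hY.
(* The projected standard basis spans every tangent space. These [n + 1] fields are dependent, but
   the coordinates of [w] itself may serve as coefficients because [hproj] fixes [w]. *)
pose Y (i : 'I_n.+1) : V -> V := hproj^~ (delta_mx 0 i).
pose X : V -> V := hproj^~ ('D_1 u t).
move=> /(_ (\sum_(i < n.+1) ('D_1 (fun s => w s 0 i) t *: Y i (u t)
  + w t 0 i *: @hyp_conn R n X (Y i) (u t)))) [].
exists n.+1, (fun i s => w s 0 i), Y, X.
have wi i : smooth_at (fun s => w s 0 i) t by exact: smooth_at_coord.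
have tu : q (u t) ('D_1 u t) = 0 by exact: curve_hyp_perp.
split.
- by split; [exact: vfield_hproj|exact: hproj_id].
- by move=> i; split=> //; exact: vfield_hproj.
- apply: filterS uw => s us.
  rewrite -[LHS](hproj_id us) {1}(row_sum_delta (w s)).
  rewrite (big_morph (hproj (u s)) (hprojD _) (hproj_id (lorentz0r _))).
  by apply: eq_bigr => i _; rewrite hprojZ.
- by [].
Qed.
End HyperbolicSpace.

(** * Busemann functions *)

Section Constancy.
Context {R : realType}.
Implicit Types s t : R.

Lemma is_derive0_const (f : R -> R) (a b : R) : a <= b ->
  (forall s, a <= s <= b -> is_derive s 1 f 0) -> f b = f a.
Proof.
move=> ab df; have [||c _] := @MVT_segment R f (fun=> 0) a b ab.
- move=> s; rewrite in_itv/= => /andP[/ltW as_ /ltW sb].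
  by apply: df; rewrite as_ sb.
- apply: continuous_in_subspaceT => s; rewrite inE /= in_itv/= => sab.
  exact/differentiable_continuous/(is_derive1_diff (df s sab)).
by rewrite mul0r => /eqP; rewrite subr_eq0 => /eqP.
Qed.

Lemma is_derive0_const_row m (f : R -> 'rV[R]_m) (a b : R) : a <= b ->
  (forall s, a <= s <= b -> is_derive s 1 f 0) -> f b = f a.
Proof.
move=> ab df; apply/rowP => j.
apply: (@is_derive0_const (fun s => f s 0 j)) => // s /df d.
have := is_derive_lin (g := @rV_coord R m j) (@coord_continuous _ _ _ _ _) d.
by rewrite linear0.
Qed.

Lemma le_increment_Rintegral (f df g : R -> R) :
  (forall s, 0 <= s <= 1 -> is_derive s 1 f (df s)) ->
  (forall s, 0 <= s <= 1 -> {for s, continuous df}) ->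
  (forall s, 0 <= s <= 1 -> {for s, continuous g}) ->
  (forall s, 0 <= s <= 1 -> df s <= g s) ->
  f 1 - f 0 <= \int[lebesgue_measure]_(s in `[0, 1]) g s.
Proof.
move=> fd cdf cg dfg.
have within (h : R -> R) : (forall s, 0 <= s <= 1 -> {for s, continuous h}) ->
    {within `[(0 : R), 1], continuous h}.
  move=> ch; apply: continuous_in_subspaceT => s; rewrite inE /= in_itv/=.
  exact: ch.
have int (h : R -> R) : (forall s, 0 <= s <= 1 -> {for s, continuous h}) ->
    lebesgue_measure.-integrable `[(0 : R), 1] (EFin \o h).
  move=> ch; apply: continuous_compact_integrable; first exact: segment_compact.
  exact: within.
have FTC : \int[lebesgue_measure]_(s in `[(0 : R), 1]) df s = f 1 - f 0.
  rewrite /Rintegral (@continuous_FTC2 _ df f)//.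
  - exact: within.
  - have cf s : 0 <= s <= 1 -> {for s, continuous f}.
      move=> sab; exact/differentiable_continuous/(is_derive1_diff (fd s sab)).
    split.
    + move=> s; rewrite in_itv/= => /andP[/ltW s0 /ltW s1].
      by have [] : is_derive s 1 f (df s) by apply: fd; rewrite s0 s1.
    + by apply: cvg_at_right_filter; apply: cf; rewrite lexx ler01.
    + by apply: cvg_at_left_filter; apply: cf; rewrite lexx ler01.
  - move=> s; rewrite in_itv/= => /andP[/ltW s0 /ltW s1]; rewrite derive1E.
    by have [] : is_derive s 1 f (df s) by apply: fd; rewrite s0 s1.
rewrite -FTC; apply: le_Rintegral; [by []|exact: int|exact: int|].
by move=> s /=; rewrite in_itv/=; exact: dfg.
Qed.

End Constancy.

Section Busemann.
Context {R : realType} {n : nat}.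
Local Notation V := 'rV[R]_n.+1.
Local Notation q := (@lorentz R n).
Local Notation H := (hyp R n).
Local Notation hm := (@hyp_metric R n).
Implicit Types (x y a e w : V) (s t : R).

(** The geodesic equation says that [c''] is normal, a multiple of [c]; differentiating
    [q (c, c') = 0] and using unit speed gives [q (c'', c) = -1], which fixes the multiple. *)
Lemma geodesic_ray_acceleration (c : R -> V) t : 0 <= t ->
  geodesic_ray H hm c -> 'D_1 ('D_1 c) t = c t.
Proof.
move=> t0 gc; have [ct cov unit] := gc t t0.
have sdc : smooth_at ('D_1 c) t by exact: smooth_at_derive ct.1.
have perp : \forall s \near t, q (c s) ('D_1 c s) = 0.
  by apply: filterS (curve_at_near ct) => s; exact: curve_hyp_perp.
move: cov; rewrite -/(@hyp_conn R n) (cov_deriv_hyp ct sdc perp) /hproj.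
have d1 := is_derive_lorentz (smooth_at_is_derive ct.1) (smooth_at_is_derive sdc).
have d2 := @is_derive_near_const R R _ t 0 perp.
have := is_derive_unique d1 d2; rewrite -/(hm (c t) _ _) unit lorentzC => e.
have -> : q ('D_1 ('D_1 c) t) (c t) = -1 by apply/eqP; rewrite -addr_eq0 addrC e.
by rewrite scaleN1r => /subr0_eq.
Qed.

Let half_sum_row (r s : R) (a b A B : V) : s * r = 1 ->
  s *: (a + b) = A + B -> r *: (a - b) = A - B ->
  a = ((r + s) / 2) *: A + ((r - s) / 2) *: B.
Proof.
move=> sr /rowP e1 /rowP e2; apply/rowP => j.
move: (e1 j) (e2 j); rewrite !mxE => h1 h2.
transitivity ((r * (A 0 j + B 0 j) + s * (A 0 j - B 0 j)) / 2); last by field.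
rewrite -h1 -h2 (_ : _ / 2 = (s * r) * a 0 j); last by field.
by rewrite sr mul1r.
Qed.

(** In place of uniqueness for the equation [c'' = c], two conserved quantities are used:
    [e^-t (c + c')] and [e^t (c - c')]. *)
Lemma geodesic_rayE (c : R -> V) t : 0 <= t -> geodesic_ray H hm c ->
  c t = ch t *: c 0 + sh t *: 'D_1 c 0.
Proof.
move=> t0 gc; pose c' := 'D_1 c.
have dc s : 0 <= s <= t -> is_derive s 1 c (c' s) /\ is_derive s 1 c' (c s).
  move=> /andP[s0 _]; have [ct _ _] := gc s s0; split.
    exact: smooth_at_is_derive ct.1.
  rewrite -(geodesic_ray_acceleration s0 gc); apply: smooth_at_is_derive.
  exact: smooth_at_derive ct.1.
have plus : expR (- t) *: (c t + c' t) = c 0 + c' 0.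
  transitivity (expR (- 0) *: (c 0 + c' 0)); last by rewrite oppr0 expR0 scale1r.
  apply: (@is_derive0_const_row R _ (fun s => expR (- s) *: (c s + c' s))) => // s /dc[d1 d2].
  have := is_derive_scale (is_derive_expRN s) (is_derive_add d1 d2).
  by rewrite scaleNr [c' s + c s]addrC addNr.
have minus : expR t *: (c t - c' t) = c 0 - c' 0.
  transitivity (expR 0 *: (c 0 - c' 0)); last by rewrite expR0 scale1r.
  apply: (@is_derive0_const_row R _ (fun s => expR s *: (c s - c' s))) => // s /dc[d1 d2].
  have := is_derive_scale (is_derive_expR s) (is_derive_sub d1 d2).
  by rewrite -scalerDr addrC subrKA subrr scaler0.
have inv : expR (- t) * expR t = 1 by rewrite -expRD addNr expR0.
exact: half_sum_row inv plus minus.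
Qed.

(** By [lorentz_null_cs] the derivative of [ln (- q (c, w))] is bounded by the speed of [c];
    integrate. *)
Lemma busemann_curve_le w x y (c : R -> V) : q w w = 0 -> 0 < w 0 ord0 ->
  (forall t, 0 <= t <= 1 -> curve_at H c t) -> c 0 = x -> c 1 = y ->
  ln (- q x w) - ln (- q y w) <= curve_length hm c.
Proof.
move=> ww w0 cH <- <-.
pose f s := - ln (- q (c s) w); pose df s := - (q ('D_1 c s) w / q (c s) w).
have neg t : 0 <= t <= 1 -> q (c t) w < 0.
  by move=> /cH/curve_atW hx; apply: lorentz_lt0; rewrite ?ww.
have -> : ln (- q (c 0) w) - ln (- q (c 1) w) = f 1 - f 0.
  by rewrite /f opprK addrC.
apply: (@le_increment_Rintegral R f df) => t /[dup] t01 /cH ct.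
- have d1 := is_derive_lorentz (smooth_at_is_derive ct.1) (is_derive_const w t).
  have p : 0 < - q (c t) w by rewrite oppr_gt0; exact: neg.
  have := is_derive_sub (is_derive_const 0 t) d1.
  rewrite lorentz0r addr0 sub0r => d2.
  have d3 : is_derive t 1 (fun s => - q (c s) w) (- q ('D_1 c t) w).
    by apply: is_derive_ext d2 => s; rewrite sub0r.
  have := @is_derive1_comp _ (@ln R) _ t _ _ (is_derive1_ln p) d3.
  move=> /(is_derive_sub (is_derive_const 0 t)); rewrite sub0r => d4.
  have <- : - ((- q (c t) w)^-1 * - q ('D_1 c t) w) = df t.
    by rewrite /df invrN mulrNN mulrC.
  by apply: is_derive_ext d4 => s; rewrite sub0r.
- apply: smooth_at_continuous; apply: smooth_atN; apply: smooth_atM.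
    apply: smooth_at_lorentz; last exact: smooth_at_cst.
    exact: smooth_at_derive ct.1.
  apply: smooth_atV; first by rewrite lt_eqF// neg.
  by apply: smooth_at_lorentz; [exact: ct.1|exact: smooth_at_cst].
- apply: (@continuous_comp _ _ _ (fun s => hm (c s) ('D_1 c s) ('D_1 c s)) Num.sqrt).
    apply: smooth_at_continuous; apply: smooth_at_lorentz.
      exact: smooth_at_derive ct.1.
    exact: smooth_at_derive ct.1.
  exact: sqrt_continuous.
have hx := curve_atW ct; have perp := curve_hyp_perp ct.
have cs := lorentz_null_cs hx perp ww.
have nx := neg t t01.
apply: le_trans (ler_norm _) _; rewrite /df normrN normrM normfV.
rewrite ler_pdivrMr ?normr_gt0 ?lt_eqF//.
rewrite -(@ler_pXn2r _ 2)// ?nnegrE ?mulr_ge0 ?sqrtr_ge0//.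
rewrite exprMn !real_normK ?num_real// sqr_sqrtr//.
exact: lorentz_perp_ge0 hx perp.
Qed.

(** The strict inequality keeps [x] and [y] apart, so the direction [w] can be normalized. The
    length is [arcosh C = ln (C + sqrt (C^2 - 1))] with [C = - q x y], and the curve runs over
    [[0, 1]] at constant speed [L]. *)
Lemma geodesic_between x y : H x -> H y -> 1 < - q x y ->
  exists (L : R) (c : R -> V), [/\ 0 <= L, ch L = - q x y,
    forall t, curve_at H c t, c 0 = x /\ c 1 = y & curve_length hm c = L].
Proof.
move=> hx hy; set C := - q x y => C1.
have C2 : 0 < C ^+ 2 - 1 by rewrite subr_gt0 expr_gt1// ltW// (lt_trans _ C1).
pose D := Num.sqrt (C ^+ 2 - 1).
have D0 : 0 < D by rewrite sqrtr_gt0.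
have DE : D ^+ 2 = C ^+ 2 - 1 by rewrite sqr_sqrtr// ltW.
have CD0 : 0 < C + D by rewrite addr_gt0// (lt_trans _ C1).
pose L := ln (C + D).
have eL : expR L = C + D by rewrite lnK.
have eNL : expR (- L) = C - D.
  rewrite expRN eL; apply: (mulIf (x := C + D)); first by rewrite gt_eqF.
  by rewrite mulVf ?gt_eqF// -subr_sqr DE; ring.
have chL : ch L = C by rewrite /ch eL eNL; field.
have shL : sh L = D by rewrite /sh eL eNL; field.
have L0 : 0 <= L by rewrite ln_ge0//; lra.
pose w := D^-1 *: (y - C *: x).
have xw : q x w = 0 by rewrite /w !lorentzE (hyp_lorentz hx) /C; ring.
have w1 : q w w = 1.
  rewrite /w !lorentzE (hyp_lorentz hx) (hyp_lorentz hy) (lorentzC y) -/C.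
  rewrite (_ : q x y = - C); last by rewrite opprK.
  have D1 : D != 0 by rewrite gt_eqF.
  by rewrite (_ : _ * _ = D^-1 * D^-1 * (C ^+ 2 - 1)); [rewrite -DE; field|ring].
have wD : D *: w = y - C *: x by rewrite /w scalerA divff ?gt_eqF// scale1r.
clearbody w.
have dm t : is_derive t 1 (fun t => t * L) L.
  have := is_derive_scale (is_derive_id t 1) (is_derive_const L t).
  by rewrite scaler0 addr0 /GRing.scale/= mul1r.
have dC t : is_derive t 1 (fun t => ch (t * L)) (sh (t * L) * L).
  exact: (@is_derive1_comp _ ch _ t _ _ (is_derive_ch _) (dm t)).
have dS t : is_derive t 1 (fun t => sh (t * L)) (ch (t * L) * L).
  exact: (@is_derive1_comp _ sh _ t _ _ (is_derive_sh _) (dm t)).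
have sm t : smooth_at (fun t => t * L) t.
  by apply: smooth_atM; [exact: smooth_at_id|exact: smooth_at_cst].
exists L, (fun t => ch (t * L) *: x + sh (t * L) *: w); split=> //.
- move=> t; split.
    apply: smooth_atD; apply: smooth_atZ; try exact: smooth_at_cst.
      by apply: (smooth_at_compR (sm t)); exact: smooth_at_ch.
    by apply: (smooth_at_compR (sm t)); exact: smooth_at_sh.
  near=> s; apply: hyp_combination => //; first exact: ch_gt0.
  by rewrite w1 mul1r ch2_sh2.
- rewrite mul0r ch0 sh0 scale0r addr0 scale1r mul1r chL shL; split=> //.
  by rewrite wD addrC subrK.
rewrite /curve_length (_ : (fun t => _) = (fun=> L)); last first.
  apply/funext => t; have [_ ->] := is_derive_comb x w (dC t) (dS t).
  rewrite /hyp_metric !lorentzE (hyp_lorentz hx) w1 (lorentzC w) xw.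
  rewrite (_ : _ + _ = L ^+ 2 * (ch (t * L) ^+ 2 - sh (t * L) ^+ 2)); last by ring.
  by rewrite ch2_sh2 mulr1 sqrtr_sqr ger0_norm.
rewrite Rintegral_cst//= lebesgue_measure_itv/= lte_fin ltr01 sube0.
by rewrite mulr1.
Unshelve. all: by end_near. Qed.

(** The limit is squeezed: [busemann_curve_le] bounds the distance to [c t] from below by
    [ln A + t], and the geodesic from [x] to [c t] bounds it from above. The ray data are kept in
    the conclusion to show later that every horosphere is nonempty. *)
Lemma busemannE (b : V -> R) : busemann b -> exists w : V,
  [/\ q w w = 0, 0 < w 0 ord0, (exists x u, [/\ H x, q x u = 0, q u u = 1 & w = x + u])
    & forall x, H x -> b x = ln (- q x w)].
Proof.
move=> [c gc bc]; have [c0 _ unit] := gc 0 (lexx 0).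
(* [w] and [w'] are the null directions of the two ends of the geodesic:
   [c t = (e^t w + e^-t w') / 2]. *)
pose x0 := c 0; pose u0 := 'D_1 c 0; pose w := x0 + u0; pose w' := x0 - u0.
have hx0 : H x0 by exact: curve_atW c0.
have xu : q x0 u0 = 0 by exact: curve_hyp_perp.
have uu : q u0 u0 = 1 by exact: unit.
have [ww w0] : q w w = 0 /\ 0 < w 0 ord0 by exact: future_null.
have [ww' w0'] : q w' w' = 0 /\ 0 < w' 0 ord0.
  by apply: future_null; rewrite ?lorentzE ?xu ?uu ?oppr0 ?opprK.
exists w; split=> //; first by exists x0, u0.
move=> x hx.
have A0 : 0 < - q x w by rewrite oppr_gt0; apply: lorentz_lt0; rewrite ?ww.
have B0 : 0 < - q x w' by rewrite oppr_gt0; apply: lorentz_lt0; rewrite ?ww'.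
set A := - q x w in A0 *; set B := - q x w' in B0 *.
have cE t : 0 <= t -> c t = ch t *: x0 + sh t *: u0.
  by move=> t0; exact: geodesic_rayE.
have hct t : 0 <= t -> H (c t) by move=> /gc[/curve_atW].
have qct t : 0 <= t -> - q x (c t) = (expR t * A + expR (- t) * B) / 2.
  by move=> t0; rewrite (cE t t0) /A /B /w /w' !lorentzE /ch /sh; field.
have fct t : 0 <= t -> ln (- q (c t) w) = - t.
  move=> t0; rewrite (cE t t0) /w !lorentzE xu uu (lorentzC u0) xu (hyp_lorentz hx0).
  rewrite -[RHS]expRK; congr ln; rewrite /ch /sh; by field.
rewrite -(cvg_lim (@norm_hausdorff _ R) (bc x hx)).
apply: (cvg_lim (@norm_hausdorff _ R)).
(* The upper bound comes from [e^L <= 2 ch L = e^t A + e^-t B], weakened to [e^t A + B] and divided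
   by [e^t]. *)
apply: (@squeeze_cvgr _ _ _ _ (fun=> ln A) (fun t => ln (A + expR (- t) * B))).
- near=> t.
  have t0 : 0 < t by near: t; exact: nbhs_pinfty_gt.
  (* Beyond this time [e^t A > 2], hence [- q x (c t) > 1], as [geodesic_between] requires. *)
  have tA : ln (2 / A) < t by near: t; apply: nbhs_pinfty_gt; exact: num_real.
  have t0' := ltW t0.
  have big : 2 < expR t * A.
    by rewrite -ltr_pdivrMr// -[X in X < _]lnK ?posrE ?divr_gt0// ltr_expR.
  have C1 : 1 < - q x (c t).
    rewrite qct// ltr_pdivlMr// mul1r; apply: (lt_trans big).
    by rewrite ltrDl mulr_gt0// expR_gt0.
  have [L [g [L0 chL gH [g0 g1] gL]]] := geodesic_between hx (hct t t0') C1.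
  pose S := [set curve_length hm c1 | c1 in
    [set c1 | [/\ forall s, 0 <= s <= 1 -> curve_at H c1 s, c1 0 = x & c1 1 = c t]]].
  have low : lbound S (ln A + t).
    move=> _ [c1 [c1H c10 c11] <-].
    have := busemann_curve_le ww w0 c1H c10 c11.
    by rewrite fct// opprK.
  have SL : S L by exists g => //; split.
  apply/andP; split.
    rewrite -lerBlDr opprK; apply: lb_le_inf => //; by exists L.
  rewrite lerBlDr; apply: (@le_trans _ _ L).
    by apply: ge_inf => //; exists (ln A + t).
  rewrite -[L]expRK -[X in _ <= _ + X]expRK -lnM ?posrE ?expR_gt0//; last first.
    by rewrite addr_gt0// mulr_gt0// expR_gt0.
  rewrite ler_ln ?posrE ?expR_gt0 ?mulr_gt0 ?addr_gt0 ?mulr_gt0 ?expR_gt0//.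
  have e1 : expR L <= 2 * ch L.
    by rewrite /ch mulrC divfK// lerDl expR_ge0.
  apply: (le_trans e1); rewrite chL qct// mulrC divfK//.
  rewrite (_ : _ * expR t = expR t * A + (expR (- t) * expR t) * B); last by ring.
  rewrite -expRD addNr expR0 mul1r lerD2l.
  rewrite ger_pMl// -[leRHS]expR0 ler_expR; lra.
- exact: cvg_cst.
- have cA : {for A, continuous (@ln R)} by exact: continuous_ln.
  have fA : A + expR (- t) * B @[t --> +oo] --> A.
    rewrite -[X in _ --> X]addr0; apply: cvgD; first exact: cvg_cst.
    rewrite -[X in _ --> X](mul0r B); apply: cvgMr_tmp; exact: cvgr_expR.
  exact: cvg_comp fA cA.
Unshelve. all: by end_near. Qed.

End Busemann.

(** * The unit tangent bundle and the Sasaki metric *)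

Section UnitTangentBundle.
Context {R : realType} {n : nat}.
Local Notation V := 'rV[R]_n.+1.
Local Notation W := (V * V)%type.
Local Notation q := (@lorentz R n).
Local Notation H := (hyp R n).
Local Notation UTn := (UT R n).
Implicit Types (x a : V) (p z e : W) (s t : R).

Lemma UTE p : UTn p <-> [/\ H p.1, q p.1 p.2 = 0 & q p.2 p.2 = 1].
Proof.
split=> [[hx /tangent_hyp[_ xv] vv]|[hx xv vv]]; first by split.
by split=> //; apply/tangent_hyp.
Qed.

(** Move [v] linearly with velocity [w], project onto the tangent space at [u s], and normalize. The
    two orthogonality conditions say that projection and normalization do not change the first
    derivative. Leaving [u] free allows a base curve inside a horosphere later. *)
Lemma UT_lift (u : R -> V) (v w : V) : curve_at H u 0 -> UTn (u 0, v) ->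
  q v w = 0 -> q (u 0) w + q ('D_1 u 0) v = 0 ->
  exists c : R -> V, [/\ curve_at UTn (fun s => (u s, c s)) 0, c 0 = v &
    is_derive (0 : R) 1 c w].
Proof.
move=> cu /UTE[/= hx xv vv] vw xw.
pose l s := v + s *: w; pose y s := hproj (u s) (l s); pose N s := q (y s) (y s).
have dl : is_derive (0 : R) 1 l w.
  have := is_derive_add (is_derive_const v (0 : R))
    (is_derive_scale (is_derive_id (0 : R) 1) (is_derive_const w (0 : R))).
  by rewrite scale1r scaler0 add0r addr0.
have sl : smooth_at l 0.
  apply: smooth_atD; first exact: smooth_at_cst.
  by apply: smooth_atZ; [exact: smooth_at_id|exact: smooth_at_cst].
have l0 : l 0 = v by rewrite /l scale0r addr0.
have y0 : y 0 = v by rewrite /y l0 hproj_id.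
have du := smooth_at_is_derive cu.1.
have dy : is_derive (0 : R) 1 y w.
  have := is_derive_add dl (is_derive_scale (is_derive_lorentz dl du) du).
  rewrite l0 (lorentzC w) (lorentzC v) xw scale0r add0r (lorentzC v) xv.
  by rewrite scale0r addr0.
have sy : smooth_at y 0 by apply: smooth_at_hproj => //; exact: cu.1.
have N0 : N 0 = 1 by rewrite /N y0.
have dN : is_derive (0 : R) 1 N 0.
  by have := is_derive_lorentz dy dy; rewrite y0 (lorentzC w) vw addr0.
have sN : smooth_at N 0 by exact: smooth_at_lorentz.
pose g (r : R) := (Num.sqrt r)^-1.
have sg : smooth_at g (N 0).
  rewrite N0; apply: smooth_atV; first by rewrite sqrtr1 oner_eq0.
  by apply: smooth_at_sqrt => //; exact: smooth_at_id.
exists (fun s => g (N s) *: y s); split.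
- split.
    apply: smooth_at_pair; first exact: cu.1.
    by apply: smooth_atZ => //; exact: smooth_at_compR.
  have Npos : \forall s \near (0 : R), 0 < N s.
    have pos : nbhs (N 0) [set r | 0 < r].
      by apply: open_nbhs_nbhs; split; [exact: open_gt|rewrite /= N0].
    exact: smooth_at_continuous sN _ pos.
  apply: filterS2 cu.2 Npos => s hs Ns; apply/UTE; split=> //=.
    by rewrite lorentzZr hproj_perp// mulr0.
  rewrite lorentzZl lorentzZr mulrA -/(N s) -expr2 /g exprVn sqr_sqrtr ?(ltW Ns)//.
  by rewrite mulVf// gt_eqF.
- by rewrite N0 y0 /g sqrtr1 invr1 scale1r.
have dgN := is_derive_along (smooth_at_differentiable sg) dN.
rewrite derive0 in dgN; have := is_derive_scale dgN dy.
by rewrite scale0r add0r N0 /g sqrtr1 invr1 scale1r.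
Qed.

(** One direction differentiates the three defining equations of the bundle; the other lifts a
    geodesic by [UT_lift]. *)
Lemma tangent_UT p z : tangent UTn p z <-> [/\ UTn p, q p.1 z.1 = 0,
  q p.2 z.2 = 0 & q p.1 z.2 + q z.1 p.2 = 0].
Proof.
split=> [[c [cc c0 cz]]|[/[dup] up /UTE[hx xv vv] xa vw xw]].
  have up : UTn p by rewrite -c0; exact: curve_atW cc.
  have dc := smooth_at_is_derive cc.1; rewrite cz in dc.
  have d1 := is_derive_fst dc; have d2 := is_derive_snd dc.
  have nUT : \forall s \near (0 : R), [/\ q (c s).1 (c s).1 = -1,
      q (c s).1 (c s).2 = 0 & q (c s).2 (c s).2 = 1].
    by apply: filterS cc.2 => s /UTE[/hyp_lorentz ? ? ?].
  have e11 := is_derive_unique (is_derive_lorentz d1 d1)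
    (@is_derive_near_const R R _ 0 (-1) (filterS (fun s h => let: And3 h _ _ := h in h) nUT)).
  have e12 := is_derive_unique (is_derive_lorentz d1 d2)
    (@is_derive_near_const R R _ 0 0 (filterS (fun s h => let: And3 _ h _ := h in h) nUT)).
  have e22 := is_derive_unique (is_derive_lorentz d2 d2)
    (@is_derive_near_const R R _ 0 1 (filterS (fun s h => let: And3 _ _ h := h in h) nUT)).
  have F0 : Filter (nbhs (0 : R)) by exact: nbhs_filter.
  move: (e11 F0) (e12 F0) (e22 F0) => {e11 e12 e22}.
  rewrite c0 (lorentzC z.1 p.1) (lorentzC z.2 p.2) => e11 e12 e22.
  by split=> //; lra.
have [C [D [sCD dCD [C0 D0] _ cu]]] := hyp_curve hx xa.
pose u s := C s *: p.1 + D s *: z.1.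
have u0 : u 0 = p.1 by rewrite /u C0 D0 scale0r addr0 scale1r.
have du : is_derive (0 : R) 1 u z.1.
  have [dC dD] := dCD 0; have := is_derive_comb p.1 z.1 dC dD.
  by rewrite C0 D0 mulr0 scale0r add0r scale1r.
have [du' du1] := du.
have [||c [cc c0 dc]] := @UT_lift u p.2 z.2 (cu 0) _ vw _.
- by rewrite u0; case: (p) up.
- by rewrite u0 du1.
exists (fun s => (u s, c s)); split=> //.
- by rewrite u0 c0 -surjective_pairing.
- by have [_ ->] := is_derive_pair du dc; rewrite -surjective_pairing.
Qed.

Lemma tangent_UT_lin p z e s t : tangent UTn p z -> tangent UTn p e ->
  tangent UTn p (s *: z + t *: e).
Proof.
move=> /tangent_UT[up z1 z2 z3] /tangent_UT[_ e1 e2 e3]; apply/tangent_UT; split=> //.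
- by rewrite [X in q _ X]/(_ *: _ + _ *: _) !lorentzE z1 e1 !mulr0 addr0.
- by rewrite [X in q _ X]/(_ *: _ + _ *: _) !lorentzE z2 e2 !mulr0 addr0.
- rewrite [X in q _ X + _]/(_ *: _ + _ *: _) [X in _ + q X _]/(_ *: _ + _ *: _) !lorentzE.
  by rewrite addrACA -!mulrDr z3 e3 !mulr0 addr0.
Qed.

Lemma dprojE p z : tangent UTn p z -> dproj p z = z.1.
Proof.
move=> tz; rewrite /dproj (@tdiff_ext _ _ _ _ _ (fst : W -> V))//; last first.
  by split; [exact: smooth_at_fst|near=> y].
have cf : continuous (fst : {linear W -> V}) by move=> y; exact: cvg_fst.
have df : differentiable (fst : {linear W -> V}) p by exact: linear_differentiable.
by rewrite (deriveE _ df) (diff_lin _ cf).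
Unshelve. all: by end_near. Qed.

Lemma cov_deriv_UT (c : R -> W) t : curve_at UTn c t ->
  cov_deriv H (@hyp_conn R n) (fst \o c) (snd \o c) t = hproj (c t).1 ('D_1 c t).2.
Proof.
move=> cc; have dc := smooth_at_is_derive cc.1.
have d1 := is_derive_fst dc; have d2 := is_derive_snd dc.
have nUT : \forall s \near t, [/\ H (c s).1, q (c s).1 (c s).2 = 0
    & q (c s).2 (c s).2 = 1].
  by apply: filterS cc.2 => s /UTE.
rewrite cov_deriv_hyp.
- by have [_ ->] := d2.
- split; last by apply: filterS nUT => s [].
  by apply: smooth_at_comp cc.1 _;
    [apply: finite_coordinates_prod; exact: finite_coordinates_rV|exact: smooth_at_fst].
- by apply: smooth_at_comp cc.1 _;
    [apply: finite_coordinates_prod; exact: finite_coordinates_rV|exact: smooth_at_snd].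
- by apply: filterS nUT => s [].
Qed.

Lemma connectorE p z : tangent UTn p z -> connector p z = hproj p.1 z.2.
Proof.
move=> tz; rewrite /connector; case: xgetP => [y _ [c [cc c0 cz ->]]|].
  by rewrite cov_deriv_UT// c0 cz.
have [c [cc c0 cz]] := tz.
by move=> /(_ (hproj p.1 z.2)) []; exists c; split=> //; rewrite cov_deriv_UT// c0 cz.
Qed.

Lemma sasakiE p z e : tangent UTn p z -> tangent UTn p e ->
  sasaki p z e = q z.1 e.1 + q (hproj p.1 z.2) (hproj p.1 e.2).
Proof. by move=> tz te; rewrite /sasaki !dprojE// !connectorE. Qed.

Lemma verticalE p z : vertical p z <-> tangent UTn p z /\ z.1 = 0.
Proof. by split=> -[tz]; [rewrite dprojE|move=> z1; split; rewrite ?dprojE]. Qed.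

Lemma horizontal_tangent p z : horizontal p z ->
  tangent UTn p z /\ z.2 = q z.1 p.2 *: p.1.
Proof.
move=> [c [cc c0 cz /nbhs_singleton cov]]; have tz : tangent UTn p z by exists c.
split=> //; move: cov; rewrite cov_deriv_UT// c0 cz /hproj => /eqP.
rewrite addr_eq0 => /eqP ->; have [_ _ _ e] := (tangent_UT _ _).1 tz.
by rewrite -scaleNr (lorentzC z.2); congr (_ *: _); apply/eqP; rewrite eq_sym -addr_eq0 addrC e.
Qed.

(** [horizontal] requires the covariant derivative to vanish for all times near [0], so a genuinely
    parallel field is needed and not just its velocity; along a geodesic it is explicit. *)
Lemma horizontal_lift p a : UTn p -> q p.1 a = 0 ->
  horizontal p (a, q a p.2 *: p.1).
Proof.
move=> /[dup] up /UTE[hx xv vv] xa.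
have [C [D [sCD dCD [C0 D0] CD1 cu]]] := hyp_curve hx xa.
(* v s = p.2 + k (u' s - a) is the parallel translate of p.2 along the
   geodesic u. *)
pose r := q a a; pose k := q a p.2 / r.
have kr : k * r = q a p.2.
  rewrite /k; have [r0|r0] := eqVneq r 0; last by rewrite divfK.
  by rewrite r0 mulr0 (lorentz_perp_eq0 hx xa r0) lorentz0l.
pose u s := C s *: p.1 + D s *: a.
pose v s := p.2 + k *: ((r * D s) *: p.1 + (C s - 1) *: a).
have dv t : is_derive t 1 v (q a p.2 *: u t).
  have [dC dD] := dCD t.
  have d1 : is_derive t 1 (fun s => r * D s) (r * C t).
    have := is_derive_scale (is_derive_const r t) dD.
    by rewrite scale0r add0r.
  have d2 : is_derive t 1 (fun s => C s - 1) (r * D t).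
    by have := is_derive_sub dC (is_derive_const (1 : R) t); rewrite subr0.
  have := is_derive_add (is_derive_const p.2 t)
    (is_derive_scale (is_derive_const k t) (is_derive_comb p.1 a d1 d2)).
  have rE : (r * C t) *: p.1 + (r * D t) *: a = r *: u t.
    by rewrite /u scalerDr !scalerA.
  by rewrite scale0r !add0r rE scalerA kr.
have vUT s : UTn (u s, v s).
  have [Cs CD] := CD1 s; apply/UTE; split=> /=; first exact: hyp_combination.
    rewrite /u /v !lorentzE xv xa (lorentzC a p.1) xa (hyp_lorentz hx) -/r.
    rewrite (_ : _ + _ = D s * (q a p.2 - k * r)); last by ring.
    by rewrite kr subrr mulr0.
  rewrite /v !lorentzE xv xa (lorentzC a p.1) xa (hyp_lorentz hx) vv -/r.
  rewrite (lorentzC p.2 p.1) xv (lorentzC p.2 a) -kr.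
  rewrite (_ : _ + _ = 1 + k ^+ 2 * r * (C s ^+ 2 - r * D s ^+ 2 - 1)); last by ring.
  by rewrite CD subrr mulr0 addr0.
have su t : smooth_at (fun s => (u s, v s)) t.
  have [sC sD] := sCD t; apply: smooth_at_pair.
    by apply: smooth_atD; apply: smooth_atZ => //; exact: smooth_at_cst.
  apply: smooth_atD; first exact: smooth_at_cst.
  apply: smooth_atZ; first exact: smooth_at_cst.
  apply: smooth_atD; apply: smooth_atZ; try exact: smooth_at_cst.
    by apply: smooth_atM => //; exact: smooth_at_cst.
  by apply: smooth_atB => //; exact: smooth_at_cst.
have cuv t : curve_at UTn (fun s => (u s, v s)) t by split=> //; near=> s; exact: vUT.
have duv t := is_derive_pair (is_derive_comb p.1 a (dCD t).1 (dCD t).2) (dv t).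
have u0 : u 0 = p.1 by rewrite /u C0 D0 scale0r addr0 scale1r.
exists (fun s => (u s, v s)); split=> //.
- rewrite u0 /v C0 D0 mulr0 subrr !scale0r addr0 scaler0 addr0.
  by rewrite -surjective_pairing.
- by have [_ ->] := duv 0; rewrite -/(u 0) u0 C0 D0 mulr0 scale0r add0r scale1r.
near=> t; rewrite cov_deriv_UT//; have [_ ->] := duv t.
rewrite /hproj /= lorentzZl hyp_lorentz; last by have /UTE[] := vUT t.
by rewrite mulrN1 scaleNr subrr.
Unshelve. all: by end_near. Qed.

Lemma hliftE p a : UTn p -> q p.1 a = 0 -> hlift p a = (a, q a p.2 *: p.1).
Proof.
move=> up xa; have hl := horizontal_lift up xa.
have [tl _] := horizontal_tangent hl.
rewrite /hlift; case: xgetP => [z _ [/horizontal_tangent[tz z2] za]|].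
  by move: za z2; rewrite dprojE// => <- <-; rewrite -surjective_pairing.
by move=> /(_ (a, q a p.2 *: p.1)) []; split=> //; rewrite dprojE.
Qed.

End UnitTangentBundle.

(** * The distribution [Db] in Lorentz coordinates and its stability under the connection *)

Section HorosphericalDistribution.
Context {R : realType} {n : nat}.
Local Notation V := 'rV[R]_n.+1.
Local Notation W := (V * V)%type.
Local Notation q := (@lorentz R n).
Local Notation H := (hyp R n).
Local Notation UTn := (UT R n).
Variables (b : V -> R) (om : V).
Hypotheses (om_null : q om om = 0) (om_future : 0 < om 0 ord0).
Hypothesis (bE : forall x, H x -> b x = ln (- q x om)).
Implicit Types (x a : V) (p z e : W) (s t : R).

Lemma lorentz_om_lt0 x : H x -> q x om < 0.
Proof. by move=> hx; apply: lorentz_lt0; rewrite ?om_null. Qed.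

Let om_neq0 x : H x -> q x om != 0.
Proof. by move=> /lorentz_om_lt0 h; rewrite lt_eqF. Qed.

Lemma tdiff_busemann x a : H x -> q x a = 0 -> tdiff H b x a = q a om / q x om.
Proof.
move=> hx xa; have ta : tangent H x a by apply/tangent_hyp.
have ext : local_extension H b x (fun y => ln (- q y om)).
  split; last by near=> y => hy; rewrite bE.
  apply: smooth_at_ln; first by rewrite oppr_gt0 lorentz_om_lt0.
  apply: smooth_atN; apply: smooth_at_lorentz; last exact: smooth_at_cst.
  exact: smooth_at_id.
rewrite (tdiff_ext ext ta); have [c [cc c0 ca]] := ta.
have dc := smooth_at_is_derive cc.1; rewrite ca in dc.
have dg : differentiable (fun y => ln (- q y om)) (c 0).
  by rewrite c0; exact: smooth_at_differentiable ext.1.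
have d1 := is_derive_along dg dc; rewrite c0 in d1.
have d2 : is_derive (0 : R) 1 (fun s => - q (c s) om) (- q a om).
  have := is_derive_lorentz dc (is_derive_const om (0 : R)).
  rewrite lorentz0r addr0 => d; have := is_derive_sub (is_derive_const (0 : R) (0 : R)) d.
  by rewrite sub0r; apply: is_derive_ext => s; rewrite sub0r.
have p0 : 0 < - q (c 0) om by rewrite c0 oppr_gt0 lorentz_om_lt0.
have d3 := @is_derive1_comp _ (@ln R) _ 0 _ _ (is_derive1_ln p0) d2.
rewrite (is_derive_unique d1 d3) c0.
by rewrite invrN mulrNN mulrC.
Unshelve. all: by end_near. Qed.

(** Tangential projection of [om / q x om], the ambient gradient of [ln (- q (x, om))] with respect
    to [q]. *)
Definition xi_field x : V := x + (q x om)^-1 *: om.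

Lemma xi_field_perp x : H x -> q x (xi_field x) = 0.
Proof.
by move=> hx; rewrite /xi_field !lorentzE hyp_lorentz// mulVf ?addNr// om_neq0.
Qed.

Lemma lorentz_xi_field x a : q x a = 0 -> q a (xi_field x) = q a om / q x om.
Proof. by move=> xa; rewrite /xi_field !lorentzE (lorentzC a) xa add0r mulrC. Qed.

Lemma xiE x : H x -> xi b x = xi_field x.
Proof.
move=> hx; have xp := xi_field_perp hx.
have tx : tangent H x (xi_field x) by apply/tangent_hyp.
have gx a : tangent H x a -> hyp_metric x (xi_field x) a = tdiff H b x a.
  move=> /tangent_hyp[_ xa]; rewrite tdiff_busemann// -lorentz_xi_field//.
  exact: lorentzC.
rewrite /xi /grad; case: xgetP => [y _ [ty gy]|]; last first.
  by move=> /(_ (xi_field x)) [].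
apply/eqP; rewrite -subr_eq0; apply/eqP.
have /tangent_hyp[_ xy] := ty.
have xd : q x (y - xi_field x) = 0 by rewrite lorentzBr xy xp subrr.
have td : tangent H x (y - xi_field x) by apply/tangent_hyp.
apply: (lorentz_perp_eq0 hx xd).
have := gy _ td; rewrite -(gx _ td) /hyp_metric => e.
by rewrite lorentzBl e subrr.
Qed.

Lemma xi_liftE p : UTn p ->
  xi_lift b p = (xi_field p.1, q (xi_field p.1) p.2 *: p.1).
Proof.
move=> up; have /UTE[hx _ _] := up.
by rewrite /xi_lift xiE// hliftE//; exact: xi_field_perp.
Qed.

Lemma tangent_lift p a : UTn p -> q p.1 a = 0 ->
  tangent UTn p (a, q a p.2 *: p.1).
Proof. by move=> up xa; have [] := horizontal_tangent (horizontal_lift up xa). Qed.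

(** The second component of a horizontal lift is a multiple of [p.1], which the connection map
    annihilates; only the base term survives. *)
Lemma sasaki_lift p z a : UTn p -> q p.1 a = 0 -> tangent UTn p z ->
  sasaki p z (a, q a p.2 *: p.1) = q z.1 a.
Proof.
move=> up xa tz; rewrite sasakiE//; last exact: tangent_lift.
have /UTE[hx _ _] := up.
have vz : hproj p.1 (q a p.2 *: p.1) = 0.
  by rewrite /hproj lorentzZl hyp_lorentz// mulrN1 scaleNr subrr.
by rewrite vz lorentz0r addr0.
Qed.

Lemma sasaki_xi_lift p z : tangent UTn p z ->
  sasaki p z (xi_lift b p) = q z.1 om / q p.1 om.
Proof.
move=> tz; have [up xz _ _] := (tangent_UT _ _).1 tz; have /UTE[hx _ _] := up.
have xp := xi_field_perp hx.
by rewrite xi_liftE// (sasaki_lift up xp tz) lorentz_xi_field.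
Qed.

(** The Sasaki product with [xi_lift] is [q z.1 om] divided by the nonzero number [q p.1 om]. The
    distribution is thus cut out by one linear functional independent of the point. *)
Lemma DbE p z : Db b p z <-> tangent UTn p z /\ q z.1 om = 0.
Proof.
split=> [[tz]|[tz z0]]; last by split=> //; rewrite sasaki_xi_lift// z0 mul0r.
have [/UTE[hx _ _] _ _ _] := (tangent_UT _ _).1 tz.
rewrite sasaki_xi_lift// => /eqP.
by rewrite mulf_eq0 invr_eq0 (negbTE (om_neq0 hx)) orbF => /eqP.
Qed.

Lemma ker_db_liftE p z : UTn p -> ker_db_lift b p z <->
  [/\ q p.1 z.1 = 0, q z.1 om = 0 & z.2 = q z.1 p.2 *: p.1].
Proof.
move=> up; have /UTE[hx _ _] := up; split.
  move=> [a [/tangent_hyp[_ xa] da] <-]; rewrite hliftE//; split=> //=.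
  move: da; rewrite tdiff_busemann// => /eqP.
  by rewrite mulf_eq0 invr_eq0 (negbTE (om_neq0 hx)) orbF => /eqP.
move=> [xa za z2]; exists z.1; last by rewrite hliftE// -z2 -surjective_pairing.
by split; [apply/tangent_hyp|rewrite tdiff_busemann// za mul0r].
Qed.

Lemma Db_direct_sum p : UTn p -> direct_sum (Db b p) (ker_db_lift b p) (vertical p).
Proof.
move=> up; have /UTE[hx xv vv] := up; split.
  apply/seteqP; split=> z.
    move=> /DbE[tz za]; have [_ xz vz xzv] := (tangent_UT _ _).1 tz.
    exists (z.1, q z.1 p.2 *: p.1); first exact/ker_db_liftE.
    exists (0, z.2 - q z.1 p.2 *: p.1).
      apply/verticalE; split=> //; apply/tangent_UT; split=> //=.
      - by rewrite lorentz0r.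
      - by rewrite !lorentzE vz (lorentzC p.2) xv mulr0 subrr.
      - rewrite !lorentzE hyp_lorentz// mulrN1 opprK addr0.
        exact: xzv.
    by rewrite -[LHS]/(_ + _, _ + _)/= addr0 addrC subrK -surjective_pairing.
  move=> [x /(ker_db_liftE _ up)[xx x1 x2] [y /verticalE[ty y1] <-]].
  have tx : tangent UTn p x.
    by rewrite [x]surjective_pairing x2; exact: tangent_lift.
  apply/DbE; split; last by rewrite (_ : (x + y).1 = x.1 + y.1)// y1 addr0.
  by have := tangent_UT_lin 1 1 tx ty; rewrite !scale1r.
apply/seteqP; split=> z.
  move=> [/(ker_db_liftE _ up)[_ _ z2] /verticalE[_ z1]] /=.
  by rewrite [z]surjective_pairing z2 z1 lorentz0l scale0r.
have w1 : (0 : W).1 = 0 by []; have w2 : (0 : W).2 = 0 by [].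
move=> ->; split.
  by apply/(ker_db_liftE _ up); rewrite w1 w2 lorentz0r !lorentz0l scale0r.
apply/verticalE; split=> //; apply/tangent_UT; split=> //;
  by rewrite ?w1 ?w2 ?lorentz0r ?lorentz0l ?addr0.
Qed.

Lemma vfield_xi_lift : vfield UTn (xi_lift b).
Proof.
split=> [|p up]; last first.
  have /UTE[hx _ _] := up.
  by rewrite xi_liftE//; apply: tangent_lift => //; exact: xi_field_perp.
apply: (@smooth_map_eq _ _ _ _
  (fun p => (xi_field p.1, q (xi_field p.1) p.2 *: p.1))).
  by move=> p up; rewrite xi_liftE.
apply: smooth_map_at => p /UTE[hx _ _].
have s1 : smooth_at (fst : W -> V) p by exact: smooth_at_fst.
have sx : smooth_at (fun p : W => xi_field p.1) p.
  apply: smooth_atD => //; apply: smooth_atZ; last exact: smooth_at_cst.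
  apply: smooth_atV; first exact: om_neq0.
  by apply: smooth_at_lorentz => //; exact: smooth_at_cst.
apply: smooth_at_pair => //; apply: smooth_atZ => //.
by apply: smooth_at_lorentz => //; exact: smooth_at_snd.
Qed.

Lemma dsectionB (X Y : W -> W) : dsection UTn (Db b) X -> dsection UTn (Db b) Y ->
  dsection UTn (Db b) (fun p => X p - Y p).
Proof.
move=> [[sX tX] DX] [[sY tY] DY].
have tXY p : UTn p -> tangent UTn p (X p - Y p).
  move=> up; have := tangent_UT_lin 1 (-1) (tX p up) (tY p up).
  by rewrite scale1r scaleN1r.
split; first by split=> //; exact: smooth_mapB.
move=> p up; have /DbE[_ X0] := DX p up; have /DbE[_ Y0] := DY p up.
apply/DbE; split; first exact: tXY.
by rewrite (_ : (X p - Y p).1 = (X p).1 - (Y p).1)// lorentzBl X0 Y0 subrr.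
Qed.

Variable nabla : (W -> W) -> (W -> W) -> W -> W.
Hypothesis nabla_conn : affine_connection UTn nabla.
Hypothesis nabla_xi : forall X, vfield UTn X ->
  forall p, UTn p -> nabla X (xi_lift b) p = 0.
Hypothesis nabla_metric : metric_compatible UTn sasaki nabla.

(** Differentiate the identity [sasaki Y xi_lift = 0] in the direction [X]: the term with the
    derivative of [xi_lift] vanishes, leaving [sasaki (nabla X Y) xi_lift = 0]. *)
Lemma nabla_Db (X Y : W -> W) : dsection UTn (Db b) X -> dsection UTn (Db b) Y ->
  dsection UTn (Db b) (nabla X Y).
Proof.
move=> [vX DX] [vY DY]; have vN := conn_vfield nabla_conn vX vY.
split=> // p up; split; first exact: vN.2.
have := nabla_metric vX vY vfield_xi_lift up.
rewrite nabla_xi//.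
(* [sasaki] is computed through [xget], so even its value on the zero vector needs tangency of that
   vector. *)
have t0 : tangent UTn p 0.
  have := tangent_UT_lin 0 0 (vX.2 p up) (vX.2 p up).
  by rewrite !scale0r addr0.
have -> : sasaki p (Y p) 0 = 0.
  rewrite sasakiE//; last exact: vY.2.
  rewrite (_ : (0 : W).1 = 0)// (_ : (0 : W).2 = 0)//.
  by rewrite [hproj _ 0]hproj_id lorentz0r// add0r lorentz0r.
rewrite addr0 => <-; rewrite /vderiv.
rewrite (@tdiff_eq _ _ _ _ _ (fun=> 0)); last by move=> y /DY[].
rewrite (@tdiff_ext _ _ _ _ _ (fun=> 0)) ?derive_cst//; last exact: vX.2.
by split; [exact: smooth_at_cst|near=> y].
Unshelve. all: by end_near. Qed.

Lemma lie_bracket_Db (X Y : W -> W) :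
  dsection UTn (Db b) (torsion UTn nabla X Y) ->
  dsection UTn (Db b) X -> dsection UTn (Db b) Y ->
  dsection UTn (Db b) (lie_bracket UTn X Y).
Proof.
move=> DT DX DY.
have -> : lie_bracket UTn X Y =
    (fun p => nabla X Y p - nabla Y X p - torsion UTn nabla X Y p).
  by apply/funext => p; rewrite /torsion subKr.
apply: dsectionB => //; apply: dsectionB; exact: nabla_Db.
Qed.

End HorosphericalDistribution.

(** * Charts and connected integral submanifolds *)

Section Foliations.
Context {R : realType}.
Implicit Types (E : normedModType R).

(** Pull [S] back to the segment from [u] to [w] and use connectedness of [[0, 1]]. *)
Lemma clopen_full E (S : set E) u w : open S -> open (~` S) -> S u -> S w.
Proof.
move=> oS oC Su; pose f (s : R) : E := u + s *: (w - u).
have cf : continuous f.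
  move=> s; apply: smooth_at_continuous; apply: smooth_atD; first exact: smooth_at_cst.
  by apply: smooth_atZ; [exact: smooth_at_id|exact: smooth_at_cst].
have oSC : open (~` (f @^-1` S)).
  by rewrite preimage_setC; apply: open_comp => // s _; exact: cf.
have := @segment_connected R 0 1 (`[(0 : R), 1]%classic `&` f @^-1` S).
have fS : `[(0 : R), 1]%classic `&` f @^-1` S = `[(0 : R), 1]%classic -> S w.
  move=> /seteqP[_ /(_ 1)] []; first by rewrite /= in_itv/= lexx ler01.
  by move=> _; rewrite /f /= scale1r addrC subrK.
move=> con; apply: fS; apply: con.
- exists 0; apply: conj; first by rewrite /= in_itv/= lexx ler01.
  by rewrite /f /= scale0r addr0.
- by exists (f @^-1` S) => //; apply: open_comp => // s _; exact: cf.
- exists (f @^-1` S) => //; rewrite -[f @^-1` S]setCK; apply: open_closedC.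
  exact: oSC.
Qed.

(** Each [phi i] identifies the whole of [R^k] with the part of [N] in the open set [O i], with an
    inverse that is smooth in the ambient space. The left inverse makes the differential injective,
    and continuity of [psi i \o phi j] makes overlaps open. *)
Lemma immersed_atlas_of_charts E k (N : set E) (phi : nat -> 'rV[R]_k -> E)
    (psi : nat -> E -> 'rV[R]_k) (O : nat -> set E) :
  (forall i u, smooth_at (phi i) u) ->
  (forall i u, N (phi i u) /\ O i (phi i u)) ->
  (forall i u, psi i (phi i u) = u) ->
  (forall i x, N x -> O i x -> phi i (psi i x) = x) ->
  (forall i, open (O i)) ->
  (forall i x, O i x -> smooth_at (psi i) x) ->
  (forall x, N x -> exists i, O i x) ->
  immersed_atlas N (fun=> setT) phi.
Proof.
move=> sphi Nphi phiK psiK oO spsi cov.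
have inj i : injective (phi i) by move=> u v e; rewrite -(phiK i u) e phiK.
split=> //.
- by move=> i; exact: openT.
- by move=> i u v _ _; exact: inj.
- move=> i u _ v w e.
  have dphi := smooth_at_differentiable (sphi i u).
  have dpsi := smooth_at_differentiable (spsi i _ (Nphi i u).2).
  have dK z : 'd (psi i) (phi i u) ('d (phi i) u z) = z.
    have <- : 'd (psi i \o phi i) u z = 'd (psi i) (phi i u) ('d (phi i) u z).
      by rewrite (diff_comp dphi dpsi).
    have -> : psi i \o phi i = idfun by apply/funext => y /=; rewrite phiK.
    by rewrite diff_lin// => y; exact: cvg_id.
  by rewrite -(dK v) e dK.
- apply/seteqP; split=> x; last by move=> [i _ [u _ <-]]; exact: (Nphi i u).1.
  by move=> Nx; have [i Oi] := cov x Nx; exists i => //; exists (psi i x) => //; exact: psiK.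
- move=> i j V oV _; rewrite setTI openE => u [v Vv e].
  have ej : O i (phi j u) by rewrite -e; exact: (Nphi i v).2.
  have h1 : \forall u' \near u, O i (phi j u').
    exact: smooth_at_continuous (sphi j u) _ (open_nbhs_nbhs (conj (oO i) ej)).
  have h2 : \forall u' \near u, V (psi i (phi j u')).
    have Ve : nbhs (psi i (phi j u)) V.
      by rewrite -e phiK; exact: open_nbhs_nbhs (conj oV Vv).
    have Vpsi := smooth_at_continuous (spsi i _ ej) Ve.
    exact: smooth_at_continuous (sphi j u) _ Vpsi.
  apply: filterS2 h1 h2 => u' Ou' Vu'; exists (psi i (phi j u')) => //.
  by apply: psiK => //; exact: (Nphi j u').1.
Qed.

(** Straight lines in the chart give one inclusion. For the other, a curve [c] in [N] equals
    [phi \o psi \o c] near time [0], so its velocity is in the range of the differential. *)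
Lemma range_chart_tangent E k (N : set E) (phi : 'rV[R]_k -> E)
    (psi : E -> 'rV[R]_k) (O : set E) u :
  smooth_at phi u -> (forall v, N (phi v)) -> psi (phi u) = u ->
  (forall x, N x -> O x -> phi (psi x) = x) -> open O -> O (phi u) ->
  smooth_at psi (phi u) -> range ('d phi u) = tangent N (phi u).
Proof.
move=> sphi Nphi phiK psiK oO Ou spsi; apply/seteqP; split=> z.
  move=> [w _ <-]; exists (fun s => phi (u + s *: w)).
  have sl : smooth_at (fun s : R => u + s *: w) 0.
    apply: smooth_atD; first exact: smooth_at_cst.
    by apply: smooth_atZ; [exact: smooth_at_id|exact: smooth_at_cst].
  have e0 : u + (0 : R) *: w = u by rewrite scale0r addr0.
  split.
  - split; last by near=> s; exact: Nphi.
    by apply: (smooth_at_comp (finite_coordinates_rV k) sl); rewrite e0.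
  - by rewrite e0.
  - have dl : is_derive (0 : R) 1 (fun s : R => u + s *: w) w.
      have := is_derive_add (is_derive_const u (0 : R))
        (is_derive_scale (is_derive_id (0 : R) 1) (is_derive_const w (0 : R))).
      by rewrite scale1r scaler0 add0r addr0.
    have dphi : differentiable phi (u + (0 : R) *: w).
      by rewrite e0; exact: smooth_at_differentiable.
    have [_ ->] := is_derive_along dphi dl; rewrite e0 deriveE//.
    by rewrite -e0.
move=> [c [cc c0 cz]]; have dc := smooth_at_is_derive cc.1; rewrite cz in dc.
have dpsi : differentiable psi (c 0) by rewrite c0; exact: smooth_at_differentiable.
have d1 := is_derive_along dpsi dc.
have dphi := smooth_at_differentiable sphi.
have dphi' : differentiable phi (psi (c 0)) by rewrite c0 phiK.
have d2 := is_derive_along dphi' d1.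
have nO : \forall s \near (0 : R), O (c s).
  have Oc : nbhs (c 0) O by rewrite c0; exact: open_nbhs_nbhs.
  exact: smooth_at_continuous cc.1 _ Oc.
have d3 : is_derive (0 : R) 1 c ('D_('D_z psi (c 0)) phi (psi (c 0))).
  apply: near_eq_is_derive d2.
  by apply: filterS2 cc.2 nO => s Ns Os; exact: psiK.
rewrite (is_derive_unique dc d3) c0 phiK deriveE//; by exists ('D_z psi (phi u)).
Unshelve. all: by end_near. Qed.

(** In a chart [f] has zero derivative along segments inside a ball, hence is locally constant. Its
    level sets are open and closed for the topology of the atlas, which is the topology in which [N]
    is connected. *)
Lemma connected_integral_const E (M : set E) (D : E -> set E) (f : {linear E -> R})
    (N : set E) :
  continuous f -> (forall p z, D p z -> f z = 0) ->
  connected_integral_submanifold M D N ->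
  forall p r, N p -> N r -> f r = f p.
Proof.
move=> cf fD [k [U [phi [[at_ NM rD] con]]]] p r Np Nr.
have loc i u : U i u -> \forall u' \near u, U i u' /\ f (phi i u') = f (phi i u).
  move=> Uu; have oU : open (U i) := @atlas_open _ _ _ _ _ _ at_ i.
  move: oU; rewrite openE => /(_ u Uu).
  move=> /nbhs_ballP[e /= e0 eU]; apply/nbhs_ballP; exists e => //= u' eu'.
  split; first exact: eU.
  pose l (s : R) := u + s *: (u' - u).
  have l0 : l 0 = u by rewrite /l scale0r addr0.
  have l1 : l 1 = u' by rewrite /l scale1r addrC subrK.
  rewrite -l0 -[in LHS]l1.
  apply: (@is_derive0_const R (fun s => f (phi i (l s))) 0 1) => // s /andP[s0 s1].
  have Ul : U i (l s).
    apply: eU; move: eu'; rewrite -!ball_normE /= /l opprD addrA subrr sub0r normrN.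
    rewrite normrZ ger0_norm// distrC; apply: le_lt_trans.
    by rewrite ler_piMl.
  have dl : is_derive s 1 l (u' - u).
    have := is_derive_add (is_derive_const u s)
      (is_derive_scale (is_derive_id s 1) (is_derive_const (u' - u) s)).
    by rewrite scale1r scaler0 add0r addr0.
  have dphi := smooth_at_differentiable (atlas_smooth at_ Ul).
  have := is_derive_lin cf (is_derive_along dphi dl).
  rewrite (deriveE _ dphi) (fD (phi i (l s)))//.
  by have /seteqP[rr _] := rD i _ Ul; apply: rr; exists (u' - u).
pose A := N `&` [set x | f x = f p].
have NU i u : U i u -> N (phi i u).
  by move=> Uu; rewrite (atlas_cover at_); exists i => //; exists u.
suff AN : A = N by have [] : A r by rewrite AN.
apply: con => //.
- by move=> x [].
- by exists p.
- move=> i; rewrite openE => u [Uu [_ fu]]; apply: filterS (loc i u Uu) => u' [Uu' fu'].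
  by split=> //; split; [exact: NU|rewrite /= fu' fu].
- move=> i; rewrite openE => u [Uu [_ nA]]; apply: filterS (loc i u Uu) => u' [Uu' fu'].
  split=> //; split; first exact: NU.
  by move=> [_ /= e]; apply: nA; split; [exact: NU|rewrite /= -fu' e].
Qed.

End Foliations.

(** * Charts of the horospherical cylinders *)

Section HorosphereCoordinates.
Context {R : realType} {n : nat}.
Local Notation V := 'rV[R]_n.+1.
Local Notation q := (@lorentz R n).
Local Notation H := (hyp R n).
Variables (om xs : V) (kappa : R).
Hypotheses (n_ge2 : (2 <= n)%N) (kappa_gt0 : 0 < kappa).
Hypotheses (om_null : q om om = 0) (hxs : H xs) (xs_om : q xs om = - kappa).

Lemma smooth_at_mulmxr k l (B : 'M[R]_(k, l)) (y : 'rV[R]_k) :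
  smooth_at (fun z : 'rV[R]_k => z *m B) y.
Proof.
apply: (@smooth_at_eq _ _ _ (fun z : 'rV[R]_k => \sum_j z 0 j *: row j B)).
  by near=> z; rewrite mulmx_sum_row.
apply: smooth_at_sum => j; apply: smooth_atZ; last exact: smooth_at_cst.
by apply: smooth_at_coord; exact: smooth_at_id.
Unshelve. all: by end_near. Qed.

Let kappa_neq0 : kappa != 0. Proof. by rewrite gt_eqF. Qed.

(* Projection onto {xs, om}^perp along the span of xs and om. *)
Definition perp_proj (v : V) : V :=
  v + (q v om / kappa) *: xs + ((q v xs - q v om / kappa) / kappa) *: om.

Lemma perp_proj_perp v : q (perp_proj v) om = 0 /\ q (perp_proj v) xs = 0.
Proof.
rewrite /perp_proj !lorentzE om_null xs_om (hyp_lorentz hxs) (lorentzC om) xs_om.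
by split; field.
Qed.

Lemma perp_proj_id v : q v om = 0 -> q v xs = 0 -> perp_proj v = v.
Proof. by rewrite /perp_proj => -> ->; rewrite mul0r subrr mul0r !scale0r !addr0. Qed.

Lemma perp_proj_is_linear : linear perp_proj.
Proof.
move=> r u v; rewrite /perp_proj !lorentzE.
by apply/rowP => j; rewrite !mxE; field.
Qed.

(** Linear coordinates on the orthogonal of [xs] and [om], realized as the kernel of a matrix with
    two columns; [m] is left as its rank. The final unit vector will be the direction where the two
    charts of a cylinder meet. *)
Lemma horosphere_coordinates : exists m (L : 'rV[R]_m -> V) (Pi : V -> 'rV[R]_m),
  [/\ (forall y, smooth_at L y) /\ (forall v, smooth_at Pi v),
      linear Pi /\ (forall y, Pi (L y) = y),
      forall y, q (L y) om = 0 /\ q (L y) xs = 0,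
      forall v, L (Pi v) = perp_proj v
    & exists y, q (L y) (L y) = 1].
Proof.
pose z (j : 'I_2) : V := if j == ord0 then xs else om.
pose A : 'M[R]_(n.+1, 2) := \matrix_(i, j) q (delta_mx 0 i) (z j).
have mulA v j : (v *m A) 0 j = q v (z j).
  rewrite mxE [in RHS](row_sum_delta v).
  have -> : forall f : 'I_n.+1 -> V, q (\sum_i f i) (z j) = \sum_i q (f i) (z j).
    move=> f; apply: (big_morph (fun x => q x (z j))) => [x y|].
      exact: lorentzDl.
    exact: lorentz0l.
  by apply: eq_bigr => i _; rewrite mxE lorentzZl.
have kerA v : (v <= kermx A)%MS <-> q v om = 0 /\ q v xs = 0.
  have zx : z ord0 = xs by rewrite /z eqxx.
  have zo : z ord_max = om by [].
  split=> [/sub_kermxP vA|[vo vx]].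
    by rewrite -zo -zx -!mulA vA !mxE.
  apply/sub_kermxP/rowP => j; rewrite mulA mxE /z.
  by case: ifP.
pose B := row_base (kermx A).
have Bker (y : 'rV_(\rank (kermx A))) : (y *m B <= kermx A)%MS.
  by rewrite -(eq_row_base (kermx A)) submxMl.
exists (\rank (kermx A)), (fun y => y *m B), (fun v => perp_proj v *m pinvmx B).
have BK v : (v <= kermx A)%MS -> v *m pinvmx B *m B = v.
  by move=> vA; rewrite mulmxKpV// eq_row_base.
have KB (y : 'rV_(\rank (kermx A))) : y *m B *m pinvmx B = y.
  by rewrite -mulmxA mulmxVp ?mulmx1// row_base_free.
have sproj v : smooth_at perp_proj v.
  have sl w : smooth_at (fun v => q v w) v.
    by apply: smooth_at_lorentz; [exact: smooth_at_id|exact: smooth_at_cst].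
  have so : smooth_at (fun v => q v om / kappa) v.
    by apply: smooth_atM => //; exact: smooth_at_cst.
  apply: smooth_atD.
    apply: smooth_atD; first exact: smooth_at_id.
    by apply: smooth_atZ => //; exact: smooth_at_cst.
  apply: smooth_atZ; last exact: smooth_at_cst.
  by apply: smooth_atM; [exact: smooth_atB|exact: smooth_at_cst].
split.
- split=> [y|v]; first exact: smooth_at_mulmxr.
  apply: (smooth_at_comp (g := fun w => w *m pinvmx B)) (sproj v) _.
    exact: finite_coordinates_rV.
  exact: smooth_at_mulmxr.
- split=> [r u v|y]; first by rewrite perp_proj_is_linear mulmxDl -scalemxAl.
  by have [yo yx] := (kerA _).1 (Bker y); rewrite perp_proj_id.
- by move=> y; apply/kerA.
- by move=> v; apply: BK; apply/kerA; exact: perp_proj_perp.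
(* The rank of [A] is at most [2], less than the dimension [n + 1]. A nonzero kernel vector is
   orthogonal to [xs], hence spacelike and normalizable. *)
have kerA0 : kermx A != 0.
  rewrite -mxrank_eq0 mxrank_ker subn_eq0 -ltnNge ltnS.
  by apply: leq_trans (rank_leq_col A) n_ge2.
have /rowV0Pn[v vA v0] := kerA0.
have [vo vx] := (kerA v).1 vA; rewrite lorentzC in vx.
have vv : 0 < q v v.
  rewrite lt_neqAle (lorentz_perp_ge0 hxs vx) andbT eq_sym.
  by apply: contra v0 => /eqP vv; rewrite (lorentz_perp_eq0 hxs vx vv).
exists ((Num.sqrt (q v v))^-1 *: (v *m pinvmx B)).
rewrite -scalemxAl BK// !lorentzE mulrA -expr2 exprVn sqr_sqrtr ?(ltW vv)//.
by rewrite mulVf// gt_eqF.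
Unshelve. all: by end_near. Qed.

End HorosphereCoordinates.

Section Charts.
Context {R : realType} {n : nat}.
Local Notation V := 'rV[R]_n.+1.
Local Notation W := (V * V)%type.
Local Notation q := (@lorentz R n).
Local Notation H := (hyp R n).
Variables (om xs : V) (kappa : R).
Hypotheses (kappa_gt0 : 0 < kappa) (om_null : q om om = 0).
Hypotheses (om_future : 0 < om 0 ord0) (hxs : H xs) (xs_om : q xs om = - kappa).
Variables (m : nat) (L : 'rV[R]_m -> V) (Pi : V -> 'rV[R]_m).
Hypotheses (smoothL : forall y, smooth_at L y) (smoothPi : forall v, smooth_at Pi v).
Hypotheses (Pi_linear : linear Pi) (PiL : forall y, Pi (L y) = y).
Hypothesis L_perp : forall y, q (L y) om = 0 /\ q (L y) xs = 0.
Hypothesis LPi : forall v, L (Pi v) = perp_proj om xs kappa v.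

Let kappa_neq0 : kappa != 0. Proof. by rewrite gt_eqF. Qed.

Definition cylinder : set W := [set p | UT R n p /\ q p.1 om = - kappa].

(** The parabolic translate of [xs] by [h]; the coefficient of [om] is forced by [q x x = -1]. *)
Definition horo_point (h : V) : V := xs + h + (q h h / (2 * kappa)) *: om.

(** [h] corrected along [om] to become tangent at [x]; as [om] is null and orthogonal to [h],
    lengths are preserved. *)
Definition horo_shift (x h : V) : V := h + (q h x / kappa) *: om.

(* Stereographic projection of the unit sphere of T_x from the pole
   eps * grad b, in the frame horo_shift x of the horosphere at x. *)
Definition horo_vector (eps : R) (x h : V) : V :=
  (q h h + 1)^-1 *: (2 *: horo_shift x h
    + (eps * (q h h - 1)) *: (x - kappa^-1 *: om)).

Definition cyl_chart eps (y : 'rV[R]_(m + m)) : W :=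
  let x := horo_point (L (lsubmx y)) in (x, horo_vector eps x (L (rsubmx y))).

(** Inverse stereographic formula. With [r = q h h] and [s = q v om] one has
    [kappa + eps * s = 2 * kappa / (r + 1)], so the scalar factor is [(r + 1) / 2]; the added
    multiple of [Pi p.1] cancels the [x] component of [v], while [Pi] kills [om] and [xs]. *)
Definition cyl_coord eps (p : W) : 'rV[R]_(m + m) :=
  row_mx (Pi p.1) ((kappa / (kappa + eps * q p.2 om))
    *: (Pi p.2 + (q p.2 om / kappa) *: Pi p.1)).

(** On the cylinder this removes exactly the pole [eps * grad b] of each fibre. *)
Definition cyl_dom eps : set W := [set p | kappa + eps * q p.2 om != 0].

Lemma horo_point_lorentz h : q h om = 0 -> q h xs = 0 ->
  q (horo_point h) (horo_point h) = -1 /\ q (horo_point h) om = - kappa.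
Proof.
move=> ho hx; rewrite /horo_point !lorentzE (hyp_lorentz hxs) om_null xs_om.
rewrite (lorentzC om) xs_om (lorentzC xs h) hx ho (lorentzC om h) ho.
by split; field.
Qed.

Lemma horo_point_hyp h : q h om = 0 -> q h xs = 0 -> H (horo_point h).
Proof.
move=> ho hx; have [x1 x2] := horo_point_lorentz ho hx.
by apply: (hyp_future x1 om_null om_future); rewrite x2 oppr_lt0.
Qed.

Lemma horo_shift_lorentz x h : q x om = - kappa -> q h om = 0 ->
  [/\ q (horo_shift x h) x = 0, q (horo_shift x h) om = 0
    & q (horo_shift x h) (horo_shift x h) = q h h].
Proof.
move=> xo ho; rewrite /horo_shift !lorentzE om_null ho (lorentzC om x) xo.
by rewrite (lorentzC om h) ho; split; field.
Qed.

Lemma horo_vector_lorentz eps x h : eps ^+ 2 = 1 -> q h xs = 0 -> q x x = -1 ->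
  q x om = - kappa -> q h om = 0 -> let v := horo_vector eps x h in
  [/\ 0 <= q h h, q x v = 0, q v v = 1
    & q v om = - kappa * (eps * (q h h - 1) / (q h h + 1))].
Proof.
move=> eps2 hx xx xo ho v.
have hh : 0 <= q h h by apply: (lorentz_perp_ge0 hxs); rewrite lorentzC.
have [sx so ss] := horo_shift_lorentz xo ho.
have r1 : q h h + 1 != 0 by rewrite gt_eqF// ltr_wpDl.
rewrite {}/v /horo_vector.
move: (horo_shift x h) sx so ss => g gx go gg.
move: (q h h) hh r1 gg => r r0 r1 gg.
have xg : q x g = 0 by rewrite lorentzC.
have og : q om g = 0 by rewrite lorentzC.
have ox : q om x = - kappa by rewrite lorentzC.
rewrite !lorentzE om_null gx go gg xx xo xg og ox; split=> //.
- by field; rewrite ?r1 ?kappa_neq0.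
- rewrite (_ : _ * _ = (r + 1)^-1 ^+ 2 * (4 * r + eps ^+ 2 * (r - 1) ^+ 2)).
    by rewrite eps2; field; rewrite ?r1.
  by field; rewrite ?r1 ?kappa_neq0.
- by field; rewrite ?r1 ?kappa_neq0.
Qed.

Lemma cyl_chart_in eps y : eps ^+ 2 = 1 ->
  cylinder (cyl_chart eps y) /\ cyl_dom eps (cyl_chart eps y).
Proof.
move=> eps2; rewrite /cyl_chart /cylinder /cyl_dom /=.
set h1 := L (lsubmx y); set h2 := L (rsubmx y).
have [h1o h1x] : q h1 om = 0 /\ q h1 xs = 0 by exact: L_perp.
have [h2o h2x] : q h2 om = 0 /\ q h2 xs = 0 by exact: L_perp.
have [xx xo] := horo_point_lorentz h1o h1x; have hx := horo_point_hyp h1o h1x.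
have [hh xv vv vo] := horo_vector_lorentz eps2 h2x xx xo h2o.
split; first by split=> //; apply/UTE.
rewrite vo; have r1 : q h2 h2 + 1 != 0 by rewrite gt_eqF// ltr_wpDl.
rewrite (_ : kappa + _ = 2 * kappa / (q h2 h2 + 1)).
  by rewrite !mulf_eq0 invr_eq0 pnatr_eq0 (negbTE r1) (negbTE kappa_neq0).
rewrite (_ : eps * _ = - kappa * (eps ^+ 2 * (q h2 h2 - 1) / (q h2 h2 + 1))).
  by rewrite eps2; field; rewrite ?r1.
by ring.
Qed.

Let Pi0 : Pi 0 = 0.
Proof.
have := Pi_linear 1 0 0; rewrite !scale1r addr0 => /eqP.
by rewrite -subr_eq subrr => /eqP.
Qed.

Let PiZ r v : Pi (r *: v) = r *: Pi v.
Proof. by have := Pi_linear r v 0; rewrite !addr0 Pi0 addr0. Qed.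

Let PiD u v : Pi (u + v) = Pi u + Pi v.
Proof. by have := Pi_linear 1 u v; rewrite !scale1r. Qed.

Let L_inj y z : L y = L z -> y = z.
Proof. by move=> e; rewrite -(PiL y) e PiL. Qed.

Let L0 : L 0 = 0.
Proof. by rewrite -Pi0 LPi /perp_proj !lorentz0l !mul0r subrr mul0r !scale0r !addr0. Qed.

Let Pi_om : Pi om = 0.
Proof.
apply: L_inj; rewrite LPi L0 /perp_proj om_null (lorentzC om) xs_om.
by apply/rowP => j; rewrite !mxE; field.
Qed.

Let Pi_xs : Pi xs = 0.
Proof.
apply: L_inj; rewrite LPi L0 /perp_proj xs_om (hyp_lorentz hxs).
by apply/rowP => j; rewrite !mxE; field.
Qed.

Lemma cyl_chartK eps y : eps ^+ 2 = 1 -> cyl_coord eps (cyl_chart eps y) = y.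
Proof.
move=> eps2; have := cyl_chart_in y eps2.
rewrite /cyl_chart /cyl_coord /cyl_dom /=.
set h1 := L (lsubmx y); set h2 := L (rsubmx y).
have [h1o h1x] : q h1 om = 0 /\ q h1 xs = 0 by exact: L_perp.
have [h2o h2x] : q h2 om = 0 /\ q h2 xs = 0 by exact: L_perp.
have [xx xo] := horo_point_lorentz h1o h1x.
have [hh xv vv vo] := horo_vector_lorentz eps2 h2x xx xo h2o.
have Px : Pi (horo_point h1) = lsubmx y.
  by rewrite /horo_point !PiD PiZ Pi_om Pi_xs scaler0 addr0 add0r PiL.
have Pv : Pi (horo_vector eps (horo_point h1) h2)
    = (q h2 h2 + 1)^-1 *: (2 *: rsubmx y + (eps * (q h2 h2 - 1)) *: lsubmx y).
  have P2 : Pi h2 = rsubmx y by exact: PiL.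
  move: (horo_point h1) Px => X Px.
  rewrite /horo_vector /horo_shift -scaleNr !(PiZ, PiD) P2 Px Pi_om.
  by rewrite !scaler0 !addr0.
move=> [_ D0]; rewrite Px Pv -[RHS]hsubmxK; congr row_mx.
have r1 : q h2 h2 + 1 != 0 by rewrite gt_eqF// ltr_wpDl.
move: D0; rewrite vo; move: (q h2 h2) r1 => r r1.
rewrite (_ : kappa + _ = 2 * kappa / (r + 1)); last first.
  rewrite (_ : eps * _ = - kappa * (eps ^+ 2 * (r - 1) / (r + 1))).
    by rewrite eps2; field; rewrite ?r1.
  by ring.
move=> _; apply/rowP => j; rewrite !mxE; field.
by rewrite r1 kappa_neq0.
Qed.

Lemma cyl_coordK eps p : eps ^+ 2 = 1 -> cylinder p -> cyl_dom eps p ->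
  cyl_chart eps (cyl_coord eps p) = p.
Proof.
move=> eps2 [/UTE[hx xv vv] xo]; rewrite /cyl_dom /= => D0.
rewrite /cyl_chart /cyl_coord row_mxKl row_mxKr.
case: p hx xv vv xo D0 => x v /= hx xv vv xo D0.
have xx := hyp_lorentz hx; have vx : q v x = 0 by rewrite lorentzC.
have ox : q om x = - kappa by rewrite lorentzC.
have ov : q om v = q v om by exact: lorentzC.
have xsx : q xs x = q x xs by exact: lorentzC.
have oxs : q om xs = - kappa by rewrite lorentzC.
have xE : horo_point (L (Pi x)) = x.
  rewrite LPi /horo_point /perp_proj !lorentzE om_null xs_om xo ox oxs xx xsx.
  rewrite (hyp_lorentz hxs).
  by apply/rowP => j; rewrite !mxE; field.
congr pair => //; rewrite xE.
set s := q v om in ov D0 *; set D := kappa + eps * s in D0 *.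
(* [g] is orthogonal to [om], so [perp_proj] alters it only by a multiple of [om], which
   [horo_shift] at [x] readjusts. *)
pose g := (kappa / D) *: (v + (s / kappa) *: x).
have go : q g om = 0 by rewrite /g !lorentzE xo -/s; field; rewrite D0 kappa_neq0.
have gx : q g x = - (s / D).
  by rewrite /g !lorentzE vx xx; field; rewrite D0 kappa_neq0.
have gg : q g g = (kappa ^+ 2 - s ^+ 2) / D ^+ 2.
  by rewrite /g !lorentzE vx xv xx vv; field; rewrite D0 kappa_neq0.
have hE : L ((kappa / D) *: (Pi v + (s / kappa) *: Pi x)) = g + (q g xs / kappa) *: om.
  rewrite -PiZ -PiD -PiZ LPi -/g /perp_proj go.
  by rewrite mul0r subr0 scale0r addr0.
have gE : g = (kappa / D) *: (v + (s / kappa) *: x) by [].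
clearbody g; rewrite hE; set h := g + _.
have hh : q h h = (kappa ^+ 2 - s ^+ 2) / D ^+ 2.
  by rewrite /h !lorentzE (lorentzC om g) go om_null gg; ring.
have hX : q h x = - (s / D) - q g xs by rewrite /h !lorentzE gx ox; field; rewrite ?D0 ?kappa_neq0.
rewrite /horo_vector /horo_shift hh hX /h gE.
(* The two signs are treated separately because [q h h + 1 = 2 * kappa * D / D ^+ 2] simplifies only
   after [eps] is a number. *)
have e1 : (eps - 1) * (eps + 1) = 0 by rewrite -subr_sqr eps2 expr1n subrr.
have De : D = kappa + eps * s by [].
move: (q g xs) => gxs; clearbody s D.
move/eqP: e1; rewrite mulf_eq0 subr_eq0 addr_eq0 => /orP[] /eqP ee;
  rewrite ee ?mul1r ?mulN1r in De; rewrite ee De in D0 *;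
  apply/rowP => j; rewrite !mxE; field; rewrite ?D0 ?kappa_neq0 //=.
- rewrite (_ : _ + _ = 2 * kappa * (kappa + s)); last by ring.
  by rewrite !mulf_eq0 pnatr_eq0 (negbTE D0) (negbTE kappa_neq0).
- rewrite (_ : _ + _ = 2 * kappa * (kappa - s)); last by ring.
  by rewrite !mulf_eq0 pnatr_eq0 (negbTE D0) (negbTE kappa_neq0).
Qed.

Lemma smooth_at_horo_point (E : normedModType R) (f : E -> V) p :
  smooth_at f p -> smooth_at (fun z => horo_point (f z)) p.
Proof.
move=> sf; apply: smooth_atD.
  by apply: smooth_atD => //; exact: smooth_at_cst.
apply: smooth_atZ; last exact: smooth_at_cst.
by apply: smooth_atM; [exact: smooth_at_lorentz|exact: smooth_at_cst].
Qed.

Lemma smooth_at_cyl_chart eps y : smooth_at (cyl_chart eps) y.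
Proof.
have sub (f : 'rV[R]_(m + m) -> 'rV[R]_m) : linear f -> continuous f ->
    smooth_at (fun z => L (f z)) y.
  move=> lf cf; pose fM := GRing.isLinear.Build _ _ _ _ _ lf.
  pose fL : {linear _ -> _} := HB.pack f fM.
  apply: (smooth_at_comp (finite_coordinates_rV m)) (smoothL _).
  exact: (@smooth_at_linear _ _ _ fL).
have s1 : smooth_at (fun z => L (lsubmx z)) y.
  by apply: sub; [exact: linearP|exact: continuous_lsubmx].
have s2 : smooth_at (fun z => L (rsubmx z)) y.
  by apply: sub; [exact: linearP|exact: continuous_rsubmx].
have sx := smooth_at_horo_point s1.
have srho : smooth_at (fun z => q (L (rsubmx z)) (L (rsubmx z))) y.
  exact: smooth_at_lorentz.
have s1c (a : R) : smooth_at (fun=> a : R) y by exact: smooth_at_cst.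
have [h2o h2x] : q (L (rsubmx y)) om = 0 /\ q (L (rsubmx y)) xs = 0 by exact: L_perp.
apply: smooth_at_pair => //; apply: smooth_atZ.
  apply: smooth_atV; last exact: smooth_atD.
  rewrite gt_eqF// ltr_wpDl//; apply: (lorentz_perp_ge0 hxs).
  by rewrite lorentzC.
apply: smooth_atD.
  apply: smooth_atZ => //; apply: smooth_atD => //.
  apply: smooth_atZ; last exact: smooth_at_cst.
  by apply: smooth_atM => //; exact: smooth_at_lorentz.
apply: smooth_atZ; first by apply: smooth_atM => //; exact: smooth_atB.
by apply: smooth_atB => //; exact: smooth_at_cst.
Qed.

Lemma smooth_at_row_mx (E : normedModType R) k l (f : E -> 'rV[R]_k)
    (g : E -> 'rV[R]_l) p : smooth_at f p -> smooth_at g p ->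
  smooth_at (fun z => row_mx (f z) (g z)) p.
Proof.
move=> sf sg.
apply: (@smooth_at_eq _ _ _ (fun z => \row_j row_mx (f z) (g z) 0 j)).
  by near=> z; apply/rowP => j; rewrite mxE.
apply: smooth_at_row => j.
have := splitP j; case=> i ji.
  have -> : j = lshift l i by exact: val_inj.
  apply: (@smooth_at_eq _ _ _ (fun z => f z 0 i)); last exact: smooth_at_coord.
  by near=> z; rewrite row_mxEl.
have -> : j = rshift k i by exact: val_inj.
apply: (@smooth_at_eq _ _ _ (fun z => g z 0 i)); last exact: smooth_at_coord.
by near=> z; rewrite row_mxEr.
Unshelve. all: by end_near. Qed.

Let smooth_dom eps (p : W) : smooth_at (fun p : W => kappa + eps * q p.2 om) p.
Proof.
apply: smooth_atD; first exact: smooth_at_cst.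
apply: smooth_atM; first exact: smooth_at_cst.
by apply: smooth_at_lorentz; [exact: smooth_at_snd|exact: smooth_at_cst].
Qed.

Lemma open_cyl_dom eps : open (cyl_dom eps).
Proof.
have -> : cyl_dom eps
    = (fun p : W => kappa + eps * q p.2 om) @^-1` (~` [set 0]).
  by apply/seteqP; split=> p /eqP.
apply: open_comp; last by apply: closed_openC; exact: closed_eq.
by move=> p _; exact: smooth_at_continuous (smooth_dom eps p).
Qed.

Lemma smooth_at_cyl_coord eps p : cyl_dom eps p -> smooth_at (cyl_coord eps) p.
Proof.
move=> D0; have s1 : smooth_at (fun p : W => Pi p.1) p.
  by apply: (smooth_at_comp (finite_coordinates_rV _) (smooth_at_fst _)).
have s2 : smooth_at (fun p : W => Pi p.2) p.
  by apply: (smooth_at_comp (finite_coordinates_rV _) (smooth_at_snd _)).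
apply: smooth_at_row_mx => //; apply: smooth_atZ.
  apply: smooth_atM; first exact: smooth_at_cst.
  by apply: smooth_atV => //; exact: smooth_dom.
apply: smooth_atD => //; apply: smooth_atZ => //; apply: smooth_atM; last exact: smooth_at_cst.
by apply: smooth_at_lorentz; [exact: smooth_at_snd|exact: smooth_at_cst].
Qed.

(** For the reverse inclusion a base curve inside the horosphere is needed: the parabola
    [p.1 + s a + s^2 r om] stays there exactly when [r = q a a / (2 kappa)]. It is then lifted by
    [UT_lift]. *)
Lemma tangent_cylinder p : cylinder p ->
  tangent cylinder p = [set z | tangent (UT R n) p z /\ q z.1 om = 0].
Proof.
move=> [up xo]; have /UTE[hx xv vv] := up; apply/seteqP; split=> z.
  move=> [c [cc c0 cz]]; split.
    by exists c; split=> //; split; [exact: cc.1|apply: filterS cc.2 => s []].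
  have dc := is_derive_fst (smooth_at_is_derive cc.1); rewrite cz in dc.
  have d1 := is_derive_lorentz dc (is_derive_const om (0 : R)).
  rewrite lorentz0r addr0 in d1; apply: (is_derive_unique d1).
  apply: (@is_derive_near_const R R _ 0 (- kappa)).
  by apply: filterS cc.2 => s [].
move=> [tz zo]; have [_ xa vw xw] := (tangent_UT _ _).1 tz.
have ox : q om p.1 = - kappa by rewrite lorentzC.
have ao : q om z.1 = 0 by rewrite lorentzC.
have ax : q z.1 p.1 = 0 by rewrite lorentzC.
pose r := q z.1 z.1 / (2 * kappa).
pose u (s : R) := p.1 + s *: z.1 + (s * s * r) *: om.
have uo s : q (u s) om = - kappa.
  by rewrite /u !lorentzE xo zo om_null; ring.
have hu s : H (u s).
  apply: (hyp_future _ om_null om_future); last by rewrite uo oppr_lt0.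
  rewrite /u !lorentzE om_null xo ox zo ao xa ax (hyp_lorentz hx) /r; field.
  by rewrite kappa_neq0.
have su s : smooth_at u s.
  have si : smooth_at (fun s : R => s) s by exact: smooth_at_id.
  apply: smooth_atD.
    apply: smooth_atD; first exact: smooth_at_cst.
    by apply: smooth_atZ => //; exact: smooth_at_cst.
  apply: smooth_atZ; last exact: smooth_at_cst.
  by apply: smooth_atM; [exact: smooth_atM|exact: smooth_at_cst].
have cu s : curve_at H u s by split=> //; near=> t; exact: hu.
have u0 : u 0 = p.1 by rewrite /u !mul0r !scale0r !addr0.
have du : is_derive (0 : R) 1 u z.1.
  have di := is_derive_id (0 : R) 1.
  have d1 := is_derive_add (is_derive_const p.1 (0 : R))
    (is_derive_scale di (is_derive_const z.1 (0 : R))).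
  have d2 := is_derive_scale (is_derive_scale (is_derive_scale di di)
    (is_derive_const r (0 : R))) (is_derive_const om (0 : R)).
  apply: (is_derive_eq (is_derive_add d1 d2)).
  by apply/rowP => j; rewrite !mxE /GRing.scale/=; ring.
have [_ du1] := du.
have [||c [cc c0 dc]] := @UT_lift _ _ u p.2 z.2 (cu 0) _ vw _.
- by rewrite u0; case: (p) up.
- by rewrite u0 du1.
exists (fun s => (u s, c s)); split=> //.
- split; first exact: cc.1.
  by apply: filterS cc.2 => s hs; split=> //; exact: uo.
- by rewrite u0 c0 -surjective_pairing.
- by have [_ ->] := is_derive_pair du dc; rewrite -surjective_pairing.
Unshelve. all: by end_near. Qed.

End Charts.

(** * Leaves *)

Section Trivialization.
Context {R : realType} {n : nat}.
Local Notation V := 'rV[R]_n.+1.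
Local Notation W := (V * V)%type.
Local Notation q := (@lorentz R n).
Local Notation H := (hyp R n).

Implicit Types (x v : V) (y : 'rV[R]_n).

Let e0 : V := delta_mx 0 ord0.

Let lorentz_e0 x : q x e0 = - x 0 ord0.
Proof.
rewrite /lorentz /e0 big1 => [|i _]; first by rewrite !mxE !eqxx mulr1 addr0.
by rewrite !mxE /= mulr0.
Qed.

Definition space_embed (y : 'rV[R]_n) : V :=
  \row_j (if unlift ord0 j is Some i then y 0 i else 0).

Definition space_part (v : V) : 'rV[R]_n := \row_i v 0 (lift ord0 i).

Lemma space_part_embed y : space_part (space_embed y) = y.
Proof. by apply/rowP => i; rewrite !mxE liftK. Qed.

Lemma space_embed_part v : v 0 ord0 = 0 -> space_embed (space_part v) = v.
Proof.
by move=> v0; apply/rowP => j; rewrite !mxE; case: unliftP => [i ->|->]; rewrite ?mxE.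
Qed.

Let space_embed0 y : space_embed y 0 ord0 = 0.
Proof. by rewrite mxE unlift_none. Qed.

Let lorentz_space_embed y : q (space_embed y) (space_embed y) = \sum_i y 0 i ^+ 2.
Proof.
rewrite /lorentz space_embed0 mul0r oppr0 add0r.
by apply: eq_bigr => i _; rewrite !mxE liftK expr2.
Qed.

(* The Lorentz boost along the geodesic between x and e0 identifies T_x with
   the Euclidean space e0^perp. *)
Definition boost_to_base (p : W) : V * 'rV[R]_n :=
  (p.1, space_part (p.2 - (p.2 0 ord0 / (1 + p.1 0 ord0)) *: (p.1 + e0))).

Definition boost_from_base (p : V * 'rV[R]_n) : W :=
  (p.1, space_embed p.2
     + (q (space_embed p.2) p.1 / (1 + p.1 0 ord0)) *: (p.1 + e0)).

Let hyp_coord_neq0 x : H x -> 1 + x 0 ord0 != 0.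
Proof. by move=> [_ x0]; rewrite gt_eqF// addr_gt0. Qed.

Let lorentz_e0l x : q e0 x = - x 0 ord0. Proof. by rewrite lorentzC. Qed.

Let e0_coord : e0 0 ord0 = 1. Proof. by rewrite mxE !eqxx. Qed.

Lemma boost_to_base_sphere p : UT R n p -> unit_sphere R n (boost_to_base p).2.
Proof.
move=> /UTE[hx xv vv]; have x1 := hyp_coord_neq0 hx; have xx := hyp_lorentz hx.
case: p hx xv vv x1 xx => x v /= hx xv vv x1 xx.
rewrite /unit_sphere /= -lorentz_space_embed space_embed_part; last first.
  by rewrite !mxE !eqxx /= ?mulr1n; field.
rewrite !lorentzE !lorentz_e0 !lorentz_e0l e0_coord (lorentzC v) xv vv xx; field.
by [].
Qed.

Lemma boost_from_base_UT (p : V * 'rV[R]_n) : H p.1 -> unit_sphere R n p.2 ->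
  UT R n (boost_from_base p).
Proof.
move=> hx; have x1 := hyp_coord_neq0 hx; have xx := hyp_lorentz hx.
case: p hx x1 xx => x y /= hx x1 xx.
rewrite /unit_sphere /= -lorentz_space_embed => yy; apply/UTE; rewrite /boost_from_base /=.
have s0 := space_embed0 y; move: (space_embed y) yy s0 => s ss s0.
split=> //; rewrite !lorentzE !lorentz_e0 ?lorentz_e0l ?e0_coord ?s0 (lorentzC x s) xx ?ss.
  by field.
by field.
Qed.

Lemma boost_to_baseK p : UT R n p -> boost_from_base (boost_to_base p) = p.
Proof.
move=> /UTE[hx xv vv]; have x1 := hyp_coord_neq0 hx; have xx := hyp_lorentz hx.
case: p hx xv vv x1 xx => x v /= hx xv vv x1 xx.
rewrite /boost_from_base /boost_to_base /=; congr pair.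
rewrite space_embed_part; last by rewrite !mxE !eqxx /= ?mulr1n; field.
rewrite !lorentzE lorentz_e0l (lorentzC v) xv xx.
by apply/rowP => j; rewrite !mxE; field.
Qed.

Lemma boost_from_baseK (p : V * 'rV[R]_n) : H p.1 -> boost_to_base (boost_from_base p) = p.
Proof.
move=> hx; have x1 := hyp_coord_neq0 hx.
case: p hx x1 => x y /= hx x1; rewrite /boost_from_base /boost_to_base /=.
congr pair; rewrite -[RHS]space_part_embed; congr space_part.
have s0 := space_embed0 y; move: (space_embed y) s0 => s s0.
have -> : (s + (q s x / (1 + x 0 ord0)) *: (x + e0)) 0 ord0 = q s x.
  by rewrite !mxE s0 !eqxx /= ?mulr1n; field.
by rewrite addrK.
Qed.

Lemma smooth_at_boost_to_base (p : W) : H p.1 -> smooth_at boost_to_base p.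
Proof.
move=> hx; have s1 : smooth_at (fst : W -> V) p by exact: smooth_at_fst.
have s2 : smooth_at (snd : W -> V) p by exact: smooth_at_snd.
apply: smooth_at_pair => //; apply: smooth_at_row => j.
apply: (smooth_at_coord (f := fun p : W =>
  p.2 - (p.2 0 ord0 / (1 + p.1 0 ord0)) *: (p.1 + e0))).
apply: smooth_atB => //; apply: smooth_atZ.
  apply: smooth_atM; first exact: smooth_at_coord.
  apply: smooth_atV; first exact: hyp_coord_neq0.
  by apply: smooth_atD; [exact: smooth_at_cst|exact: smooth_at_coord].
by apply: smooth_atD => //; exact: smooth_at_cst.
Qed.

Lemma smooth_at_boost_from_base (p : V * 'rV[R]_n) : H p.1 -> smooth_at boost_from_base p.
Proof.
move=> hx; have s1 : smooth_at (fst : V * 'rV[R]_n -> V) p by exact: smooth_at_fst.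
have s2 : smooth_at (snd : V * 'rV[R]_n -> _) p by exact: smooth_at_snd.
have s3 : smooth_at (fun p : V * 'rV[R]_n => space_embed p.2) p.
  apply: smooth_at_row => j; case: (unlift ord0 j) => [i|].
    exact: smooth_at_coord.
  exact: smooth_at_cst.
apply: smooth_at_pair => //; apply: smooth_atD => //; apply: smooth_atZ.
  apply: smooth_atM; first exact: smooth_at_lorentz.
  apply: smooth_atV; first exact: hyp_coord_neq0.
  by apply: smooth_atD; [exact: smooth_at_cst|exact: smooth_at_coord].
by apply: smooth_atD => //; exact: smooth_at_cst.
Qed.

Lemma horocylinder_diffeomorphic (b : V -> R) c :
  diffeomorphic (horocylinder b c) (horosphere b c `*` unit_sphere R n).
Proof.
exists boost_to_base, boost_from_base; split.
- split=> [|p [up hp]]; last by split=> //; exact: boost_to_base_sphere.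
  by apply: smooth_map_at => p [/UTE[hx _ _] _]; exact: smooth_at_boost_to_base.
- split=> [|p [[hx bp] sp]].
    by apply: smooth_map_at => p [[hx _] _]; exact: smooth_at_boost_from_base.
  by split; [exact: boost_from_base_UT|split].
- by move=> p [up _]; exact: boost_to_baseK.
- by move=> p [[hx _] _]; exact: boost_from_baseK.
Qed.

End Trivialization.

(** * Cylinders as maximal connected integral submanifolds *)

Section Leaves.
Context {R : realType} {n : nat}.
Local Notation V := 'rV[R]_n.+1.
Local Notation W := (V * V)%type.
Local Notation q := (@lorentz R n).
Local Notation H := (hyp R n).
Local Notation UTn := (UT R n).
Variables (b : V -> R) (om : V).
Hypotheses (n_ge2 : (2 <= n)%N).
Hypotheses (om_null : q om om = 0) (om_future : 0 < om 0 ord0).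
Hypothesis (bE : forall x, H x -> b x = ln (- q x om)).
Hypothesis (om_ray : exists x u, [/\ H x, q x u = 0, q u u = 1 & om = x + u]).

Lemma busemann_level x c : H x -> b x = c <-> q x om = - expR c.
Proof.
move=> hx; have x0 := lorentz_om_lt0 om_null om_future hx.
rewrite bE//; split=> [<-|->]; last by rewrite opprK expRK.
by rewrite lnK ?opprK// posrE oppr_gt0.
Qed.

Lemma horocylinderE c : horocylinder b c = cylinder om (expR c).
Proof.
apply/seteqP; split=> p.
  by move=> [up [hx /= bp]]; split=> //; apply/busemann_level.
move=> [up xo]; have /UTE[hx _ _] := up; split=> //; split=> //.
exact/busemann_level.
Qed.

Lemma horosphere_nonempty c : exists2 x, H x & q x om = - expR c.
Proof.
have [x [u [hx xu uu ->]]] := om_ray.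
(* The Busemann function equals [- t] at time [t] of the ray, so level [c] is met at time [- c], on
   the backward extension of the ray when [c > 0]. *)
exists (ch (- c) *: x + sh (- c) *: u).
  by apply: hyp_combination; rewrite ?ch_gt0// uu mul1r ch2_sh2.
rewrite !lorentzE xu uu (lorentzC u) xu (hyp_lorentz hx) /ch /sh opprK.
by field.
Qed.

Lemma horocylinder_nonempty c : horocylinder b c !=set0.
Proof.
have [x hx xo] := horosphere_nonempty c; rewrite horocylinderE.
have x0 : q x om != 0 by rewrite xo oppr_eq0 gt_eqF// expR_gt0.
have xp := xi_field_perp om_null om_future hx.
exists (x, xi_field om x); split=> //; apply/UTE; split=> //=.
rewrite lorentz_xi_field// /xi_field !lorentzE om_null mulr0 addr0.
by rewrite divff.
Qed.

(** Every chart is parametrized by a full vector space, so a set open and closed for the atlas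
    contains a chart image or misses it. Connectedness then only needs one point common to all chart
    images. *)
Lemma horocylinder_integral c : exists k U phi,
  @integral_atlas R W UTn (Db b) k (horocylinder b c) U phi
  /\ atlas_connected (horocylinder b c) U phi.
Proof.
have [xs hxs xs_om] := horosphere_nonempty c; rewrite horocylinderE.
have k0 := expR_gt0 c; move: (expR c) k0 xs_om => kappa k0 xs_om.
have [m [L [Pi [[sL sPi] [PiL PiK] Lp LPi [y0 y01]]]]] :=
  horosphere_coordinates n_ge2 k0 om_null hxs xs_om.
(* The atlas is indexed by [nat]: chart [0] uses the pole [grad b], and all later charts repeat the
   one with pole [- grad b]. *)
pose eps (i : nat) : R := if i is 0%N then 1 else -1.
have eps2 i : eps i ^+ 2 = 1 by case: i => [|i]; rewrite /eps ?sqrrN expr1n.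
pose phi i := cyl_chart om xs kappa L (eps i).
pose psi i := cyl_coord om kappa Pi (eps i).
pose O i := cyl_dom om kappa (eps i).
have sphi i u : smooth_at (phi i) u.
  exact: (smooth_at_cyl_chart kappa hxs sL Lp).
have Nphi i u : cylinder om kappa (phi i u) /\ O i (phi i u).
  exact: (cyl_chart_in k0 om_null om_future hxs xs_om Lp u (eps2 i)).
have phiK i u : psi i (phi i u) = u.
  exact: (cyl_chartK k0 om_null om_future hxs xs_om PiL PiK Lp LPi u (eps2 i)).
have psiK i p : cylinder om kappa p -> O i p -> phi i (psi i p) = p.
  exact: (cyl_coordK k0 om_null hxs xs_om PiL LPi (eps2 i)).
have oO i : open (O i) by exact: open_cyl_dom.
have spsi i p : O i p -> smooth_at (psi i) p by exact: smooth_at_cyl_coord.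
have cov p : cylinder om kappa p -> exists i, O i p.
  move=> _; have [e|e] := eqVneq (kappa + eps 0%N * q p.2 om) 0; last by exists 0%N.
  exists 1%N; rewrite /O /cyl_dom /=; apply/eqP => e'.
  by move: e e'; rewrite /eps mul1r mulN1r => e e'; move: k0; lra.
exists (m + m)%N, (fun=> setT), phi; split.
  split; first exact: immersed_atlas_of_charts sphi Nphi phiK psiK oO spsi cov.
    by move=> p [].
  move=> i u _; have [Np Op] := Nphi i u.
  rewrite (range_chart_tangent (sphi i u) _ (phiK i u) (psiK i) (oO i) Op (spsi i _ Op));
    last by move=> v; have [] := Nphi i v.
  rewrite (tangent_cylinder k0 om_null om_future Np).
  by apply/seteqP; split=> z /(DbE om_null om_future bE).
move=> A AN [p Ap] oA oC.
have full i u : A (phi i u) -> forall v, A (phi i v).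
  move=> Au v; apply: (@clopen_full R _ (phi i @^-1` A) u v) => //.
    by have := oA i; rewrite setTI.
  have := oC i; rewrite setTI; congr open; apply/seteqP; split=> w /=.
    by move=> [].
  by move=> nA; split=> //; have [] := Nphi i w.
have [i Oi] := cov _ (AN _ Ap).
(* A unit vector tangent to the horosphere has [q v om = 0] and so avoids both poles. *)
pose o : W := (xs, L y0); have [yo yx] := Lp y0.
have No : cylinder om kappa o by split=> //; apply/UTE; split=> //=; rewrite lorentzC.
have Oo j : O j o by rewrite /O /cyl_dom /= yo mulr0 addr0 gt_eqF.
have Ao : A o.
  by rewrite -(psiK i o No (Oo i)); apply: (full i (psi i p)); rewrite psiK//; exact: AN.
apply/seteqP; split=> // r Nr; have [j Oj] := cov r Nr.
rewrite -(psiK j r Nr Oj); apply: (full j (psi j o)).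
by rewrite psiK.
Qed.

Lemma connected_integral_sub_horocylinder (N : set W) p :
  connected_integral_submanifold UTn (Db b) N -> N p ->
  N `<=` horocylinder b (b p.1).
Proof.
move=> cN Np; have NM : N `<=` UTn by have [k [U [phi [[_ ? _] _]]]] := cN.
pose fq (v : V) : R := q v om.
have lfq : linear fq by move=> r u v; rewrite /fq lorentzDl lorentzZl.
pose fM := GRing.isLinear.Build _ _ _ _ _ lfq.
pose fL : {linear V -> R} := HB.pack fq fM.
have cf : continuous (fL \o fst : {linear W -> R}).
  move=> z; apply: smooth_at_continuous.
  by apply: smooth_at_lorentz; [exact: smooth_at_fst|exact: smooth_at_cst].
have fD z w : Db b z w -> (fL \o fst : {linear W -> R}) w = 0.
  by move=> /(DbE om_null om_future bE)[].
have const := connected_integral_const cf fD cN Np.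
have /UTE[hp _ _] := NM _ Np.
move=> r Nr; rewrite horocylinderE; split; first exact: NM.
have := const r Nr; rewrite /= /fq => ->.
exact/busemann_level.
Qed.

(** A connected integral submanifold lies in the cylinder through any of its points. Maximality of a
    leaf therefore makes it that cylinder, and anything larger than a cylinder is contained in a
    cylinder of the same level. *)
Lemma leaf_horocylinder (N : set W) :
  leaf UTn (Db b) N <-> exists c : R, N = horocylinder b c.
Proof.
split=> [[cN [p Np] maxN]|[c ->]].
  exists (b p.1); apply/esym; apply: maxN; first exact: horocylinder_integral.
  exact: connected_integral_sub_horocylinder.
split; [exact: horocylinder_integral|exact: horocylinder_nonempty|].
move=> N' cN' sub; have [p Hp] := horocylinder_nonempty c.
have := connected_integral_sub_horocylinder cN' (sub _ Hp).
have [_ [_ /= ->]] := Hp => sub'.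
by apply/seteqP; split.
Qed.

Lemma Db_integrable : integrable_distribution UTn (Db b).
Proof.
move=> p up; exists (horocylinder b (b p.1)); last first.
  by split=> //; have /UTE[] := up.
by have [k [U [phi [? _]]]] := horocylinder_integral (b p.1); exists k, U, phi.
Qed.

End Leaves.

Theorem theorem5p1 (R : realType) (n : nat) (n_ge2 : (2 <= n)%N)
    (b : 'rV[R]_n.+1 -> R) (hb : busemann b)
    (nabla : ('rV[R]_n.+1 * 'rV[R]_n.+1 -> 'rV[R]_n.+1 * 'rV[R]_n.+1) ->
             ('rV[R]_n.+1 * 'rV[R]_n.+1 -> 'rV[R]_n.+1 * 'rV[R]_n.+1) ->
             'rV[R]_n.+1 * 'rV[R]_n.+1 -> 'rV[R]_n.+1 * 'rV[R]_n.+1)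
    (nabla_conn : affine_connection (UT R n) nabla)
    (nabla_xi : forall X, vfield (UT R n) X ->
       forall p, UT R n p -> nabla X (xi_lift b) p = 0)
    (nabla_metric : metric_compatible (UT R n) sasaki nabla)
    (nabla_torsion : forall X Y,
       dsection (UT R n) (Db b) X -> dsection (UT R n) (Db b) Y ->
       dsection (UT R n) (Db b) (torsion (UT R n) nabla X Y)) :
  [/\ (forall p, UT R n p -> direct_sum (Db b p) (ker_db_lift b p) (vertical p)),
      involutive_distribution (UT R n) (Db b) /\
        integrable_distribution (UT R n) (Db b),
      (forall X Y, dsection (UT R n) (Db b) X -> dsection (UT R n) (Db b) Y ->
         dsection (UT R n) (Db b) (nabla X Y)),
      (forall N, leaf (UT R n) (Db b) N <-> exists c : R, N = horocylinder b c)
    & (forall c : R,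
         diffeomorphic (horocylinder b c) (horosphere b c `*` unit_sphere R n))].
Proof.
have [om [om_null om_future om_ray bE]] := busemannE hb.
split.
- by move=> p; exact: (Db_direct_sum om_null om_future bE).
- split; last exact: (Db_integrable n_ge2 om_null om_future bE om_ray).
  move=> X Y DX DY; have DT := nabla_torsion X Y DX DY.
  exact: (lie_bracket_Db om_null om_future bE nabla_conn nabla_xi nabla_metric DT).
- move=> X Y.
  exact: (nabla_Db om_null om_future bE nabla_conn nabla_xi nabla_metric).
- by move=> N; exact: leaf_horocylinder n_ge2 om_null om_future bE om_ray N.
- by move=> c; exact: horocylinder_diffeomorphic.
Qed.
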